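(* Let $(X_t\colon t\in\mathbb{Z})$ be a weakly stationary zero-mean process with values in $H=L^2([0,1])$ satisfying $\sum_{h\in\mathbb{Z}}\|C_h\|_{\mathcal{S}}<\infty$, with dynamic functional principal component scores $Y_{mt}=\sum_{\ell\in\mathbb{Z}}\langle X_{t-\ell},\phi_{m\ell}\rangle$, $m\ge1$, $t\in\mathbb{Z}$. Then: (a) the series defining $Y_{mt}$ is mean-square convergent, with $$EY_{mt}=0\quad\text{and}\quad E|Y_{mt}|^2=\sum_{\ell\in\mathbb{Z}}\sum_{k\in\mathbb{Z}}\langle C_{\ell-k}(\phi_{m\ell}),\phi_{mk}\rangle;$$ (b) the dynamic FPC scores $Y_{mt}$ and $Y_{m's}$ are uncorrelated for all $s,t\in\mathbb{Z}$ and $m\ne m'$; in other words, if $Y_t=(Y_{1t},\dots,Y_{pt})'$ denotes the $p$-dimensional score vector and $C^Y_h$ its lag-$h$ covariance matrix, then $C^Y_h$ is diagonal for all $h$; (c) the long-run covariance matrix of the score vector process $(Y_t)$ is $$\lim_{n\to\infty}\frac1n\operatorname{Var}(Y_1+\cdots+Y_n)=2\pi\,\mathrm{diag}(\lambda_1(0),\dots,\lambda_p(0)).$$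
   Context: $H=L^2([0,1])$ is the Hilbert space of complex-valued square-integrable functions on $[0,1]$, with $\langle x,y\rangle=\int_0^1x(u)\overline{y(u)}\,du$ and $\|x\|=\langle x,x\rangle^{1/2}$. For complex random variables $\mathrm{cov}(X,Y)=E(X-EX)\overline{(Y-EY)}$; for a random vector $Z$, $\operatorname{Var}(Z)=E(Z-EZ)(Z-EZ)^*$. A zero-mean $H$-valued process $(X_t\colon t\in\mathbb{Z})$ is weakly stationary if $E\|X_t\|^2<\infty$, $EX_t=0$ and $c_h(u,v):=E[X_{t+h}(u)\overline{X_t(v)}]$ does not depend on $t$. $C_h$ is the operator with kernel $c_h$, i.e. $C_h(x)(u)=\int_0^1c_h(u,v)x(v)\,dv$, and $\|\cdot\|_{\mathcal{S}}$ is the Hilbert--Schmidt norm. Spectral density operator: $\mathcal{F}^X_\theta:=\frac{1}{2\pi}\sum_{h\in\mathbb{Z}}C_he^{-\mathrm{i}h\theta}$, $\theta\in[-\pi,\pi]$; it is non-negative, self-adjoint and Hilbert--Schmidt, with spectral representation $\mathcal{F}^X_\theta(x)=\sum_{m\ge1}\lambda_m(\theta)\langle x,\varphi_m(\theta)\rangle\varphi_m(\theta)$, where $\lambda_1(\theta)\ge\lambda_2(\theta)\ge\cdots\ge0$ and the eigenfunctions $\varphi_m(\theta)=\varphi_m(\cdot|\theta)$ are orthonormal. A version of the eigenfunctions is fixed such that $(u,\theta)\mapsto\varphi_m(u|\theta)$ is jointly measurable. Dynamic FPC filter coefficients: $\phi_{m\ell}(u):=\frac{1}{2\pi}\int_{-\pi}^{\pi}\varphi_m(u|s)e^{-\mathrm{i}\ell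 s}\,ds$ for (almost every) $u$ such that $\varphi_m(u|\cdot)\in L^2([-\pi,\pi])$, and $\phi_{m\ell}(u):=0$ otherwise. Series over $\mathbb{Z}$ are limits of the partial sums over $\{-N,\dots,N\}$ as $N\to\infty$. *)

(* Defs.v *)
From HB Require Import structures.
From mathcomp Require Import all_boot all_order all_algebra.
From mathcomp Require Import all_classical all_reals all_analysis.
From mathcomp Require Export complex.

Set Implicit Arguments.
Unset Strict Implicit.
Unset Printing Implicit Defensive.

Import Order.TTheory GRing.Theory Num.Theory.
Import numFieldNormedType.Exports Normc.

Local Open Scope classical_set_scope.
Local Open Scope ring_scope.
Local Open Scope complex_scope.

Section ComplexIntegration.
Context {R : realType}.

Definition ccvg (s : nat -> R[i]) (l : R[i]) : Prop :=
  (s : nat -> R[i]^o) @ \oo --> (l : R[i]^o).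

(* e^{i x} for real x *)
Definition expi (x : R) : R[i] := cos x +i* sin x.

(* sum over h in {-N, ..., N} *)
Definition zsum (N : nat) (f : int -> R[i]) : R[i] :=
  \sum_(k < N.*2.+1) f (k%:Z - N%:Z).

(* sum over Z, as the limit of the sums over {-N, ..., N} *)
Definition zseries_cvg (f : int -> R[i]) (l : R[i]) : Prop :=
  ccvg (fun N => zsum N f) l.

Context {d : measure_display} {T : measurableType d}.
Implicit Types (mu : {measure set T -> \bar R}) (D : set T) (f : T -> R[i]).

Definition cmeasurable D f : Prop :=
  measurable_fun D (fun t => complex.Re (f t)) /\
  measurable_fun D (fun t => complex.Im (f t)).

Definition cintegral mu D f : R[i] :=
  \int[mu]_(t in D) complex.Re (f t) +i* \int[mu]_(t in D) complex.Im (f t).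

(* squared L^2 norm, possibly +oo *)
Definition sqnorm mu D f : \bar R :=
  (\int[mu]_(t in D) (normc (f t) ^+ 2)%:E)%E.

Definition cL2 mu D f : Prop := cmeasurable D f /\ (sqnorm mu D f < +oo)%E.

End ComplexIntegration.

Section Hilbert.
Context {R : realType}.

Definition unit_itv : set (measurableTypeR R) := [set` `[0 : R, 1 : R]].

Definition pi_itv : set (measurableTypeR R) := [set` `[- pi : R, pi : R]].

(* Elements of H = L^2([0,1]) are represented by functions x with inH x; two
   functions represent the same element when they agree a.e. on [0,1].  Values
   outside [0,1] play no role. *)
Definition inH (x : R -> R[i]) : Prop := cL2 lebesgue_measure unit_itv x.

Definition sqnormH (x : R -> R[i]) : \bar R :=
  sqnorm lebesgue_measure unit_itv x.

Definition dotH (x y : R -> R[i]) : R[i] :=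
  cintegral lebesgue_measure unit_itv (fun u => x u * (y u)^*).

Definition orthonormalH (e : nat -> R -> R[i]) : Prop :=
  (forall j, inH (e j)) /\ (forall j k, dotH (e j) (e k) = (j == k)%:R).

Definition orthonormal_basisH (e : nat -> R -> R[i]) : Prop :=
  orthonormalH e /\
  forall x, inH x ->
    sqnormH (fun u => x u - \sum_(j < n) dotH x (e j) * e j u)
      @[n --> \oo] --> 0%E.

(* Hilbert-Schmidt norm, computed in the orthonormal basis e (its value does
   not depend on e) *)
Definition HSnorm (e : nat -> R -> R[i]) (A : (R -> R[i]) -> R -> R[i])
    : \bar R :=
  ((\sum_(0 <= j <oo) sqnormH (A (e j))) `^ (2^-1))%E.

(* A maps representatives to representatives, so linearity is required a.e. *)
Definition bounded_linearH (A : (R -> R[i]) -> R -> R[i]) : Prop :=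
  [/\ forall x, inH x -> inH (A x),
      forall a x y, inH x -> inH y ->
        {ae lebesgue_measure, forall u, unit_itv u ->
          A (fun v => a * x v + y v) u = a * A x u + A y u}
    & exists K : R, forall x, inH x ->
        (sqnormH (A x) <= K%:E * sqnormH x)%E].

Definition kernel_op (k : R -> R -> R[i]) (x : R -> R[i]) (u : R) : R[i] :=
  cintegral lebesgue_measure unit_itv (fun v => k u v * x v).

(* F theta is the Hilbert-Schmidt limit of
   (2 pi)^{-1} sum_{|h| <= N} e^{-i h theta} C_h *)
Definition spectral_density_op (e : nat -> R -> R[i])
    (C : int -> (R -> R[i]) -> R -> R[i])
    (F : R -> (R -> R[i]) -> R -> R[i]) : Prop :=
  forall theta : R, pi_itv theta ->
    bounded_linearH (F theta) /\
    HSnorm e (fun x u => F theta x u -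
        ((2 * pi)^-1)%:C *
          zsum N (fun h => C h x u * expi (- (h%:~R * theta))))
      @[N --> \oo] --> 0%E.

(* Here, and for everything indexed by the order of an eigenvalue, the natural
   number m stands for the (m+1)-st item. *)
Definition spectral_representation (A : (R -> R[i]) -> R -> R[i])
    (lambda : nat -> R) (phi : nat -> R -> R[i]) : Prop :=
  [/\ forall m, 0 <= lambda m,
      forall m, lambda m.+1 <= lambda m,
      orthonormalH phi
    & forall x, inH x ->
        sqnormH (fun u => A x u -
            \sum_(m < n) (lambda m)%:C * dotH x (phi m) * phi m u)
          @[n --> \oo] --> 0%E].

(* phi m theta u is phi_m(u|theta) *)
Definition fpc_filter (phi : nat -> R -> R -> R[i]) (m : nat) (l : int)
    (u : R) : R[i] :=
  if `[< cL2 lebesgue_measure pi_itv (fun s => phi m s u) >] then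
    ((2 * pi)^-1)%:C *
    cintegral lebesgue_measure pi_itv
      (fun s => phi m s u * expi (- (l%:~R * s)))
  else 0.

End Hilbert.

Section Probability.
Context {R : realType} {d : measure_display} {Omega : measurableType d}.
Variable P : probability Omega R.

Definition cE (Z : Omega -> R[i]) : R[i] := cintegral P setT Z.

Definition ccov (Z W : Omega -> R[i]) : R[i] :=
  cE (fun w => (Z w - cE Z) * (W w - cE W)^*).

Definition expect_mx {m n : nat} (Z : Omega -> 'M[R[i]]_(m, n)) : 'M[R[i]]_(m, n) :=
  \matrix_(i, j) cE (fun w => Z w i j).

Definition covmx {p : nat} (Z W : Omega -> 'cV[R[i]]_p) : 'M[R[i]]_p :=
  expect_mx (fun w => (Z w - expect_mx Z) *m (map_mx Num.conj (W w - expect_mx W))^T).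

Definition varmx {p : nat} (Z : Omega -> 'cV[R[i]]_p) : 'M[R[i]]_p :=
  covmx Z Z.

Definition ms_cvg (S : nat -> Omega -> R[i]) (Y : Omega -> R[i]) : Prop :=
  cL2 P setT Y /\
  sqnorm P setT (fun w => S N w - Y w) @[N --> \oo] --> 0%E.

(* An H-valued process, each X t being given by a jointly measurable version
   (w, u) |-> X t w u. *)
Definition H_process (X : int -> Omega -> R -> R[i]) : Prop :=
  forall t,
    cmeasurable ([set: Omega] `*` unit_itv)
      (fun q : Omega * measurableTypeR R => X t q.1 q.2) /\
    forall w, inH (X t w).

(* c_h(u,v), read off at t = 0 *)
Definition autocov_kernel (X : int -> Omega -> R -> R[i]) (h : int) (u v : R)
    : R[i] :=
  cE (fun w => X h w u * (X 0 w v)^*).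

Definition autocov_op (X : int -> Omega -> R -> R[i]) (h : int)
    : (R -> R[i]) -> R -> R[i] :=
  kernel_op (autocov_kernel X h).

(* Equalities in H and in L^2([0,1]^2) are a.e. equalities. *)
Definition weakly_stationary (X : int -> Omega -> R -> R[i]) : Prop :=
  [/\ forall t, (\int[P]_w sqnormH (X t w) < +oo)%E,
      forall t, {ae lebesgue_measure, forall u, unit_itv u ->
        cE (fun w => X t w u) = 0}
    & forall t h : int,
        {ae (@lebesgue_measure R \x @lebesgue_measure R)%E,
          forall q : R * R, unit_itv q.1 -> unit_itv q.2 ->
            cE (fun w => X (t + h) w q.1 * (X t w q.2)^*) =
            autocov_kernel X h q.1 q.2}].

(* partial sums of the series defining the score Y_{mt} *)
Definition score_psum (X : int -> Omega -> R -> R[i])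
    (phi : nat -> R -> R -> R[i]) (m : nat) (t : int) (N : nat) (w : Omega)
    : R[i] :=
  zsum N (fun l => dotH (X (t - l) w) (fpc_filter phi m l)).

Definition score_vec (Y : nat -> int -> Omega -> R[i]) (p : nat) (t : int)
    (w : Omega) : 'cV[R[i]]_p :=
  \col_(i < p) Y i t w.

End Probability.

(* Main.v *)
Require Import Defs.
From HB Require Import structures.
From mathcomp Require Import all_boot all_order all_algebra.
From mathcomp Require Import all_classical all_reals all_analysis.
From mathcomp Require Import measurable_realfun lebesgue_Rintegral simple_functions.
From mathcomp Require Import zify ring lra.

(** All assertions about the scores follow from one computation in the
    frequency domain.

    By Fubini's theorem the coordinates <X_t, f> of the process are square
    integrable with mean zero, and E <X_s, f> conj <X_t, g> equals
    <C_(s-t) g, f> [coordinate_covariance].  The covariance of two partial sums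
    of scores is therefore a finite double sum of forms of the operators C_h.
    The filters phi_(m,l) are the Fourier coefficients of the function
    theta |-> phi_m(theta) with values in H, so by orthogonality of the
    exponentials this double sum is an integral over the frequency: the form of
    the truncated series of F_theta, evaluated at Fourier partial sums of phi_m
    and phi_m', times e^(i j theta) with j the lag [trunc_ip_trigpoly].

    As the norms of the C_h are summable, the truncated forms are bounded by a
    common multiple of the product of the norms of their arguments, and they
    converge to the form of F_theta.  The Fourier partial sums converge to
    phi_m in L^2([-pi, pi]; H): this is Parseval's theorem in each section
    [filter_psum_cvg], and rests on the completeness of the trigonometric
    system [fourier_cvg_L2].  Hence the covariances of the partial sums of
    orders N and M converge jointly, as N and M tend to infinity, to the
    integral of <F_theta phi_m'(theta), phi_m(theta)> e^(i j theta)
    [score_covariance_bound].  Since the phi_m(theta) are orthonormal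
    eigenvectors, the limit is the integral of lambda_m(theta) e^(i j theta)
    for m = m', and 0 otherwise.

    Joint convergence makes the partial sums a Cauchy sequence, and L^2(P) is
    complete [L2_complete], so the scores exist.  Their means and covariances
    are limits by continuity of the inner product, which gives the iterated
    series for the second moment and the absence of correlation.  Finally the
    variance of a sum of n successive scores, divided by n, is the integral of
    lambda_m against the Fejer kernel; this has mass 2 pi and concentrates at
    0, where lambda_m is continuous because F_theta is continuous in theta and
    eigenvalues depend continuously on the operator [weyl_inequality]. *)

Set Implicit Arguments.
Unset Strict Implicit.
Unset Printing Implicit Defensive.

Import Order.TTheory GRing.Theory Num.Theory.
Import numFieldNormedType.Exports Normc.

Local Open Scope classical_set_scope.
Local Open Scope ring_scope.
Local Open Scope complex_scope.

(* On R[i] the conjugations of complex_scope and ring_scope are convertible;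
   the latter, which has the richer theory, is used throughout. *)
Local Notation "z ^*" := (Num.conj z) : complex_scope.

(** * Complex numbers *)

Section ComplexNumbers.
Context {R : realType}.
Implicit Types (z w : R[i]) (x y : R).

Lemma Re_add z w : complex.Re (z + w) = complex.Re z + complex.Re w.
Proof. by case: z w => a b []. Qed.

Lemma Im_add z w : complex.Im (z + w) = complex.Im z + complex.Im w.
Proof. by case: z w => a b []. Qed.

Lemma Re_opp z : complex.Re (- z) = - complex.Re z.
Proof. by case: z. Qed.

Lemma Im_opp z : complex.Im (- z) = - complex.Im z.
Proof. by case: z. Qed.

Lemma Re_mul z w : complex.Re (z * w) =
  complex.Re z * complex.Re w - complex.Im z * complex.Im w.
Proof. by case: z w => a b []. Qed.

Lemma Im_mul z w : complex.Im (z * w) =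
  complex.Re z * complex.Im w + complex.Im z * complex.Re w.
Proof. by case: z w => a b []. Qed.

Lemma Re_conj z : complex.Re z^* = complex.Re z. Proof. by case: z. Qed.

Lemma Im_conj z : complex.Im z^* = - complex.Im z. Proof. by case: z. Qed.

Lemma complex_eq z w :
  complex.Re z = complex.Re w -> complex.Im z = complex.Im w -> z = w.
Proof. by case: z w => a b [c e] /= -> ->. Qed.

Lemma sqr_normcE z : normc z ^+ 2 = complex.Re z ^+ 2 + complex.Im z ^+ 2.
Proof. by case: z => a b /=; rewrite sqr_sqrtr// addr_ge0// sqr_ge0. Qed.

Lemma normc_ge0 z : 0 <= normc z.
Proof. by case: z => a b /=; rewrite sqrtr_ge0. Qed.

Lemma normc_conj z : normc z^* = normc z.
Proof. by case: z => a b /=; rewrite sqrrN. Qed.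

Lemma mulc_conj z : z * z^* = (normc z ^+ 2)%:C.
Proof.
by apply: complex_eq; rewrite ?Re_mul ?Im_mul !Re_conj !Im_conj /= ?sqr_normcE; ring.
Qed.

Lemma normc_real x : normc x%:C = `|x|.
Proof. by rewrite /= expr0n/= addr0 sqrtr_sqr. Qed.

Lemma conj_real x : (x%:C : R[i])^* = x%:C.
Proof. by apply: complex_eq => /=; rewrite ?oppr0. Qed.

Lemma conjD z w : (z + w)^* = z^* + w^*. Proof. exact: rmorphD. Qed.

Lemma conjM z w : (z * w)^* = z^* * w^*. Proof. exact: rmorphM. Qed.

Lemma conjV z : (z^-1)^* = (z^*)^-1. Proof. exact: fmorphV. Qed.

Lemma conj_sum (I : Type) (r : seq I) (Q : pred I) (f : I -> R[i]) :
  (\sum_(i <- r | Q i) f i)^* = \sum_(i <- r | Q i) (f i)^*.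
Proof. exact: rmorph_sum. Qed.

Lemma normc_Re_le z : `|complex.Re z| <= normc z.
Proof.
rewrite -(ler_pXn2r (_ : 0 < 2)%N)// ?nnegrE ?normc_ge0// sqr_normcE.
by rewrite real_normK ?num_real// lerDl sqr_ge0.
Qed.

Lemma normc_Im_le z : `|complex.Im z| <= normc z.
Proof.
rewrite -(ler_pXn2r (_ : 0 < 2)%N)// ?nnegrE ?normc_ge0// sqr_normcE.
by rewrite real_normK ?num_real// lerDr sqr_ge0.
Qed.

Lemma normc_le_ReIm z : normc z <= `|complex.Re z| + `|complex.Im z|.
Proof.
rewrite -(ler_pXn2r (_ : 0 < 2)%N)// ?nnegrE ?normc_ge0 ?addr_ge0// sqr_normcE.
rewrite sqrrD !real_normK ?num_real// addrAC lerDl.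
by rewrite mulrn_wge0// mulr_ge0.
Qed.

Lemma normcB_sym z w : normc (z - w) = normc (w - z).
Proof. by rewrite -opprB normcN. Qed.

Lemma normc_sum (I : Type) (r : seq I) (Q : pred I) (f : I -> R[i]) :
  normc (\sum_(i <- r | Q i) f i) <= \sum_(i <- r | Q i) normc (f i).
Proof.
elim/big_ind2 : _ => [|z a w b za wb|//]; first by rewrite normc0.
by rewrite (le_trans (le_normcD _ _))// lerD.
Qed.

Lemma sqr_normcD_le z w : normc (z + w) ^+ 2 <= 2 * normc z ^+ 2 + 2 * normc w ^+ 2.
Proof.
apply: (@le_trans _ _ ((normc z + normc w) ^+ 2)).
  by rewrite ler_pXn2r// ?nnegrE ?addr_ge0 ?normc_ge0// le_normcD.
by have := sqr_ge0 (normc z - normc w); rewrite !expr2; lra.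
Qed.

Lemma expiD x y : expi (x + y) = expi x * expi y.
Proof. by apply: complex_eq; rewrite ?Re_mul ?Im_mul/= ?cosD ?sinD//; ring. Qed.

Lemma expi0 : expi (0 : R) = 1.
Proof. by rewrite /expi cos0 sin0. Qed.

Lemma expiN x : expi (- x) = (expi x)^*.
Proof. by rewrite /expi cosN sinN. Qed.

Lemma normc_expi x : normc (expi x) = 1.
Proof. by rewrite /= cos2Dsin2 sqrtr1. Qed.

Lemma normc_expi_sub1 (n : nat) (x : R) :
  normc (expi (n%:R * x) - 1) <= n%:R * normc (expi x - 1).
Proof.
elim: n => [|n IH]; first by rewrite !mul0r expi0 subrr normc0.
have -> : expi (n.+1%:R * x) - 1 = expi (n%:R * x) * (expi x - 1) + (expi (n%:R * x) - 1).
  by rewrite -(addn1 n) natrD mulrDl mul1r expiD; ring.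
rewrite (le_trans (le_normcD _ _))// normcM normc_expi mul1r -natr1 mulrDl mul1r addrC.
by rewrite lerD2r.
Qed.

Lemma sqr_normc_expi_sub1 (x : R) : normc (expi x - 1) ^+ 2 = 2 - 2 * cos x.
Proof.
rewrite sqr_normcE Re_add Im_add !Re_opp Im_opp /expi /= oppr0 addr0.
rewrite (_ : _ + _ = cos x ^+ 2 + sin x ^+ 2 + 1 - 2 * cos x); last by ring.
by rewrite cos2Dsin2; ring.
Qed.

End ComplexNumbers.

(** * Limits of real and complex sequences *)

Section RealLimits.
Context {R : realType}.
Implicit Types (u a b : nat -> R).

Lemma cvg0P u : (forall n, 0 <= u n) ->
  (u @ \oo --> (0 : R)) <->
  (forall e, 0 < e -> exists N, forall n, (N <= n)%N -> u n <= e).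
Proof.
move=> u0; split => [h e e0|h].
  move/cvgrPdist_le : h => /(_ _ e0) [N _ hN]; exists N => n Nn.
  by have := hN n Nn; rewrite sub0r normrN ger0_norm.
apply/cvgrPdist_le => e /h [N hN]; exists N => // n /= Nn.
by rewrite sub0r normrN ger0_norm// hN.
Qed.

Lemma cvg0_le2 (c : R) u a b : (forall n, 0 <= u n) ->
  (forall n, u n <= c * a n + c * b n) ->
  a @ \oo --> (0 : R) -> b @ \oo --> (0 : R) -> u @ \oo --> (0 : R).
Proof.
move=> u0 ub ha hb; have h : (fun n => c * a n + c * b n) @ \oo --> (0 : R).
  by rewrite -(addr0 0) -(mulr0 c); apply: cvgD; apply: cvgM => //; exact: cvg_cst.
by apply: (squeeze_cvgr _ (cvg_cst 0) h); apply: nearW => n; rewrite u0 ub.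
Qed.

Lemma cvg0_le (c : R) u a : (forall n, 0 <= u n) -> (forall n, u n <= c * a n) ->
  a @ \oo --> (0 : R) -> u @ \oo --> (0 : R).
Proof.
move=> u0 ub ha; apply: (@cvg0_le2 c u a (fun=> 0)) => //.
  by move=> n; rewrite mulr0 addr0.
exact: cvg_cst.
Qed.

End RealLimits.

Section ComplexLimits.
Context {R : realType}.
Implicit Types (s u : nat -> R[i]) (l k : R[i]).

Lemma ccvgP s l : ccvg s l <-> normc (s n - l) @[n --> \oo] --> (0 : R).
Proof.
split=> h.
  apply/cvgrPdist_lt => e e0.
  have e0' : 0 < e%:C by rewrite ltcR.
  move/cvgrPdist_lt : h => /(_ _ e0'); apply: filterS => n h.
  rewrite sub0r normrN ger0_norm ?normc_ge0// normcB_sym -ltcR; exact: h.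
apply/cvgrPdist_lt => e e0.
have eE : e = (complex.Re e)%:C.
  by move: e0; case: (e) => a b; rewrite ltcE/= => /andP[/eqP -> _].
rewrite eE in e0 *; rewrite ltcR in e0.
move/cvgrPdist_lt : h => /(_ _ e0); apply: filterS => n.
rewrite sub0r normrN ger0_norm ?normc_ge0// normcB_sym.
by rewrite -ltcR.
Qed.

Lemma ccvg_unique s l k : ccvg s l -> ccvg s k -> l = k.
Proof.
move=> /ccvgP sl /ccvgP sk; apply/eqP; rewrite -subr_eq0; apply/eqP/eq0_normc.
apply/eqP; rewrite eq_le normc_ge0 andbT.
have h : (normc (s n - l) + normc (s n - k)) @[n --> \oo] --> (0 + 0 : R).
  exact: cvgD.
rewrite addr0 in h; rewrite -(cvg_lim _ h)//.
apply: limr_ge; first by apply/cvg_ex; exists 0.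
apply: nearW => n; rewrite (_ : l - k = (s n - k) - (s n - l)); last by ring.
by rewrite (le_trans (le_normcD _ _))// normcN addrC.
Qed.

Lemma ccvg_le s l (a : nat -> R) : (forall n, normc (s n - l) <= a n) ->
  a @ \oo --> (0 : R) -> ccvg s l.
Proof.
move=> sa a0; apply/ccvgP; apply: (squeeze_cvgr _ (cvg_cst 0) a0).
by apply: nearW => n; rewrite normc_ge0 sa.
Qed.

Lemma ccvgD s u l k : ccvg s l -> ccvg u k -> ccvg (fun n => s n + u n) (l + k).
Proof.
move=> /ccvgP sl /ccvgP uk; apply: (@ccvg_le _ _ (fun n => normc (s n - l) + normc (u n - k))).
  by move=> n; rewrite opprD addrACA le_normcD.
by rewrite -(addr0 0); exact: cvgD.
Qed.

Lemma ccvgMl s l k : ccvg s l -> ccvg (fun n => k * s n) (k * l).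
Proof.
move=> /ccvgP sl; apply: (@ccvg_le _ _ (fun n => normc k * normc (s n - l))).
  by move=> n; rewrite -mulrBr normcM.
by rewrite -(mulr0 (normc k)); apply: cvgM => //; exact: cvg_cst.
Qed.

Lemma ccvg_cst l : ccvg (fun=> l) l.
Proof.
by apply/ccvgP; under eq_fun do rewrite subrr normc0; exact: cvg_cst.
Qed.

Lemma ccvg_real (u : nat -> R) (x : R) : u @ \oo --> x ->
  ccvg (fun n => (u n)%:C) x%:C.
Proof.
move=> ux; apply/ccvgP; under eq_fun do rewrite -rmorphB normc_real.
have h : (fun n => u n - x) @ \oo --> (0 : R) by apply/subr_cvg0.
by have := cvg_norm h; rewrite normr0; exact.
Qed.

Lemma ccvg_normc_le (s : nat -> R[i]) (l : R[i]) (M : R) : ccvg s l ->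
  (forall n, normc (s n) <= M) -> normc l <= M.
Proof.
move=> /ccvgP sl sM.
have h : M + normc (s n - l) @[n --> \oo] --> M + 0 by apply: cvgD => //; exact: cvg_cst.
rewrite -[leRHS]addr0 -(cvg_lim _ h)//; apply: limr_ge.
  by apply/cvg_ex; eexists; exact: h.
apply: nearW => n; rewrite -[in leLHS](subrK (s n) l) addrC.
by rewrite (le_trans (le_normcD _ _))// normcB_sym lerD.
Qed.

Lemma ccvg_shift (s : nat -> R[i]) l n0 : ccvg s l -> ccvg (fun n => s (n + n0)%N) l.
Proof.
move=> /ccvgP h; apply/ccvgP; rewrite -(cvg_shiftn n0) in h; exact: h.
Qed.

Lemma ccvg_near_cst (s : nat -> R[i]) l k n0 : ccvg s l ->
  (forall n, (n0 <= n)%N -> s n = k) -> l = k.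
Proof.
move=> /(ccvg_shift n0) sl sk; apply: (ccvg_unique sl).
by under eq_fun do rewrite sk ?leq_addl//; exact: ccvg_cst.
Qed.

End ComplexLimits.

(** * Symmetric sums over the integers *)

Section IntegerSums.
Context {R : realType}.
Implicit Types (f g : int -> R[i]) (N : nat).

Lemma eq_zsum N f g : (forall k, f k = g k) -> zsum N f = zsum N g.
Proof. by move=> fg; apply: eq_bigr => i _; rewrite fg. Qed.

Lemma zsumD N f g : zsum N (fun k => f k + g k) = zsum N f + zsum N g.
Proof. by rewrite /zsum big_split. Qed.

Lemma zsumMl N (a : R[i]) f : zsum N (fun k => a * f k) = a * zsum N f.
Proof. by rewrite /zsum mulr_sumr. Qed.

Lemma zsum_pick N f (j : int) : (absz j <= N)%N ->
  zsum N (fun k => if k == j then f k else 0) = f j.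
Proof.
move=> jN.
have jN0 : 0 <= j + N%:Z by lia.
have lt : (absz (j + N%:Z)%R < N.*2.+1)%N by lia.
rewrite /zsum (bigD1 (Ordinal lt))//= ifT; last by apply/eqP; lia.
rewrite big1 ?addr0; first by congr f; lia.
move=> i /eqP iN; rewrite ifF//; apply/negbTE/eqP => ij; apply: iN.
by apply: val_inj => /=; lia.
Qed.

End IntegerSums.

Arguments normc : simpl never.
Arguments expi : simpl never.
Arguments cintegral : simpl never.

(** * Measurability and integration of complex functions *)

Section ComplexMeasurability.
Context {R : realType} {d : measure_display} {T : measurableType d} {D : set T}.
Implicit Types (f g : T -> R[i]).

Lemma cmeasurable_cst (z : R[i]) : cmeasurable D (fun=> z).
Proof. by split; exact: measurable_cst. Qed.

Lemma cmeasurable_real (f : T -> R) :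
  measurable_fun D f -> cmeasurable D (fun t => (f t)%:C).
Proof. by move=> mf; split => //=; exact: measurable_cst. Qed.

Lemma cmeasurableD f g : cmeasurable D f -> cmeasurable D g ->
  cmeasurable D (fun t => f t + g t).
Proof.
move=> [f1 f2] [g1 g2]; split.
- under eq_fun do rewrite Re_add; exact: measurable_funD.
- under eq_fun do rewrite Im_add; exact: measurable_funD.
Qed.

Lemma cmeasurableM f g : cmeasurable D f -> cmeasurable D g ->
  cmeasurable D (fun t => f t * g t).
Proof.
move=> [f1 f2] [g1 g2]; split.
- under eq_fun do rewrite Re_mul.
  by apply: measurable_funB; exact: measurable_funM.
- under eq_fun do rewrite Im_mul.
  by apply: measurable_funD; exact: measurable_funM.
Qed.

Lemma cmeasurableZ (a : R[i]) f : cmeasurable D f -> cmeasurable D (fun t => a * f t).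
Proof. by apply: cmeasurableM; exact: cmeasurable_cst. Qed.

Lemma cmeasurableN f : cmeasurable D f -> cmeasurable D (fun t => - f t).
Proof. by move=> mf; under eq_fun do rewrite -mulN1r; exact: cmeasurableZ. Qed.

Lemma cmeasurableB f g : cmeasurable D f -> cmeasurable D g ->
  cmeasurable D (fun t => f t - g t).
Proof. by move=> mf mg; apply: cmeasurableD => //; exact: cmeasurableN. Qed.

Lemma cmeasurable_conj f : cmeasurable D f -> cmeasurable D (fun t => (f t)^*).
Proof.
move=> [f1 f2]; split; first by under eq_fun do rewrite Re_conj.
by under eq_fun do rewrite Im_conj; exact: measurableT_comp.
Qed.

Lemma cmeasurable_sum (I : Type) (r : seq I) (f : I -> T -> R[i]) :
  (forall i, cmeasurable D (f i)) -> cmeasurable D (fun t => \sum_(i <- r) f i t).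
Proof.
move=> mf; elim: r => [|i r IH].
  by under eq_fun do rewrite big_nil; exact: cmeasurable_cst.
by under eq_fun do rewrite big_cons; exact: cmeasurableD.
Qed.

Lemma measurable_sqr_normc f : cmeasurable D f ->
  measurable_fun D (fun t => normc (f t) ^+ 2).
Proof.
move=> [f1 f2]; under eq_fun do rewrite sqr_normcE.
by apply: measurable_funD; exact: measurable_funX.
Qed.

Lemma measurable_normc f : cmeasurable D f -> measurable_fun D (fun t => normc (f t)).
Proof.
move=> mf; rewrite (_ : (fun t => _) = (fun t => Num.sqrt (normc (f t) ^+ 2))).
  apply: (measurableT_comp (f := @Num.sqrt R)); first exact: continuous_measurable_fun (@sqrt_continuous R).
  exact: measurable_sqr_normc.
by apply/funext => t; rewrite sqrtr_sqr ger0_norm ?normc_ge0.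
Qed.

Lemma cmeasurable_cvg (F_ : nat -> T -> R[i]) (F : T -> R[i]) :
  (forall n, cmeasurable D (F_ n)) ->
  (forall t, D t -> ccvg (fun n => F_ n t) (F t)) -> cmeasurable D F.
Proof.
move=> mF cv; have core (p : R[i] -> R) : (forall z w, p (z - w) = p z - p w) ->
    (forall z, `|p z| <= normc z) -> (forall n, measurable_fun D (fun t => p (F_ n t))) ->
    measurable_fun D (fun t => p (F t)).
  move=> pB pn mp; apply: (measurable_fun_cvg mp) => t Dt.
  apply/subr_cvg0; apply: norm_cvg0; have /ccvgP h := cv t Dt.
  apply: (squeeze_cvgr _ (cvg_cst (0 : R)) h); apply: nearW => n.
  by rewrite normr_ge0 /= -pB pn.
split.
- apply: (core (@complex.Re R)); [by move=> z w; rewrite Re_add Re_opp|exact: normc_Re_le|].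
  by move=> n; exact: (mF n).1.
- apply: (core (@complex.Im R)); [by move=> z w; rewrite Im_add Im_opp|exact: normc_Im_le|].
  by move=> n; exact: (mF n).2.
Qed.

End ComplexMeasurability.

Lemma cmeasurable_comp {R : realType} {d1 d2 : measure_display}
    {T1 : measurableType d1} {T2 : measurableType d2} (D : set T1) (E : set T2)
    (f : T2 -> R[i]) (g : T1 -> T2) : measurable E -> (forall t, D t -> E (g t)) ->
  cmeasurable E f -> measurable_fun D g -> cmeasurable D (fun t => f (g t)).
Proof.
move=> mE DE [f1 f2] mg; split.
- by apply: (measurable_comp mE _ f1) => // _ [t Dt <-]; exact: DE.
- by apply: (measurable_comp mE _ f2) => // _ [t Dt <-]; exact: DE.
Qed.

Section ComplexIntegrability.
Context {R : realType} {d : measure_display} {T : measurableType d}.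
Context (mu : {measure set T -> \bar R}) (D : set T).
Implicit Types (f g : T -> R[i]).

Definition cintegrable f : Prop :=
  mu.-integrable D (EFin \o (fun t => complex.Re (f t))) /\
  mu.-integrable D (EFin \o (fun t => complex.Im (f t))).

Hypothesis mD : measurable D.

Lemma le_cintegrable f (g : T -> R) : cmeasurable D f ->
  (forall t, D t -> normc (f t) <= g t) ->
  mu.-integrable D (EFin \o g) -> cintegrable f.
Proof.
move=> [mf1 mf2] fg ig; split.
- apply: le_integrable ig => //; first exact/measurable_EFinP.
  move=> t Dt /=; rewrite lee_fin (le_trans (normc_Re_le _))//.
  by rewrite (le_trans (fg _ Dt))// ler_norm.
- apply: le_integrable ig => //; first exact/measurable_EFinP.
  move=> t Dt /=; rewrite lee_fin (le_trans (normc_Im_le _))//.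
  by rewrite (le_trans (fg _ Dt))// ler_norm.
Qed.

Lemma cintegrable_measurable f : cintegrable f -> cmeasurable D f.
Proof.
by move=> [/measurable_int/measurable_EFinP ? /measurable_int/measurable_EFinP ?].
Qed.

Lemma cintegrable_normc f : cintegrable f ->
  mu.-integrable D (EFin \o (fun t => normc (f t))).
Proof.
move=> intf; have [i1 i2] := intf.
have : mu.-integrable D (fun t => `|(complex.Re (f t))%:E| + `|(complex.Im (f t))%:E|)%E.
  by apply: integrableD => //; exact: integrable_abse.
apply: le_integrable => //.
  by apply/measurable_EFinP/measurable_normc/cintegrable_measurable.
move=> t Dt /=; rewrite lee_fin ger0_norm ?normc_ge0//.
by rewrite (le_trans (normc_le_ReIm _))// ler_norm.
Qed.

Lemma cintegrableD f g : cintegrable f -> cintegrable g ->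
  cintegrable (fun t => f t + g t).
Proof.
move=> [f1 f2] [g1 g2]; split; rewrite /comp.
- under eq_fun do rewrite Re_add EFinD; exact: integrableD.
- under eq_fun do rewrite Im_add EFinD; exact: integrableD.
Qed.

Lemma cintegrableZ (a : R[i]) f : cintegrable f -> cintegrable (fun t => a * f t).
Proof.
move=> intf; apply: (le_cintegrable (g := fun t => normc a * normc (f t))).
- by apply: cmeasurableZ; exact: cintegrable_measurable.
- by move=> t _; rewrite normcM.
- by rewrite /comp; under eq_fun do rewrite EFinM; exact/integrableZl/cintegrable_normc.
Qed.

Lemma cintegrable_cst0 : cintegrable (fun=> 0).
Proof. by split; exact: integrable0. Qed.

Lemma cintegrable_sum (I : Type) (r : seq I) (f : I -> T -> R[i]) :
  (forall i, cintegrable (f i)) -> cintegrable (fun t => \sum_(i <- r) f i t).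
Proof.
move=> mf; elim: r => [|i r IH].
  by under eq_fun do rewrite big_nil; exact: cintegrable_cst0.
by under eq_fun do rewrite big_cons; exact: cintegrableD.
Qed.

Lemma eq_cintegral f g : {in D, f =1 g} -> cintegral mu D f = cintegral mu D g.
Proof.
by move=> fg; congr (_ +i* _); apply: eq_Rintegral => t Dt; rewrite (fg _ Dt).
Qed.

Lemma ae_eq_cintegral f g : cmeasurable D f -> cmeasurable D g ->
  {ae mu, forall t, D t -> f t = g t} -> cintegral mu D f = cintegral mu D g.
Proof.
move=> [mf1 mf2] [mg1 mg2] fg; congr (_ +i* _); congr fine.
- apply: ae_eq_integral => //; [exact/measurable_EFinP..|].
  by apply: filterS fg => t h Dt; rewrite h.
- apply: ae_eq_integral => //; [exact/measurable_EFinP..|].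
  by apply: filterS fg => t h Dt; rewrite h.
Qed.

Lemma cintegral0 : cintegral mu D (fun=> 0) = 0.
Proof. by apply: complex_eq; rewrite /cintegral /=; rewrite Rintegral_cst// mul0r. Qed.

Lemma cintegral_real (f : T -> R) :
  cintegral mu D (fun t => (f t)%:C) = (\int[mu]_(t in D) f t)%:C.
Proof. by apply: complex_eq; rewrite /cintegral //=; rewrite Rintegral_cst// mul0r. Qed.

Lemma cintegralD f g : cintegrable f -> cintegrable g ->
  cintegral mu D (fun t => f t + g t) = cintegral mu D f + cintegral mu D g.
Proof.
move=> [f1 f2] [g1 g2]; apply: complex_eq; rewrite /cintegral /=; rewrite -RintegralD//.
- by under eq_Rintegral do rewrite Re_add.
- by under eq_Rintegral do rewrite Im_add.
Qed.

Lemma cintegralZ (a : R[i]) f : cintegrable f ->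
  cintegral mu D (fun t => a * f t) = a * cintegral mu D f.
Proof.
move=> [f1 f2].
have iZ (b : R) (h : T -> R) : mu.-integrable D (EFin \o h) ->
    mu.-integrable D (EFin \o (fun t => b * h t)).
  by move=> ih; rewrite /comp; under eq_fun do rewrite EFinM; exact: integrableZl.
apply: complex_eq; rewrite ?Re_mul ?Im_mul /cintegral /= -!RintegralZl//.
- rewrite -RintegralB//; try exact: iZ.
  by under eq_Rintegral do rewrite Re_mul.
- rewrite -RintegralD//; try exact: iZ.
  by under eq_Rintegral do rewrite Im_mul.
Qed.

Lemma cintegral_conj f : cintegrable f ->
  cintegral mu D (fun t => (f t)^*) = (cintegral mu D f)^*.
Proof.
move=> [f1 f2]; apply: complex_eq; rewrite /cintegral /=.
  by under eq_Rintegral do rewrite Re_conj.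
under eq_Rintegral do rewrite Im_conj -mulN1r.
by rewrite RintegralZl// mulN1r.
Qed.

Lemma cintegralB f g : cintegrable f -> cintegrable g ->
  cintegral mu D (fun t => f t - g t) = cintegral mu D f - cintegral mu D g.
Proof.
move=> intf intg; under [LHS]eq_cintegral => t _ do rewrite -(mulN1r (g t)).
rewrite cintegralD//; last exact: cintegrableZ.
by rewrite cintegralZ// mulN1r.
Qed.

Lemma cintegral_sum (I : Type) (r : seq I) (f : I -> T -> R[i]) :
  (forall i, cintegrable (f i)) ->
  cintegral mu D (fun t => \sum_(i <- r) f i t) = \sum_(i <- r) cintegral mu D (f i).
Proof.
move=> mf; elim: r => [|i r IH].
  by under eq_cintegral do rewrite big_nil; rewrite cintegral0 big_nil.
under eq_cintegral do rewrite big_cons.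
by rewrite cintegralD ?big_cons ?IH//; exact: cintegrable_sum.
Qed.

(** Rotate the integral onto the positive half-line and compare real parts. *)
Lemma le_normc_cintegral f : cintegrable f ->
  normc (cintegral mu D f) <= \int[mu]_(t in D) normc (f t).
Proof.
move=> intf; set I := cintegral mu D f; set N := (X in _ <= X).
have N0 : 0 <= N by apply: Rintegral_ge0 => t _; exact: normc_ge0.
suff h : normc I ^+ 2 <= normc I * N.
  have [->|I0] := eqVneq (normc I) 0; first by [].
  by rewrite -(ler_pM2l (x := normc I)) ?lt_def ?I0 ?normc_ge0.
have -> : normc I ^+ 2 = complex.Re (I^* * I).
  by rewrite mulrC mulc_conj.
rewrite /I -cintegralZ// -/I /N -RintegralZl//=; last exact: cintegrable_normc.
apply: le_Rintegral => //.
- by have [] := cintegrableZ I^* intf.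
- rewrite /comp; under eq_fun do rewrite EFinM.
  by apply: integrableZl => //; exact: cintegrable_normc.
- move=> t _; rewrite (le_trans (ler_norm _))// (le_trans (normc_Re_le _))//.
  by rewrite normcM normc_conj.
Qed.

Lemma cintegral_le_bound f (g : T -> R) : cintegrable f ->
  mu.-integrable D (EFin \o g) -> (forall t, D t -> normc (f t) <= g t) ->
  normc (cintegral mu D f) <= \int[mu]_(t in D) g t.
Proof.
move=> intf intg fg; apply: (le_trans (le_normc_cintegral intf)).
by apply: le_Rintegral => //; exact: cintegrable_normc.
Qed.

(** Dominated convergence, for the real and the imaginary parts. *)
Lemma cintegral_dominated (f_ : nat -> T -> R[i]) f (g : T -> R) :
  (forall n, cmeasurable D (f_ n)) -> cmeasurable D f ->
  {ae mu, forall t, D t -> ccvg (fun n => f_ n t) (f t)} ->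
  mu.-integrable D (EFin \o g) ->
  {ae mu, forall t, forall n, D t -> normc (f_ n t) <= g t} ->
  ccvg (fun n => cintegral mu D (f_ n)) (cintegral mu D f).
Proof.
move=> mf_ mf ff ig fg.
have core (p : R[i] -> R) : (forall z w, p (z - w) = p z - p w) ->
    (forall z, `|p z| <= normc z) ->
    (forall n, measurable_fun D (p \o f_ n)) -> measurable_fun D (p \o f) ->
    (\int[mu]_(t in D) p (f_ n t)) @[n --> \oo] --> \int[mu]_(t in D) p (f t).
  move=> pB pn mp_ mp.
  have := @dominated_convergence _ _ _ mu D mD (fun n t => (p (f_ n t))%:E)
    (fun t => (p (f t))%:E) (EFin \o g).
  case.
  - by move=> n; apply/measurable_EFinP; exact: mp_.
  - by apply/measurable_EFinP.
  - apply: filterS ff => t h Dt; apply: cvg_EFin; first exact: nearW.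
    apply/subr_cvg0.
    apply: norm_cvg0; move/ccvgP: (h Dt) => h'.
    apply: (squeeze_cvgr _ (cvg_cst 0) h'); apply: nearW => n /=.
    by rewrite normr_ge0 /= -pB pn.
  - by [].
  - apply: filterS fg => t h n Dt; rewrite /= lee_fin.
    exact: le_trans (pn _) (h _ Dt).
  move=> intf _ cv.
  apply: fine_cvg; rewrite fineK//.
  exact: integrable_fin_num.
have c1 : (\int[mu]_(t in D) complex.Re (f_ n t)) @[n --> \oo] -->
    \int[mu]_(t in D) complex.Re (f t).
  apply: core; [by move=> z w; rewrite Re_add Re_opp|exact: normc_Re_le| |exact: mf.1].
  by move=> n; exact: (mf_ n).1.
have c2 : (\int[mu]_(t in D) complex.Im (f_ n t)) @[n --> \oo] -->
    \int[mu]_(t in D) complex.Im (f t).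
  apply: core; [by move=> z w; rewrite Im_add Im_opp|exact: normc_Im_le| |exact: mf.2].
  by move=> n; exact: (mf_ n).2.
apply: (@ccvg_le _ _ _ (fun n =>
   `|\int[mu]_(t in D) complex.Re (f_ n t) - \int[mu]_(t in D) complex.Re (f t)| +
   `|\int[mu]_(t in D) complex.Im (f_ n t) - \int[mu]_(t in D) complex.Im (f t)|)).
  move=> n; by rewrite (le_trans (normc_le_ReIm _))// Re_add Im_add Re_opp Im_opp.
rewrite -(addr0 0); apply: cvgD.
- by rewrite -(normr0 R); apply: cvg_norm; apply/subr_cvg0.
- by rewrite -(normr0 R); apply: cvg_norm; apply/subr_cvg0.
Qed.

End ComplexIntegrability.

(** * The inner product of L^2 *)

Section L2Space.
Context {R : realType} {d : measure_display} {T : measurableType d}.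
Context (mu : {measure set T -> \bar R}) (D : set T).
Implicit Types (f g h : T -> R[i]).

Definition ip f g : R[i] := cintegral mu D (fun t => f t * (g t)^*).

Arguments ip : simpl never.

Definition normsq f : R := fine (sqnorm mu D f).

Definition L2norm f : R := Num.sqrt (normsq f).

Lemma normsq_ge0 f : 0 <= normsq f.
Proof. by apply/fine_ge0/integral_ge0 => t _; rewrite lee_fin sqr_ge0. Qed.

Lemma L2norm_ge0 f : 0 <= L2norm f. Proof. exact: sqrtr_ge0. Qed.

Lemma sqr_L2norm f : L2norm f ^+ 2 = normsq f.
Proof. by rewrite sqr_sqrtr// normsq_ge0. Qed.

Hypothesis mD : measurable D.
Local Notation L2 := (cL2 mu D).

Lemma cL2_sqr_integrable f : L2 f ->
  mu.-integrable D (EFin \o (fun t => normc (f t) ^+ 2)).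
Proof.
move=> [mf foo]; apply/integrableP; split.
  by apply/measurable_EFinP; exact: measurable_sqr_normc.
rewrite (eq_integral (fun t => (normc (f t) ^+ 2)%:E))// => t _ /=.
by rewrite ger0_norm ?sqr_ge0.
Qed.

Lemma sqnormE f : L2 f -> sqnorm mu D f = (normsq f)%:E.
Proof.
by move=> /cL2_sqr_integrable/integrable_fin_num h; rewrite fineK//; exact: h.
Qed.

Lemma normsqE f : normsq f = \int[mu]_(t in D) (normc (f t) ^+ 2).
Proof. by []. Qed.

Lemma le_cL2 f (g : T -> R) : cmeasurable D f ->
  (forall t, D t -> normc (f t) ^+ 2 <= g t) -> mu.-integrable D (EFin \o g) -> L2 f.
Proof.
move=> mf fg ig; split => //; apply: le_lt_trans (integrable_lty mD ig).
apply: ge0_le_integral => //.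
- by move=> t _; rewrite lee_fin sqr_ge0.
- by apply/measurable_EFinP; exact: measurable_sqr_normc.
- exact: measurable_int ig.
Qed.

Lemma cL2D f g : L2 f -> L2 g -> L2 (fun t => f t + g t).
Proof.
move=> f2 g2.
apply: (@le_cL2 _ (fun t => 2 * normc (f t) ^+ 2 + 2 * normc (g t) ^+ 2)).
- by apply: cmeasurableD; [exact: f2.1|exact: g2.1].
- by move=> t _; exact: sqr_normcD_le.
- rewrite /comp; under eq_fun do rewrite EFinD !EFinM.
  by apply: integrableD => //; apply: integrableZl => //; exact: cL2_sqr_integrable.
Qed.

Lemma cL2Z (a : R[i]) f : L2 f -> L2 (fun t => a * f t).
Proof.
move=> f2; apply: (@le_cL2 _ (fun t => normc a ^+ 2 * normc (f t) ^+ 2)).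
- by apply: cmeasurableZ; exact: f2.1.
- by move=> t _; rewrite normcM exprMn.
- rewrite /comp; under eq_fun do rewrite EFinM.
  by apply: integrableZl => //; exact: cL2_sqr_integrable.
Qed.

Lemma cL20 : L2 (fun=> 0).
Proof.
apply: (@le_cL2 _ (fun=> 0)); first exact: cmeasurable_cst.
- by move=> t _; rewrite normc0 expr0n.
- exact: integrable0.
Qed.

Lemma cL2B f g : L2 f -> L2 g -> L2 (fun t => f t - g t).
Proof.
move=> f2 g2; under eq_fun do rewrite -(mulN1r (g _)).
by apply: cL2D => //; exact: cL2Z.
Qed.

Lemma cL2_sum (I : Type) (r : seq I) (f : I -> T -> R[i]) :
  (forall i, L2 (f i)) -> L2 (fun t => \sum_(i <- r) f i t).
Proof.
move=> mf; elim: r => [|i r IH].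
  by under eq_fun do rewrite big_nil; exact: cL20.
by under eq_fun do rewrite big_cons; exact: cL2D.
Qed.

Lemma cL2_cintegrable f g : L2 f -> L2 g -> cintegrable mu D (fun t => f t * (g t)^*).
Proof.
move=> f2 g2.
apply: (@le_cintegrable _ _ _ _ _ mD _ (fun t => normc (f t) ^+ 2 + normc (g t) ^+ 2)).
- by apply: cmeasurableM; [exact: f2.1|apply: cmeasurable_conj; exact: g2.1].
- move=> t _; rewrite normcM normc_conj.
  have := sqr_ge0 (normc (f t) - normc (g t)); have := normc_ge0 (f t).
  by have := normc_ge0 (g t); rewrite !expr2; nra.
- rewrite /comp; under eq_fun do rewrite EFinD.
  by apply: integrableD => //; exact: cL2_sqr_integrable.
Qed.

Lemma ipDl f g h : L2 f -> L2 g -> L2 h ->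
  ip (fun t => f t + g t) h = ip f h + ip g h.
Proof.
move=> f2 g2 h2; rewrite /ip -cintegralD//; try exact: cL2_cintegrable.
by apply: eq_cintegral => t _; rewrite mulrDl.
Qed.

Lemma ipZl (a : R[i]) f g : L2 f -> L2 g -> ip (fun t => a * f t) g = a * ip f g.
Proof.
move=> f2 g2; rewrite /ip -cintegralZ//; try exact: cL2_cintegrable.
by apply: eq_cintegral => t _; rewrite mulrA.
Qed.

Lemma ip_conj f g : L2 f -> L2 g -> ip g f = (ip f g)^*.
Proof.
move=> f2 g2; rewrite /ip -cintegral_conj//; try exact: cL2_cintegrable.
by apply: eq_cintegral => t _; rewrite rmorphM/= conjCK mulrC.
Qed.

Lemma ipBl f g h : L2 f -> L2 g -> L2 h ->
  ip (fun t => f t - g t) h = ip f h - ip g h.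
Proof.
move=> f2 g2 h2; rewrite /ip -cintegralB//; try exact: cL2_cintegrable.
by apply: eq_cintegral => t _; rewrite mulrBl.
Qed.

Lemma ipDr f g h : L2 f -> L2 g -> L2 h ->
  ip h (fun t => f t + g t) = ip h f + ip h g.
Proof.
move=> f2 g2 h2; rewrite (ip_conj (cL2D f2 g2) h2) ipDl// rmorphD/=.
by rewrite (ip_conj f2 h2) (ip_conj g2 h2).
Qed.

Lemma ipBr f g h : L2 f -> L2 g -> L2 h ->
  ip h (fun t => f t - g t) = ip h f - ip h g.
Proof.
move=> f2 g2 h2; rewrite (ip_conj (cL2B f2 g2) h2) ipBl// rmorphB/=.
by rewrite (ip_conj f2 h2) (ip_conj g2 h2).
Qed.

Lemma ipZr (a : R[i]) f g : L2 f -> L2 g -> ip g (fun t => a * f t) = a^* * ip g f.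
Proof.
move=> f2 g2; rewrite (ip_conj (cL2Z a f2) g2) ipZl// rmorphM/=.
by rewrite (ip_conj f2 g2).
Qed.

Lemma ip0l f : ip (fun=> 0) f = 0.
Proof. by rewrite /ip; under eq_cintegral do rewrite mul0r; exact: cintegral0. Qed.

Lemma ip_suml (I : Type) (r : seq I) (f : I -> T -> R[i]) g :
  (forall i, L2 (f i)) -> L2 g ->
  ip (fun t => \sum_(i <- r) f i t) g = \sum_(i <- r) ip (f i) g.
Proof.
move=> f2 g2; rewrite /ip -cintegral_sum//; last by move=> i; exact: cL2_cintegrable.
by apply: eq_cintegral => t _; rewrite mulr_suml.
Qed.

Lemma ip_sumr (I : Type) (r : seq I) (f : I -> T -> R[i]) g :
  (forall i, L2 (f i)) -> L2 g ->
  ip g (fun t => \sum_(i <- r) f i t) = \sum_(i <- r) ip g (f i).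
Proof.
move=> f2 g2; rewrite (ip_conj (cL2_sum r f2) g2) ip_suml// rmorph_sum/=.
by apply: eq_bigr => i _; rewrite (ip_conj (f2 i) g2).
Qed.

Lemma ip_normsq f : ip f f = (normsq f)%:C.
Proof.
rewrite normsqE -cintegral_real//; apply: eq_cintegral => t _.
exact: mulc_conj.
Qed.

Lemma normsqZ (a : R[i]) f : L2 f ->
  normsq (fun t => a * f t) = normc a ^+ 2 * normsq f.
Proof.
move=> f2; apply: complexI; rewrite -ip_normsq ipZl//; last exact: cL2Z.
by rewrite ipZr// mulrA mulc_conj ip_normsq -rmorphM.
Qed.

Lemma normsqB f g : L2 f -> L2 g ->
  (normsq (fun t => f t - g t))%:C =
  (normsq f)%:C - ip f g - ip g f + (normsq g)%:C.
Proof.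
move=> f2 g2; rewrite -!ip_normsq ipBl//; last exact: cL2B.
by rewrite !ipBr//; ring.
Qed.

Lemma normsqD_le f g : L2 f -> L2 g ->
  normsq (fun t => f t + g t) <= 2 * normsq f + 2 * normsq g.
Proof.
move=> f2 g2; rewrite !normsqE -!RintegralZl//; try exact: cL2_sqr_integrable.
rewrite -RintegralD//; last 2 first.
- rewrite /comp; under eq_fun do rewrite EFinM; exact/integrableZl/cL2_sqr_integrable.
- rewrite /comp; under eq_fun do rewrite EFinM; exact/integrableZl/cL2_sqr_integrable.
apply: le_Rintegral => //.
- exact/cL2_sqr_integrable/cL2D.
- rewrite /comp; under eq_fun do rewrite EFinD !EFinM.
  by apply: integrableD => //; apply: integrableZl => //; exact: cL2_sqr_integrable.
- by move=> t _; exact: sqr_normcD_le.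
Qed.

Lemma cauchy_schwarz f g : L2 f -> L2 g ->
  normc (ip f g) ^+ 2 <= normsq f * normsq g.
Proof.
move=> f2 g2; set z := ip f g; set a := normsq f; set b := normsq g.
(* 0 <= |b f - z g|^2 = b (a b - |z|^2), unless b = 0, where |f - n z g|^2
   would become negative for large n *)
have key (x : R) (y : R[i]) : 0 <= x ^+ 2 * a - 2 * x * complex.Re (y^* * z) + normc y ^+ 2 * b.
  have <- : normsq (fun t => x%:C * f t - y * g t) =
      x ^+ 2 * a - 2 * x * complex.Re (y^* * z) + normc y ^+ 2 * b.
    apply: complexI; rewrite normsqB; try exact: cL2Z.
    rewrite !ipZl//; try exact: cL2Z.
    rewrite !ipZr// (ip_conj f2 g2) -/z !normsqZ// normc_real real_normK ?num_real//.
    have -> : x%:C^* = x%:C by rewrite conj_real.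
    rewrite -/a -/b rmorphD rmorphB !rmorphM/=.
    apply: complex_eq; rewrite ?Re_add ?Im_add ?Re_opp ?Im_opp ?Re_mul ?Im_mul ?Re_conj ?Im_conj /=; ring.
  exact: normsq_ge0.
have b0 : 0 <= b by exact: normsq_ge0.
have a0 : 0 <= a by exact: normsq_ge0.
have zz : complex.Re (z^* * z) = normc z ^+ 2 by rewrite mulrC mulc_conj.
have [b00|bneq0] := eqVneq b 0.
  rewrite b00 mulr0 leNgt; apply/negP => z0.
  have := key 1 (((a + 1) / normc z ^+ 2)%:C * z).
  have -> (x : R) : complex.Re ((x%:C * z)^* * z) = x * normc z ^+ 2.
    by rewrite conjM conj_real -mulrA Re_mul zz /= mul0r subr0.
  by rewrite b00 mulr0 divfK ?gt_eqF// expr1n; lra.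
have bp : 0 < b by rewrite lt_def bneq0.
have := key b z; rewrite zz => h.
rewrite -(ler_pM2l bp); move: h; rewrite -subr_ge0 => h.
rewrite -subr_ge0; apply: le_trans h _; rewrite subr0 le_eqVlt; apply/orP; left; apply/eqP; ring.
Qed.

Lemma cauchy_schwarz_norm f g : L2 f -> L2 g ->
  normc (ip f g) <= L2norm f * L2norm g.
Proof.
move=> f2 g2; rewrite -(ler_pXn2r (_ : 0 < 2)%N)// ?nnegrE ?normc_ge0//.
  by rewrite exprMn !sqr_L2norm cauchy_schwarz.
by rewrite mulr_ge0 ?L2norm_ge0.
Qed.

Lemma eq_ae_normsq f g : cmeasurable D f -> cmeasurable D g ->
  {ae mu, forall t, D t -> f t = g t} -> sqnorm mu D f = sqnorm mu D g.
Proof.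
move=> mf mg fg; apply: ge0_ae_eq_integral => //.
- by apply/measurable_EFinP; exact: measurable_sqr_normc.
- by apply/measurable_EFinP; exact: measurable_sqr_normc.
- by move=> t _; rewrite lee_fin sqr_ge0.
- by move=> t _; rewrite lee_fin sqr_ge0.
- by apply: filterS fg => t h Dt; rewrite h.
Qed.

Lemma eq_ae_ipl f g h : cmeasurable D f -> cmeasurable D g -> cmeasurable D h ->
  {ae mu, forall t, D t -> f t = g t} -> ip f h = ip g h.
Proof.
move=> mf mg mh fg; apply: ae_eq_cintegral => //.
- by apply: cmeasurableM => //; exact: cmeasurable_conj.
- by apply: cmeasurableM => //; exact: cmeasurable_conj.
- by apply: filterS fg => t e Dt; rewrite e.
Qed.

(** Bessel's identity, for a finite orthogonal family of common squared norm
    [c]; keeping [c] avoids normalising the trigonometric functions. *)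
Lemma bessel_identity n (c : R) (e : 'I_n -> T -> R[i]) f : c != 0 ->
  (forall j, L2 (e j)) -> L2 f ->
  (forall j k, ip (e j) (e k) = if j == k then c%:C else 0) ->
  normsq (fun t => f t - \sum_(j < n) c%:C^-1 * ip f (e j) * e j t) =
  normsq f - c^-1 * \sum_(j < n) normc (ip f (e j)) ^+ 2.
Proof.
move=> c0 e2 f2 eo.
have cC : c%:C != 0 by rewrite eq_complex /= eqxx andbT.
set p := fun t => \sum_(j < n) c%:C^-1 * ip f (e j) * e j t.
have p2 : L2 p by apply: cL2_sum => j; exact: cL2Z.
have ppf : ip p f = c%:C^-1 * (\sum_(j < n) normc (ip f (e j)) ^+ 2)%:C.
  rewrite ip_suml//; last by move=> j; exact: cL2Z.
  rewrite rmorph_sum/= mulr_sumr; apply: eq_bigr => j _.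
  by rewrite ipZl// (ip_conj f2 (e2 j)) -mulrA mulc_conj.
have pp : ip p p = ip p f.
  rewrite [LHS]ip_suml//; last by move=> j; exact: cL2Z.
  rewrite [RHS]ip_suml//; last by move=> j; exact: cL2Z.
  apply: eq_bigr => j _; rewrite !ipZl//; congr (_ * _).
  rewrite ip_sumr//; last by move=> k; exact: cL2Z.
  rewrite (bigD1 j)//= big1 ?addr0.
    rewrite ipZr// eo eqxx rmorphM/= (ip_conj f2 (e2 j)).
    rewrite fmorphV /= conj_real -mulrA mulrCA mulVf// mulr1//.
  by move=> k /negbTE kj; rewrite ipZr// eo eq_sym kj mulr0.
have ppf_real : (ip p f)^* = ip p f by rewrite ppf conjM conjV !conj_real.
apply: complexI; rewrite normsqB// -!ip_normsq pp (ip_conj p2 f2) ppf_real ppf.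
by rewrite ip_normsq rmorphB rmorphM fmorphV; ring.
Qed.

Lemma bessel_le n (c : R) (e : 'I_n -> T -> R[i]) f : 0 < c ->
  (forall j, L2 (e j)) -> L2 f ->
  (forall j k, ip (e j) (e k) = if j == k then c%:C else 0) ->
  \sum_(j < n) normc (ip f (e j)) ^+ 2 <= c * normsq f.
Proof.
move=> c0 e2 f2 eo; rewrite mulrC -ler_pdivrMr// mulrC -subr_ge0.
by rewrite -(bessel_identity (lt0r_neq0 c0) e2 f2 eo) normsq_ge0.
Qed.

Lemma sqnorm_cvg0P (g : nat -> T -> R[i]) : (forall n, L2 (g n)) ->
  (sqnorm mu D (g n) @[n --> \oo] --> 0%E) <-> (normsq (g n) @[n --> \oo] --> 0).
Proof.
move=> g2; have -> : (fun n => sqnorm mu D (g n)) = EFin \o (fun n => normsq (g n)).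
  by apply/funext => n /=; rewrite sqnormE.
split=> [/fine_cvgP[_ h]|h]; first exact: h.
by apply: cvg_EFin => //; exact: nearW.
Qed.

Lemma L2norm_cvg0 (s : nat -> T -> R[i]) : normsq (s n) @[n --> \oo] --> 0 ->
  L2norm (s n) @[n --> \oo] --> 0.
Proof.
move=> h; rewrite -sqrtr0; apply: (cvg_comp (fun n => normsq (s n)) _ (G := nbhs (0 : R)) h).
exact: sqrt_continuous.
Qed.

Lemma ip_cvg (s r : nat -> T -> R[i]) f g : (forall n, L2 (s n)) -> (forall n, L2 (r n)) ->
  L2 f -> L2 g -> normsq (fun t => s n t - f t) @[n --> \oo] --> 0 ->
  normsq (fun t => r n t - g t) @[n --> \oo] --> 0 ->
  ccvg (fun n => ip (s n) (r n)) (ip f g).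
Proof.
move=> s2 r2 f2 g2 /L2norm_cvg0 sf /L2norm_cvg0 rg.
have sB n := cL2B (s2 n) f2; have rB n := cL2B (r2 n) g2.
pose a n := L2norm (fun t => s n t - f t); pose b n := L2norm (fun t => r n t - g t).
apply: (@ccvg_le _ _ _ (fun n => a n * b n + a n * L2norm g + L2norm f * b n)).
  move=> n; have -> : ip (s n) (r n) - ip f g =
      ip (fun t => s n t - f t) (fun t => r n t - g t) +
      ip (fun t => s n t - f t) g + ip f (fun t => r n t - g t).
    rewrite (ipBl (s2 n) f2 (rB n)) (ipBl (s2 n) f2 g2) (ipBr (r2 n) g2 (s2 n)).
    by rewrite (ipBr (r2 n) g2 f2); ring.
  apply: (le_trans (le_normcD _ _)); apply: lerD; last exact: cauchy_schwarz_norm.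
  by apply: (le_trans (le_normcD _ _)); apply: lerD; exact: cauchy_schwarz_norm.
have -> : 0 = 0 * 0 + 0 * L2norm g + L2norm f * 0 :> R by rewrite !mulr0 mul0r !addr0.
by apply: cvgD; [apply: cvgD|]; apply: cvgM => //; exact: cvg_cst.
Qed.

Lemma ip_cvgl (s : nat -> T -> R[i]) f g : (forall n, L2 (s n)) -> L2 f -> L2 g ->
  normsq (fun t => s n t - f t) @[n --> \oo] --> 0 ->
  ccvg (fun n => ip (s n) g) (ip f g).
Proof.
move=> s2 f2 g2 sf; apply: (@ip_cvg s (fun=> g)) => //.
have -> : normsq (fun t => g t - g t) = 0; last exact: cvg_cst.
by rewrite (_ : (fun t => _) = (fun=> 0)); [apply: complexI; rewrite -ip_normsq ip0l|apply/funext => t; exact: subrr].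
Qed.

Lemma ip_cvgr (s : nat -> T -> R[i]) f g : (forall n, L2 (s n)) -> L2 f -> L2 g ->
  normsq (fun t => s n t - f t) @[n --> \oo] --> 0 ->
  ccvg (fun n => ip g (s n)) (ip g f).
Proof.
move=> s2 f2 g2 sf; apply: (@ip_cvg (fun=> g) s) => //.
have -> : normsq (fun t => g t - g t) = 0; last exact: cvg_cst.
by rewrite (_ : (fun t => _) = (fun=> 0)); [apply: complexI; rewrite -ip_normsq ip0l|apply/funext => t; exact: subrr].
Qed.

End L2Space.

Section L2AlmostEverywhere.
Context {R : realType} {d : measure_display} {T : measurableType d}.
Context (mu : {measure set T -> \bar R}) (D : set T) (mD : measurable D).

Lemma cL2_conj (f : T -> R[i]) : cL2 mu D f -> cL2 mu D (fun t => (f t)^*).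
Proof.
move=> hf; apply: (@le_cL2 _ _ _ _ _ mD _ (fun v => normc (f v) ^+ 2)).
- by apply: cmeasurable_conj; exact: hf.1.
- by move=> v _; rewrite normc_conj.
- exact: cL2_sqr_integrable.
Qed.

Lemma sqnorm_ge0 (f : T -> R[i]) : (0 <= sqnorm mu D f)%E.
Proof. by apply: integral_ge0 => x _; rewrite lee_fin sqr_ge0. Qed.

Lemma integrable_of_ge0 (f : T -> \bar R) : measurable_fun D f ->
  (forall t, D t -> 0 <= f t)%E -> (\int[mu]_(t in D) f t < +oo)%E -> mu.-integrable D f.
Proof.
move=> mf f0 foo; apply/integrableP; split => //.
apply: le_lt_trans foo; rewrite le_eqVlt; apply/orP; left; apply/eqP.
by apply: eq_integral => t /set_mem Dt; rewrite gee0_abs// f0.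
Qed.

Lemma ae_ge0_le_integral (f g : T -> \bar R) : measurable_fun D f -> measurable_fun D g ->
  (forall t, D t -> 0 <= f t)%E -> (forall t, D t -> 0 <= g t)%E ->
  {ae mu, forall t, D t -> (f t <= g t)%E} ->
  (\int[mu]_(t in D) f t <= \int[mu]_(t in D) g t)%E.
Proof.
move=> mf mg f0 g0 fg.
have mm : measurable_fun D (fun t => mine (f t) (g t)) by exact: measurable_mine.
rewrite (@ge0_ae_eq_integral _ _ _ mu D f (fun t => mine (f t) (g t)))//.
- apply: ge0_le_integral => //.
  + by move=> t Dt; rewrite le_min f0 ?g0.
  + by move=> t Dt; rewrite ge_min lexx orbT.
- by move=> t Dt; rewrite le_min f0 ?g0.
- by apply: filterS fg => t h Dt; apply/esym/min_idPl; exact: h.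
Qed.

End L2AlmostEverywhere.

(** * Completeness of L^2 *)

Section L2Completeness.
Context {R : realType} {d : measure_display} {T : measurableType d}.
Context (mu : {measure set T -> \bar R}) (D : set T) (mD : measurable D).
Local Notation L2 := (cL2 mu D).

(** The increments themselves are summable, since 2 a <= 2^k a^2 + 2^-k. *)
Lemma cvg_of_weighted_increments (u : nat -> R[i]) (p : R[i] -> R) :
  (forall z w, p (z - w) = p z - p w) -> (forall z, `|p z| <= normc z) ->
  (\sum_(0 <= k <oo) (2 ^+ k * normc (u k.+1 - u k) ^+ 2)%:E < +oo)%E ->
  cvgn (fun k => p (u k)).
Proof.
move=> pB pn; set S := (X in (X < _)%E) => Soo.
have S0 : (0 <= S)%E by apply: nneseries_ge0 => k _ _; rewrite lee_fin mulr_ge0 ?sqr_ge0 ?exprn_ge0.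
have SE : S = (fine S)%:E by rewrite fineK// ge0_fin_numE.
have partial n : \sum_(0 <= k < n) 2 ^+ k * normc (u k.+1 - u k) ^+ 2 <= fine S.
  rewrite -lee_fin -SE -sumEFin; apply: nneseries_lim_ge => k _ _.
  by rewrite lee_fin mulr_ge0 ?sqr_ge0 ?exprn_ge0.
have abs_cvg : cvgn (series (fun k => `|p (u k.+1 - u k)|)).
  apply: nondecreasing_is_cvgn.
    apply/nondecreasing_seqP => n; rewrite -subr_ge0 seriesSB; exact: normr_ge0.
  exists (fine S + 2) => _ [n _ <-].
  apply: (@le_trans _ _ (\sum_(0 <= k < n)
      (2 ^+ k * normc (u k.+1 - u k) ^+ 2 + 1 * 2^-1 ^+ k))).
    apply: ler_sum => k _; rewrite (le_trans (pn _))// mul1r.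
    set a := normc _; set q := 2 ^+ k.
    have q0 : 0 < q by rewrite exprn_gt0.
    rewrite exprVn -/q -(ler_pM2l q0) mulrDr divff ?gt_eqF//.
    have := sqr_ge0 (q * a - 1); have := normc_ge0 (u k.+1 - u k); rewrite -/a !expr2; nra.
  rewrite big_split/= lerD//.
  have := @geometric_le_lim R n 1 2^-1 ler01; rewrite mul1r /series/= /geometric/= => h.
  have e2 : (1 - 2^-1 : R)^-1 = 2 by field.
  rewrite e2 in h; apply: h; first by rewrite invr_gt0.
  by rewrite ger0_norm ?invr_ge0// invf_lt1// ltr1n.
have uE n : p (u n) = p (u 0%N) + series (fun k => p (u k.+1 - u k)) n.
  rewrite /series/=; under eq_bigr do rewrite pB.
  by rewrite telescope_sumr// addrC subrK.
rewrite (_ : (fun k => _) = (fun n => p (u 0%N) + series (fun k => p (u k.+1 - u k)) n)); last first.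
  by apply/funext => n; exact: uE.
apply: is_cvgD; first exact: is_cvg_cst.
exact: normed_cvg.
Qed.

(** Riesz-Fischer: along a subsequence with rapidly decreasing increments the
    functions converge almost everywhere, and Fatou's lemma turns the
    pointwise limit into a limit in mean square. *)
Lemma L2_complete (s : nat -> T -> R[i]) : (forall n, L2 (s n)) ->
  (forall eps, 0 < eps -> exists N, forall m n, (N <= m)%N -> (N <= n)%N ->
     normsq mu D (fun t => s m t - s n t) <= eps) ->
  exists f, L2 f /\ normsq mu D (fun t => s n t - f t) @[n --> \oo] --> 0.
Proof.
move=> s2 cauchy.
(* Increments of squared norm at most 4^-k stay summable with weights 2^k. *)
have [N NP] : {N : nat -> nat & forall k m n, (N k <= m)%N -> (N k <= n)%N ->
    normsq mu D (fun t => s m t - s n t) <= 4^-1 ^+ k}.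
  apply: (@choice _ _ (fun k N => forall m n, (N <= m)%N -> (N <= n)%N ->
    normsq mu D (fun t => s m t - s n t) <= 4^-1 ^+ k)) => k.
  by apply: cauchy; rewrite exprn_gt0// invr_gt0.
pose n_ k := (k + \max_(i < k.+1) N i)%N.
have n_ge k : (k <= n_ k)%N by rewrite leq_addr.
have n_N k : (N k <= n_ k)%N.
  by apply: leq_trans (leq_addl _ _); exact: (@leq_bigmax _ _ ord_max).
have n_SN k : (N k <= n_ k.+1)%N.
  apply: leq_trans (leq_addl _ _).
  exact: (@leq_bigmax _ (fun i : 'I_k.+2 => N i) (widen_ord (leqnSn _) ord_max)).
pose u k := s (n_ k).
have u2 k : L2 (u k) by exact: s2.
have ae_sum : {ae mu, forall t, D t ->
    (\sum_(0 <= k <oo) (2 ^+ k * normc (u k.+1 t - u k t) ^+ 2)%:E < +oo)%E}.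
  have mF k : measurable_fun D (fun t => (2 ^+ k * normc (u k.+1 t - u k t) ^+ 2)%:E).
    apply/measurable_EFinP; apply: measurable_funM; first exact: measurable_cst.
    by apply: measurable_sqr_normc; exact: (cL2B mD (u2 _) (u2 _)).1.
  have F0 k t : D t -> (0 <= (2 ^+ k * normc (u k.+1 t - u k t) ^+ 2)%:E)%E.
    by move=> _; rewrite lee_fin mulr_ge0 ?sqr_ge0 ?exprn_ge0.
  have : mu.-integrable D (fun t => \sum_(0 <= k <oo) (2 ^+ k * normc (u k.+1 t - u k t) ^+ 2)%:E)%E.
    apply/integrableP; split.
      by apply: ge0_emeasurable_sum => // k t Dt _; exact: F0.
    rewrite (eq_integral (fun t => \sum_(0 <= k <oo) (2 ^+ k * normc (u k.+1 t - u k t) ^+ 2)%:E)%E); last first.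
      move=> t /set_mem Dt; rewrite gee0_abs//; apply: nneseries_ge0 => k _ _; exact: F0.
    rewrite integral_nneseries//.
    apply: (@le_lt_trans _ _ (\sum_(0 <= k <oo) (2 / (2 ^ (k + 1))%:R)%:E)%E).
      apply: lee_nneseries => [k _ _|k _].
        by apply: integral_ge0; exact: F0.
      rewrite (_ : (fun _ => _) = (fun t => (2 ^+ k)%:E * (normc (u k.+1 t - u k t) ^+ 2)%:E)%E); last by [].
      have isq := cL2_sqr_integrable (cL2B mD (u2 k.+1) (u2 k)).
      rewrite integralZl//.
      have /= := sqnormE mD (cL2B mD (u2 k.+1) (u2 k)); rewrite /sqnorm => ->.
      rewrite -EFinM lee_fin addn1 expnS natrM invfM mulrA divff// mul1r.
      have := NP k _ _ (n_SN k) (n_N k); rewrite -/(u _) -/(u _) => h.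
      apply: (@le_trans _ _ (2 ^+ k * 4^-1 ^+ k)); first by rewrite ler_pM2l// exprn_gt0.
      by rewrite -exprMn natrX (_ : 2 * 4^-1 = 2^-1 :> R) ?exprVn//; field.
    have h := @cvg_geometric_eseries_half R 2 0.
    by rewrite (_ : limn _ = (2 / 2 ^+ 0)%:E) ?ltry//; exact: (cvg_lim _ h).
  move/integrable_ae => /(_ mD); apply: filterS => t h Dt.
  by rewrite -ge0_fin_numE ?h//; apply: nneseries_ge0 => k _ _; exact: F0.
pose lim_of (p : R[i] -> R) t := fine (limn_esup (fun k => (p (u k t))%:E)).
have mlim p : (forall k, measurable_fun D (fun t => p (u k t))) ->
    measurable_fun D (lim_of p).
  move=> mp; apply: (measurableT_comp (f := fine)) => //.
  apply: measurable_fun_limn_esup => k; apply/measurable_EFinP; exact: mp.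
pose f t := lim_of (@complex.Re R) t +i* lim_of (@complex.Im R) t.
have mf : cmeasurable D f.
  by split; apply: mlim => k; [exact: (u2 k).1.1|exact: (u2 k).1.2].
have lim_ofE (p : R[i] -> R) t : cvgn (fun k => p (u k t)) -> (fun k => p (u k t)) @ \oo --> lim_of p t.
  move=> cp; have : (fun k => (p (u k t))%:E) @ \oo --> (limn (fun k => p (u k t)))%:E.
    by apply: cvg_EFin => //; exact: nearW.
  move=> h; rewrite /lim_of is_cvg_limn_esupE; last by apply/cvg_ex; eexists; exact: h.
  by rewrite (cvg_lim _ h).
have u_f : {ae mu, forall t, D t -> ccvg (fun k => u k t) (f t)}.
  apply: filterS ae_sum => t + Dt => /(_ Dt) h.
  have c1 : (fun k => complex.Re (u k t)) @ \oo --> complex.Re (f t).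
    apply: lim_ofE; apply: (@cvg_of_weighted_increments (u^~ t) (@complex.Re R)) => //.
      by move=> z w; rewrite Re_add Re_opp.
    exact: normc_Re_le.
  have c2 : (fun k => complex.Im (u k t)) @ \oo --> complex.Im (f t).
    apply: lim_ofE; apply: (@cvg_of_weighted_increments (u^~ t) (@complex.Im R)) => //.
      by move=> z w; rewrite Im_add Im_opp.
    exact: normc_Im_le.
  apply: (@ccvg_le _ _ _ (fun n => `|complex.Re (u n t) - complex.Re (f t)| +
     `|complex.Im (u n t) - complex.Im (f t)|)).
    by move=> n; rewrite (le_trans (normc_le_ReIm _))// Re_add Im_add Re_opp Im_opp.
  rewrite -(addr0 0); apply: cvgD.
  - by rewrite -(normr0 R); apply: cvg_norm; apply/subr_cvg0.
  - by rewrite -(normr0 R); apply: cvg_norm; apply/subr_cvg0.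
have small eps : 0 < eps -> exists N, forall n, (N <= n)%N ->
    (sqnorm mu D (fun t => s n t - f t)%R <= eps%:E)%E.
  move=> e0; have [M MP] := cauchy _ e0; exists M => n Mn.
  have mG k : measurable_fun D (fun t => (normc (s n t - u k t) ^+ 2)%:E).
    by apply/measurable_EFinP/measurable_sqr_normc; exact: (cL2B mD (s2 _) (u2 _)).1.
  have -> : sqnorm mu D (fun t => s n t - f t) =
      (\int[mu]_(t in D) limn_einf (fun k => (normc (s n t - u k t) ^+ 2)%:E))%E.
    apply: ge0_ae_eq_integral => //.
    - by apply/measurable_EFinP/measurable_sqr_normc/cmeasurableB => //; exact: (s2 n).1.
    - rewrite /limn_einf; apply: measurableT_comp => //.
      apply: measurable_fun_limn_esup => k; apply: measurableT_comp => //.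
    - by move=> t _; rewrite lee_fin sqr_ge0.
    - move=> t _; rewrite limn_einf_lim; apply: lime_ge; first exact: is_cvg_einfs.
      apply: nearW => k; apply: le_ereal_inf_tmp => _ [j _ <-].
      by rewrite lee_fin sqr_ge0.
    - apply: filterS u_f => t h Dt; apply/esym.
      have cv : (fun k => (normc (s n t - u k t) ^+ 2)%:E) @ \oo --> (normc (s n t - f t) ^+ 2)%:E.
        apply: cvg_EFin; first exact: nearW.
        have hn : (fun k => normc (s n t - u k t)) @ \oo --> normc (s n t - f t).
          apply/subr_cvg0; apply: norm_cvg0.
          have /ccvgP h' := h Dt.
          apply: (squeeze_cvgr _ (cvg_cst 0) h'); apply: nearW => k; rewrite normr_ge0 /=.
          rewrite ler_norml lerBlDr lerNl opprB lerBlDr; apply/andP; split.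
            rewrite (_ : s n t - f t = (u k t - f t) + (s n t - u k t)); last by ring.
            exact: le_normcD.
          rewrite (_ : s n t - u k t = - (u k t - f t) + (s n t - f t)); last by ring.
          by rewrite (le_trans (le_normcD _ _))// normcN.
        by apply: cvgM.
      rewrite is_cvg_limn_einfE; last by apply/cvg_ex; eexists; exact: cv.
      by rewrite (cvg_lim _ cv).
  apply: (le_trans (fatou mu mD mG _)).
    by move=> k t _; rewrite lee_fin sqr_ge0.
  apply: (le_trans (limn_einf_sup _)).
  rewrite limn_esup_lim; apply: lime_le; first exact: is_cvg_esups.
  exists M => // k /= Mk; apply: ge_ereal_sup => _ [j /= kj <-].
  have /= := sqnormE mD (cL2B mD (s2 n) (u2 j)); rewrite /sqnorm => ->.
  by rewrite lee_fin; apply: MP => //; rewrite (leq_trans Mk)// (leq_trans kj).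
have f2 : L2 f.
  have [M MP] := small 1 ltr01.
  have h2 : L2 (fun t => s M t - f t).
    split; first by apply: cmeasurableB => //; exact: (s2 M).1.
    by rewrite (le_lt_trans (MP _ (leqnn _)))// ltry.
  by rewrite (_ : f = (fun t => s M t - (s M t - f t))); [exact: cL2B|apply/funext => t; ring].
exists f; split => //.
apply/cvgrPdist_le => e e0; have [M MP] := small _ e0.
exists M => // n /= Mn; rewrite sub0r normrN ger0_norm ?normsq_ge0//.
by rewrite -lee_fin -sqnormE//; [exact: MP|exact: cL2B].
Qed.

End L2Completeness.

(** * Iterated integrals over rectangles *)

Section IteratedIntegrals.
Context {R : realType} {d1 d2 : measure_display}.
Context {T1 : measurableType d1} {T2 : measurableType d2}.
Context (m1 : {sigma_finite_measure set T1 -> \bar R}).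
Context (m2 : {sigma_finite_measure set T2 -> \bar R}).
Context (D1 : set T1) (D2 : set T2).
Hypotheses (mD1 : measurable D1) (mD2 : measurable D2).
Let mD12 : measurable (D1 `*` D2). Proof. exact: measurableX. Qed.

Lemma measurable_section1 {d'} {U : measurableType d'} (f : T1 * T2 -> U) x : D1 x ->
  measurable_fun (D1 `*` D2) f -> measurable_fun D2 (fun y => f (x, y)).
Proof.
move=> D1x mf; apply: (measurable_comp mD12 _ mf) => //=.
- by move=> _ [y D2y <-].
- exact: measurable_funTS.
Qed.

Lemma measurable_section2 {d'} {U : measurableType d'} (f : T1 * T2 -> U) y : D2 y ->
  measurable_fun (D1 `*` D2) f -> measurable_fun D1 (fun x => f (x, y)).
Proof.
move=> D2y mf; apply: (measurable_comp mD12 _ mf) => //=.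
- by move=> _ [x D1x <-].
- exact: measurable_funTS.
Qed.

Lemma cmeasurable_section1 (f : T1 * T2 -> R[i]) x : D1 x ->
  cmeasurable (D1 `*` D2) f -> cmeasurable D2 (fun y => f (x, y)).
Proof.
by move=> D1x [f1 f2]; split; [exact: (measurable_section1 D1x f1)|exact: (measurable_section1 D1x f2)].
Qed.

Lemma cmeasurable_section2 (f : T1 * T2 -> R[i]) y : D2 y ->
  cmeasurable (D1 `*` D2) f -> cmeasurable D1 (fun x => f (x, y)).
Proof.
by move=> D2y [f1 f2]; split; [exact: (measurable_section2 D2y f1)|exact: (measurable_section2 D2y f2)].
Qed.

Let restr_section1 (f : T1 * T2 -> \bar R) x : D1 x ->
  (\int[m2]_(y in D2) f (x, y) = \int[m2]_y (f \_ (D1 `*` D2)) (x, y))%E.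
Proof.
move=> D1x; rewrite integral_mkcond; apply: eq_integral => y _; rewrite !patchE.
by rewrite in_setX (mem_set D1x).
Qed.

Let restr_section2 (f : T1 * T2 -> \bar R) y : D2 y ->
  (\int[m1]_(x in D1) f (x, y) = \int[m1]_x (f \_ (D1 `*` D2)) (x, y))%E.
Proof.
move=> D2y; rewrite integral_mkcond; apply: eq_integral => x _; rewrite !patchE.
by rewrite in_setX (mem_set D2y) andbT.
Qed.

Let restr_iter12 (f : T1 * T2 -> \bar R) :
  (\int[m1]_(x in D1) \int[m2]_(y in D2) f (x, y) =
   \int[m1]_x \int[m2]_y (f \_ (D1 `*` D2)) (x, y))%E.
Proof.
rewrite [LHS]integral_mkcond; apply: eq_integral => x _; rewrite patchE.
case: ifPn => [/set_mem D1x|xD]; first exact: restr_section1.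
by rewrite integral0_eq// => y _; rewrite patchE in_setX (negbTE xD).
Qed.

Let restr_iter21 (f : T1 * T2 -> \bar R) :
  (\int[m2]_(y in D2) \int[m1]_(x in D1) f (x, y) =
   \int[m2]_y \int[m1]_x (f \_ (D1 `*` D2)) (x, y))%E.
Proof.
rewrite [LHS]integral_mkcond; apply: eq_integral => y _; rewrite patchE.
case: ifPn => [/set_mem D2y|yD]; first exact: restr_section2.
by rewrite integral0_eq// => x _; rewrite patchE in_setX (negbTE yD) andbF.
Qed.

Let mrestr (f : T1 * T2 -> \bar R) : measurable_fun (D1 `*` D2) f ->
  measurable_fun setT (f \_ (D1 `*` D2)).
Proof. by move=> mf; apply/(measurable_restrictT _ _).1. Qed.

Lemma ge0_measurable_integral1 (f : T1 * T2 -> \bar R) :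
  measurable_fun (D1 `*` D2) f -> (forall q, 0 <= f q)%E ->
  measurable_fun D1 (fun x => \int[m2]_(y in D2) f (x, y))%E.
Proof.
move=> mf f0.
apply: (eq_measurable_fun (fubini_F m2 (f \_ (D1 `*` D2)))).
  by move=> x /set_mem D1x; rewrite restr_section1.
apply: measurable_funTS; apply: measurable_fun_fubini_tonelli_F.
  exact: mrestr.
by move=> q; rewrite patchE; case: ifPn.
Qed.

Lemma ge0_measurable_integral2 (f : T1 * T2 -> \bar R) :
  measurable_fun (D1 `*` D2) f -> (forall q, 0 <= f q)%E ->
  measurable_fun D2 (fun y => \int[m1]_(x in D1) f (x, y))%E.
Proof.
move=> mf f0.
apply: (eq_measurable_fun (fubini_G m1 (f \_ (D1 `*` D2)))).
  by move=> y /set_mem D2y; rewrite restr_section2.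
apply: measurable_funTS; apply: measurable_fun_fubini_tonelli_G.
  exact: mrestr.
by move=> q; rewrite patchE; case: ifPn.
Qed.

Lemma tonelli_on (f : T1 * T2 -> \bar R) :
  measurable_fun (D1 `*` D2) f -> (forall q, 0 <= f q)%E ->
  (\int[m1]_(x in D1) \int[m2]_(y in D2) f (x, y) =
   \int[m2]_(y in D2) \int[m1]_(x in D1) f (x, y))%E.
Proof.
move=> mf f0; rewrite restr_iter12 restr_iter21 fubini_tonelli//.
  exact: mrestr.
by move=> q; rewrite patchE; case: ifPn.
Qed.

Lemma measurable_Rintegral1 (f : T1 * T2 -> R) : measurable_fun (D1 `*` D2) f ->
  measurable_fun D1 (fun x => \int[m2]_(y in D2) f (x, y)).
Proof.
move=> mf; apply: (measurableT_comp (f := fine)) => //.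
have mEf : measurable_fun (D1 `*` D2) (EFin \o f) by apply/measurable_EFinP.
have mp : measurable_fun D1 (fun x => \int[m2]_(y in D2) ((EFin \o f)^\+ (x, y)))%E.
  by apply: (@ge0_measurable_integral1 (EFin \o f)^\+%E) => //; exact: measurable_funepos.
have mn : measurable_fun D1 (fun x => \int[m2]_(y in D2) ((EFin \o f)^\- (x, y)))%E.
  by apply: (@ge0_measurable_integral1 (EFin \o f)^\-%E) => //; exact: measurable_funeneg.
apply: eq_measurable_fun (emeasurable_funB mp mn) => x _ /=.
rewrite [RHS]integralE; congr (_ - _)%E; apply: eq_integral => y _.
- by rewrite !funeposE.
- by rewrite !funenegE.
Qed.

Lemma measurable_Rintegral2 (f : T1 * T2 -> R) : measurable_fun (D1 `*` D2) f ->
  measurable_fun D2 (fun y => \int[m1]_(x in D1) f (x, y)).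
Proof.
move=> mf; apply: (measurableT_comp (f := fine)) => //.
have mEf : measurable_fun (D1 `*` D2) (EFin \o f) by apply/measurable_EFinP.
have mp : measurable_fun D2 (fun x => \int[m1]_(y in D1) ((EFin \o f)^\+ (y, x)))%E.
  by apply: (@ge0_measurable_integral2 (EFin \o f)^\+%E) => //; exact: measurable_funepos.
have mn : measurable_fun D2 (fun x => \int[m1]_(y in D1) ((EFin \o f)^\- (y, x)))%E.
  by apply: (@ge0_measurable_integral2 (EFin \o f)^\-%E) => //; exact: measurable_funeneg.
apply: eq_measurable_fun (emeasurable_funB mp mn) => x _ /=.
rewrite [RHS]integralE; congr (_ - _)%E; apply: eq_integral => y _.
- by rewrite !funeposE.
- by rewrite !funenegE.
Qed.

Lemma cmeasurable_cintegral1 (f : T1 * T2 -> R[i]) : cmeasurable (D1 `*` D2) f ->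
  cmeasurable D1 (fun x => cintegral m2 D2 (fun y => f (x, y))).
Proof.
move=> [f1 f2]; split; rewrite /cintegral/=.
- exact: (measurable_Rintegral1 f1).
- exact: (measurable_Rintegral1 f2).
Qed.

Lemma cmeasurable_cintegral2 (f : T1 * T2 -> R[i]) : cmeasurable (D1 `*` D2) f ->
  cmeasurable D2 (fun y => cintegral m1 D1 (fun x => f (x, y))).
Proof.
move=> [f1 f2]; split; rewrite /cintegral/=.
- exact: (measurable_Rintegral2 f1).
- exact: (measurable_Rintegral2 f2).
Qed.

Lemma tonelli_sqnorm (f : T1 * T2 -> R[i]) : cmeasurable (D1 `*` D2) f ->
  (\int[m1]_(x in D1) sqnorm m2 D2 (fun y => f (x, y)) =
   \int[m2]_(y in D2) sqnorm m1 D1 (fun x => f (x, y)))%E.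
Proof.
move=> mf; rewrite /sqnorm (@tonelli_on (fun q => (normc (f q) ^+ 2)%:E))//.
- by apply/measurable_EFinP; exact: measurable_sqr_normc.
- by move=> q; rewrite lee_fin sqr_ge0.
Qed.

Lemma measurable_sqnorm1 (f : T1 * T2 -> R[i]) : cmeasurable (D1 `*` D2) f ->
  measurable_fun D1 (fun x => sqnorm m2 D2 (fun y => f (x, y))).
Proof.
move=> mf; apply: (@ge0_measurable_integral1 (fun q => (normc (f q) ^+ 2)%:E)).
- by apply/measurable_EFinP; exact: measurable_sqr_normc.
- by move=> q; rewrite lee_fin sqr_ge0.
Qed.

Lemma measurable_sqnorm2 (f : T1 * T2 -> R[i]) : cmeasurable (D1 `*` D2) f ->
  measurable_fun D2 (fun y => sqnorm m1 D1 (fun x => f (x, y))).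
Proof.
move=> mf; apply: (@ge0_measurable_integral2 (fun q => (normc (f q) ^+ 2)%:E)).
- by apply/measurable_EFinP; exact: measurable_sqr_normc.
- by move=> q; rewrite lee_fin sqr_ge0.
Qed.

(** Fubini's theorem for the function extended by zero outside the rectangle. *)
Lemma real_fubini_on (f : T1 * T2 -> R) : measurable_fun (D1 `*` D2) f ->
  (\int[m1]_(x in D1) \int[m2]_(y in D2) `|f (x, y)|%:E < +oo)%E ->
  \int[m1]_(x in D1) (\int[m2]_(y in D2) f (x, y)) =
  \int[m2]_(y in D2) (\int[m1]_(x in D1) f (x, y)).
Proof.
move=> mf foo; have mEf : measurable_fun (D1 `*` D2) (EFin \o f) by apply/measurable_EFinP.
pose g := (EFin \o f) \_ (D1 `*` D2).
have mg : measurable_fun setT g by exact: mrestr.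
have ig : (m1 \x m2)%E.-integrable setT g.
  apply: (integrable12ltyP m1 m2 mg).2.
  rewrite (eq_integral (fun x => \int[m2]_y ((fun q => `|f q|%:E) \_ (D1 `*` D2)) (x, y))%E).
    by rewrite -restr_iter12.
  move=> x _; apply: eq_integral => y _; rewrite /g !patchE; case: ifPn => //= _.
  by rewrite normr0.
have fin1 : {ae m1, forall x, D1 x -> (\int[m2]_(y in D2) (f (x, y))%:E)%E \is a fin_num}.
  apply: filterS (ae_integrable1 ig) => x h D1x.
  rewrite (@restr_section1 (EFin \o f))//; exact: integrable_fin_num.
have fin2 : {ae m2, forall y, D2 y -> (\int[m1]_(x in D1) (f (x, y))%:E)%E \is a fin_num}.
  apply: filterS (ae_integrable2 ig) => y h D2y.
  rewrite (@restr_section2 (EFin \o f))//; exact: integrable_fin_num.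
rewrite /Rintegral; congr fine.
transitivity (\int[m1]_(x in D1) \int[m2]_(y in D2) (f (x, y))%:E)%E.
  apply: ae_eq_integral => //.
  - by apply/measurable_EFinP; exact: measurable_Rintegral1.
  - apply: (eq_measurable_fun (fubini_F m2 g)).
      by move=> x /set_mem D1x; rewrite (@restr_section1 (EFin \o f)).
    by apply: measurable_funTS; exact: (measurable_fubini_F ig).
  - by apply: filterS fin1 => x h D1x; rewrite fineK// h.
rewrite (@restr_iter12 (EFin \o f)) (Fubini ig) -(@restr_iter21 (EFin \o f)).
apply: ae_eq_integral => //.
- apply: (eq_measurable_fun (fubini_G m1 g)).
    by move=> x /set_mem D1x; rewrite (@restr_section2 (EFin \o f)).
  by apply: measurable_funTS; exact: (measurable_fubini_G ig).
- by apply/measurable_EFinP; exact: measurable_Rintegral2.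
- by apply: filterS fin2 => x h D1x; rewrite fineK// h.
Qed.

Lemma cfubini_on (f : T1 * T2 -> R[i]) : cmeasurable (D1 `*` D2) f ->
  (\int[m1]_(x in D1) \int[m2]_(y in D2) (normc (f (x, y)))%:E < +oo)%E ->
  cintegral m1 D1 (fun x => cintegral m2 D2 (fun y => f (x, y))) =
  cintegral m2 D2 (fun y => cintegral m1 D1 (fun x => f (x, y))).
Proof.
move=> mf foo; have [mf1 mf2] := mf.
have le_foo (p : R[i] -> R) : (forall z, `|p z| <= normc z) ->
    measurable_fun (D1 `*` D2) (fun q => p (f q)) ->
    (\int[m1]_(x in D1) \int[m2]_(y in D2) `|p (f (x, y))|%:E < +oo)%E.
  move=> pn mp; apply: le_lt_trans foo.
  have mpf : measurable_fun (D1 `*` D2) (fun q => `|p (f q)|%:E).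
    by apply/measurable_EFinP; apply: measurableT_comp.
  have mnf : measurable_fun (D1 `*` D2) (fun q => (normc (f q))%:E).
    by apply/measurable_EFinP; exact: measurable_normc.
  apply: ge0_le_integral => //.
  - by move=> x _; exact: integral_ge0.
  - exact: (ge0_measurable_integral1 mpf).
  - by apply: (ge0_measurable_integral1 mnf) => q; rewrite lee_fin normc_ge0.
  - move=> x D1x; apply: ge0_le_integral => //.
    + exact: (measurable_section1 D1x mpf).
    + exact: (measurable_section1 D1x mnf).
    + by move=> y _; rewrite lee_fin pn.
apply: complex_eq; rewrite /cintegral/=.
- by apply: (real_fubini_on mf1); apply: le_foo => //; exact: normc_Re_le.
- by apply: (real_fubini_on mf2); apply: le_foo => //; exact: normc_Im_le.
Qed.

(** Almost all sections of a null set of the product are null sets. *)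
Lemma ae_sections (P : T1 * T2 -> Prop) :
  {ae (m1 \x m2)%E, forall q, D1 q.1 -> D2 q.2 -> P q} ->
  {ae m1, forall x, D1 x -> {ae m2, forall y, D2 y -> P (x, y)}}.
Proof.
move=> [N [mN N0 subN]].
have mx : measurable_fun setT (m2 \o xsection N) by exact: measurable_fun_xsection.
have : ae_eq m1 setT (m2 \o xsection N) (cst 0%E).
  apply/(ae_eq_integral_abs _ measurableT mx).
  rewrite (eq_integral (m2 \o xsection N)); first exact: N0.
  by move=> x _; rewrite gee0_abs.
apply: filterS => x /= /(_ I) h D1x.
exists (xsection N x); split => //; first exact: measurable_xsection.
by move=> y /= nP; rewrite /xsection/= inE; apply: subN => /= hP; apply: nP => D2y; exact: hP.
Qed.

End IteratedIntegrals.

(** * Fourier series in mean square *)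

Section L2Dominated.
Context {R : realType} {d : measure_display} {T : measurableType d}.
Context (mu : {measure set T -> \bar R}) (D : set T) (mD : measurable D).

(** Dominated convergence, since |g_n - g|^2 <= 4 G^2. *)
Lemma L2_dominated (g_ : nat -> T -> R[i]) (g : T -> R[i]) (G : T -> R) :
  (forall n, cmeasurable D (g_ n)) -> cmeasurable D g ->
  (forall n t, D t -> normc (g_ n t) <= G t) -> (forall t, D t -> normc (g t) <= G t) ->
  mu.-integrable D (EFin \o (fun t => G t ^+ 2)) ->
  {ae mu, forall t, D t -> ccvg (fun n => g_ n t) (g t)} ->
  normsq mu D (fun t => g_ n t - g t) @[n --> \oo] --> 0.
Proof.
move=> mg_ mg g_G gG iG cv.
have h := @cintegral_dominated _ _ _ mu D mD (fun n t => (normc (g_ n t - g t) ^+ 2)%:C)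
  (fun=> 0) (fun t => 4 * G t ^+ 2).
have : ccvg (fun n => cintegral mu D (fun t => (normc (g_ n t - g t) ^+ 2)%:C)) (cintegral mu D (fun=> 0)).
  apply: h.
  - by move=> n; apply/cmeasurable_real/measurable_sqr_normc/cmeasurableB.
  - exact: cmeasurable_cst.
  - apply: filterS cv => t h Dt; have /ccvgP h' := h Dt.
    apply/ccvgP; under eq_fun do rewrite subr0 normc_real ger0_norm ?sqr_ge0// expr2.
    by rewrite -(mulr0 0); exact: cvgM.
  - by rewrite /comp; under eq_fun do rewrite EFinM; exact: integrableZl.
  - apply: aeW => t n Dt; rewrite normc_real ger0_norm ?sqr_ge0//.
    apply: (le_trans (sqr_normcD_le _ _)); rewrite normcN.
    have := g_G n t Dt; have := gG t Dt; have := normc_ge0 (g t); have := normc_ge0 (g_ n t).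
    by rewrite !expr2; nra.
rewrite cintegral0//; under eq_fun do rewrite cintegral_real//.
move=> /ccvgP; under eq_fun do rewrite subr0 normc_real ger0_norm ?normsq_ge0 -?normsqE ?normsq_ge0//.
by [].
Qed.

End L2Dominated.

Section TrigonometricSystem.
Context {R : realType}.
Local Notation leb := (@lebesgue_measure R).
Local Notation D := (@pi_itv R).
Implicit Types (f g : R -> R[i]) (k l : int).

Lemma measurable_pi_itv : measurable D. Proof. exact: measurable_itv. Qed.
Local Hint Resolve measurable_pi_itv : core.

Lemma twopi_gt0 : 0 < 2 * pi :> R. Proof. by rewrite mulr_gt0// pi_gt0. Qed.

Lemma lebesgue_pi_itv : leb D = (2 * pi)%:E.
Proof.
rewrite /pi_itv lebesgue_measure_itv /= lte_fin gtrN ?pi_gt0//.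
by rewrite -EFinD opprK mulr2n mulrDl mul1r.
Qed.

Lemma integrable_pi_cst (r : R) : leb.-integrable D (EFin \o (fun=> r)).
Proof.
apply: measurable_bounded_integrable => //; first by rewrite -[ltLHS]/(leb D) lebesgue_pi_itv ltry.
by exists `|r|; split; [exact: num_real|move=> M rM t _ /=; exact: ltW].
Qed.

Lemma sin_int_pi k : sin (k%:~R * pi) = 0 :> R.
Proof.
have nat_case n : sin (n%:R * pi) = 0 :> R.
  elim: n => [|n IH]; first by rewrite mul0r sin0.
  by rewrite -natr1 mulrDl mul1r sinDpi IH oppr0.
by case: k => n; rewrite ?NegzE ?mulrNz ?mulNr ?sinN ?nat_case ?oppr0.
Qed.

Lemma cexp_measurable (a : R) (A : set (measurableTypeR R)) :
  cmeasurable A (fun x : R => expi (a * x)).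
Proof.
have ma : measurable_fun A ( *%R a) by exact: measurable_funM.
split; rewrite /expi/=.
- apply: (measurableT_comp (f := @cos R)) => //; exact: continuous_measurable_fun (@continuous_cos R).
- apply: (measurableT_comp (f := @sin R)) => //; exact: continuous_measurable_fun (@continuous_sin R).
Qed.

Lemma Rintegral_cos_sin (a : R) : a != 0 -> sin (a * pi) = 0 ->
  \int[leb]_(x in D) cos (a * x) = 0 /\ \int[leb]_(x in D) sin (a * x) = 0.
Proof.
move=> a0 sa; have pp : - pi < pi :> R by rewrite gtrN ?pi_gt0.
have ftc (f F : R -> R) : continuous f -> (forall x, is_derive x (1 : R) F (f x)) ->
    F (- pi) = F pi -> \int[leb]_(x in D) f x = 0.
  move=> cf dF FF; rewrite /Rintegral (@continuous_FTC2 _ f F).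
  - by rewrite FF -EFinB subrr.
  - exact: pp.
  - exact: continuous_subspaceT.
  - have cF : continuous F.
      move=> x; apply: differentiable_continuous; apply/derivable1_diffP.
      by have [] := dF x.
    split.
    + by move=> x _; have [] := dF x.
    + apply: cvg_at_right_filter; exact: cF.
    + apply: cvg_at_left_filter; exact: cF.
  - move=> x _; rewrite derive1E; exact: derive_val.
have cM : continuous ( *%R a) by move=> x; exact: mulrl_continuous.
split.
- apply: (ftc _ (fun x => a^-1 * sin (a * x))).
  + by move=> x; apply: continuous_comp; [exact: cM|exact: continuous_cos].
  + move=> x; apply: is_derive_eq; rewrite /GRing.scale/= mulr1 mulrA mulrAC mulVf// mul1r.
    by ring.
  + by rewrite mulrN sinN sa oppr0.
- apply: (ftc _ (fun x => - a^-1 * cos (a * x))).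
  + by move=> x; apply: continuous_comp; [exact: cM|exact: continuous_sin].
  + move=> x; apply: is_derive_eq; rewrite /GRing.scale/= mulr1; field.
    exact: a0.
  + by rewrite mulrN cosN.
Qed.

Lemma cintegral_cexp k : cintegral leb D (fun x => expi (k%:~R * x)) =
  if k == 0 then (2 * pi)%:C else 0.
Proof.
case: ifPn => [/eqP ->|k0].
  rewrite (@eq_cintegral _ _ _ _ _ _ (fun=> 1)); last by move=> x _; rewrite mul0r expi0.
  apply: complex_eq; rewrite /cintegral/= Rintegral_cst// ?mul0r//.
  by rewrite -[X in fine X]/(leb D) lebesgue_pi_itv mul1r.
have [h1 h2] := @Rintegral_cos_sin k%:~R (etrans (congr1 negb (intr_eq0 _ k)) k0) (sin_int_pi k).
by apply: complex_eq; rewrite /cintegral /expi/=.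
Qed.

Lemma expi_int_add k l (x : R) :
  expi ((k + l)%:~R * x) = expi (k%:~R * x) * expi (l%:~R * x).
Proof. by rewrite intrD mulrDl expiD. Qed.

Lemma expi_int_conj k (x : R) : (expi (k%:~R * x))^* = expi ((- k)%:~R * x).
Proof. by rewrite mulrNz mulNr expiN. Qed.

Lemma cL2_bounded f (M : R) : cmeasurable D f -> (forall x, D x -> normc (f x) <= M) ->
  cL2 leb D f.
Proof.
move=> mf fM; apply: (@le_cL2 _ _ _ _ _ measurable_pi_itv _ (fun=> M ^+ 2)) => //.
  move=> x Dx; rewrite ler_pXn2r// ?nnegrE ?normc_ge0 ?fM//.
  by rewrite (le_trans (normc_ge0 (f x)))// fM.
exact: integrable_pi_cst.
Qed.

Lemma cL2_cexp (a : R) : cL2 leb D (fun x => expi (a * x)).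
Proof.
by apply: (@cL2_bounded _ 1); [exact: cexp_measurable|move=> x _; rewrite normc_expi].
Qed.

Lemma ip_cexp k l : ip leb D (fun x => expi (k%:~R * x)) (fun x => expi (l%:~R * x)) =
  if k == l then (2 * pi)%:C else 0.
Proof.
rewrite -subr_eq0 -cintegral_cexp; apply: eq_cintegral => x _.
by rewrite expi_int_conj expi_int_add.
Qed.

Definition fhat f l : R[i] :=
  ((2 * pi)^-1)%:C * cintegral leb D (fun s => f s * expi (- (l%:~R * s))).

Definition fourier_psum N f (x : R) : R[i] := zsum N (fun l => fhat f l * expi (l%:~R * x)).

Lemma fhatE f l : fhat f l = (2 * pi)%:C^-1 * ip leb D f (fun x => expi (l%:~R * x)).
Proof.
rewrite /fhat fmorphV; congr (_ * _); apply: eq_cintegral => x _.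
by rewrite expiN.
Qed.

Lemma cL2_fourier_psum N f : cL2 leb D (fourier_psum N f).
Proof. by apply: cL2_sum => // i; apply: cL2Z => //; exact: cL2_cexp. Qed.

Lemma fourier_bessel N f : cL2 leb D f ->
  normsq leb D (fun x => f x - fourier_psum N f x) =
  normsq leb D f - 2 * pi * \sum_(k < N.*2.+1) normc (fhat f (k%:Z - N%:Z)) ^+ 2.
Proof.
move=> f2.
have := @bessel_identity _ _ _ leb D measurable_pi_itv N.*2.+1 (2 * pi)
  (fun j x => expi ((j%:Z - N%:Z)%:~R * x)) f (lt0r_neq0 twopi_gt0) (fun j => cL2_cexp _) f2.
move=> h; have := h _; rewrite (_ : (fun t => _) = (fun x => f x - fourier_psum N f x)); last first.
  apply/funext => x; congr (_ - _); apply: eq_bigr => j _; by rewrite fhatE.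
move=> -> ; last first.
  move=> j k; rewrite ip_cexp; congr (if _ then _ else _).
  by apply/eqP/eqP => [jk|->//]; apply: val_inj => /=; lia.
congr (_ - _); rewrite !mulr_sumr; apply: eq_bigr => j _.
rewrite fhatE normcM normcV normc_real ger0_norm ?(ltW twopi_gt0)//.
rewrite exprMn; move: (normc _ ^+ 2) (2 * pi) (lt0r_neq0 twopi_gt0) => z p p0.
by field.
Qed.

Lemma fourier_contraction N f : cL2 leb D f ->
  normsq leb D (fun x => f x - fourier_psum N f x) <= normsq leb D f.
Proof.
move=> f2; rewrite fourier_bessel// lerBlDr lerDl mulr_ge0 ?(ltW twopi_gt0)//.
by apply: sumr_ge0 => k _; rewrite sqr_ge0.
Qed.

Lemma fhatD f g l : cL2 leb D f -> cL2 leb D g ->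
  fhat (fun x => f x + g x) l = fhat f l + fhat g l.
Proof. by move=> f2 g2; rewrite !fhatE ipDl ?mulrDr//; exact: cL2_cexp. Qed.

Lemma fhatZ (a : R[i]) f l : cL2 leb D f -> fhat (fun x => a * f x) l = a * fhat f l.
Proof. by move=> f2; rewrite !fhatE ipZl//; [rewrite mulrCA|exact: cL2_cexp]. Qed.

Lemma fhat_cexp k l : fhat (fun x => expi (k%:~R * x)) l = if k == l then 1 else 0.
Proof.
rewrite fhatE ip_cexp; case: ifP => _; last by rewrite mulr0.
by rewrite mulVf// eq_complex /= eqxx andbT gt_eqF ?twopi_gt0.
Qed.

Definition fourier_cvg f := cL2 leb D f /\
  normsq leb D (fun x => f x - fourier_psum N f x) @[N --> \oo] --> 0.

Lemma fourier_cvgD f g : fourier_cvg f -> fourier_cvg g ->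
  fourier_cvg (fun x => f x + g x).
Proof.
move=> [f2 cf] [g2 cg]; split; first exact: cL2D.
have E N : (fun x => f x + g x - fourier_psum N (fun x => f x + g x) x) =
    (fun x => (f x - fourier_psum N f x) + (g x - fourier_psum N g x)).
  apply/funext => x; rewrite /fourier_psum (eq_zsum _ (g := fun l => fhat f l * expi (l%:~R * x) + fhat g l * expi (l%:~R * x))).
    by rewrite zsumD; ring.
  by move=> l; rewrite fhatD// mulrDl.
apply: (cvg0_le2 (c := 2) _ _ cf cg) => [N|N]; first exact: normsq_ge0.
rewrite E; apply: normsqD_le => //.
- by apply: cL2B => //; exact: cL2_fourier_psum.
- by apply: cL2B => //; exact: cL2_fourier_psum.
Qed.

Lemma fourier_cvgZ (a : R[i]) f : fourier_cvg f -> fourier_cvg (fun x => a * f x).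
Proof.
move=> [f2 cf]; split; first exact: cL2Z.
have E N : normsq leb D (fun x => a * f x - fourier_psum N (fun x => a * f x) x) =
    normc a ^+ 2 * normsq leb D (fun x => f x - fourier_psum N f x).
  rewrite -normsqZ//; last by apply: cL2B => //; exact: cL2_fourier_psum.
  congr normsq; apply/funext => x; rewrite mulrBr /fourier_psum -zsumMl.
  by congr (_ - _); apply: eq_zsum => l; rewrite fhatZ// mulrA.
apply: (cvg0_le (c := normc a ^+ 2) _ _ cf) => [N|N]; first exact: normsq_ge0.
by rewrite E.
Qed.

Lemma fourier_cvgB f g : fourier_cvg f -> fourier_cvg g ->
  fourier_cvg (fun x => f x - g x).
Proof.
move=> cf cg; under eq_fun do rewrite -(mulN1r (g _)).
exact: (fourier_cvgD cf (fourier_cvgZ (-1) cg)).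
Qed.

Lemma fourier_cvg_sum n (f : 'I_n -> R -> R[i]) : (forall j, fourier_cvg (f j)) ->
  fourier_cvg (fun x => \sum_(j < n) f j x).
Proof.
move=> cf; elim: n f cf => [|n IH] f cf.
  split.
    by under eq_fun do rewrite big_ord0; exact: cL20.
  have E N : (fun x => \sum_(j < 0) f j x - fourier_psum N (fun x => \sum_(j < 0) f j x) x) = (fun=> 0 : R[i]).
    apply/funext => x; rewrite big_ord0 sub0r; apply/eqP; rewrite oppr_eq0; apply/eqP.
    apply: big1 => i _; rewrite /fhat (@eq_cintegral _ _ _ _ _ _ (fun=> 0)).
      by rewrite cintegral0// mulr0 mul0r.
    by move=> y _; rewrite big_ord0 mul0r.
  under eq_fun do rewrite E.
  have -> : normsq leb D (fun=> 0) = 0 by apply: complexI; rewrite -ip_normsq// ip0l.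
  exact: cvg_cst.
under eq_fun do rewrite big_ord_recr.
by apply: fourier_cvgD => //; apply: IH => j; exact: cf.
Qed.

Lemma fourier_cvg_cexp k : fourier_cvg (fun x => expi (k%:~R * x)).
Proof.
split; first exact: cL2_cexp.
apply: (@cvg_near_cst _ _ _ _ _ eventually_filter); exists (absz k) => // N /= kN.
have -> : (fun x => expi (k%:~R * x) - fourier_psum N (fun x => expi (k%:~R * x)) x) = (fun=> 0 : R[i]).
  apply/funext => x; rewrite /fourier_psum.
  rewrite (eq_zsum _ (g := fun l => if l == k then expi (l%:~R * x) else 0)).
    by rewrite zsum_pick// subrr.
  by move=> l; rewrite fhat_cexp eq_sym; case: ifP; rewrite ?mul1r ?mul0r.
by apply: complexI; rewrite -ip_normsq// ip0l.
Qed.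

(** The functions whose Fourier series converge in mean square form a closed
    subspace, because the partial sum operators are contractions. *)
Lemma fourier_cvg_closed (g_ : nat -> R -> R[i]) f : (forall n, fourier_cvg (g_ n)) ->
  cL2 leb D f -> normsq leb D (fun x => g_ n x - f x) @[n --> \oo] --> 0 -> fourier_cvg f.
Proof.
move=> cg f2 gf; split => //; apply/cvg0P => [N|e e0]; first exact: normsq_ge0.
have e4 : 0 < e / 4 by rewrite divr_gt0.
have [n /(_ n (leqnn _)) gfn] := (cvg0P (fun n => normsq_ge0 _ _ _)).1 gf _ e4.
have [g2 cgn] := cg n.
have d2 : cL2 leb D (fun x => f x - g_ n x) by exact: cL2B.
have dE : normsq leb D (fun x => f x - g_ n x) = normsq leb D (fun x => g_ n x - f x).
  rewrite (_ : (fun x => f x - g_ n x) = (fun x => -1 * (g_ n x - f x))); last first.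
    by apply/funext => x; ring.
  rewrite normsqZ//; last exact: cL2B.
  by rewrite normcN normc1 expr1n mul1r.
have [N0 hN] := (cvg0P (fun n => normsq_ge0 _ _ _)).1 cgn _ e4.
exists N0 => N /hN gN.
have -> : (fun x => f x - fourier_psum N f x) =
    (fun x => (g_ n x - fourier_psum N (g_ n) x) +
              ((f x - g_ n x) - fourier_psum N (fun x => f x - g_ n x) x)).
  apply/funext => x; have -> : fourier_psum N f x = fourier_psum N (g_ n) x + fourier_psum N (fun x => f x - g_ n x) x.
    have e2 : (fun y => g_ n y + (f y - g_ n y)) = f.
      by apply/funext => y; rewrite addrC subrK.
    rewrite /fourier_psum -zsumD; apply: eq_zsum => l; rewrite -mulrDl.
    by congr (_ * _); rewrite -[in LHS]e2; exact: (fhatD l g2 d2).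
  by ring.
apply: (le_trans (normsqD_le _ _ _)) => //.
- by apply: cL2B => //; exact: cL2_fourier_psum.
- by apply: cL2B => //; exact: cL2_fourier_psum.
have h : normsq leb D (fun x => f x - g_ n x - fourier_psum N (fun x => f x - g_ n x) x) <= e / 4.
  by apply: (le_trans (fourier_contraction N d2)); rewrite dE.
apply: (le_trans (lerD (ler_wpM2l (ler0n _ _) gN) (ler_wpM2l (ler0n _ _) h))).
by clear; lra.
Qed.

Lemma fourier_cvg_dominated (g_ : nat -> R -> R[i]) f (G : R -> R) :
  (forall n, fourier_cvg (g_ n)) -> cmeasurable D f ->
  (forall n x, D x -> normc (g_ n x) <= G x) -> (forall x, D x -> normc (f x) <= G x) ->
  leb.-integrable D (EFin \o (fun x => G x ^+ 2)) ->
  {ae leb, forall x, D x -> ccvg (fun n => g_ n x) (f x)} -> fourier_cvg f.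
Proof.
move=> cg mf gG fG iG cv; apply: (@fourier_cvg_closed g_) => //.
  apply: (@le_cL2 _ _ _ _ _ measurable_pi_itv _ (fun x => G x ^+ 2)) => //.
  move=> x Dx; rewrite ler_pXn2r// ?nnegrE ?normc_ge0 ?fG//.
  by rewrite (le_trans (normc_ge0 (f x)))// fG.
apply: L2_dominated gG fG iG cv => //.
by move=> n; exact: (cg n).1.1.
Qed.

(** A special case of closedness: the constant sequence f tends to g. *)
Lemma fourier_cvg_ae f g : fourier_cvg f -> cmeasurable D g ->
  {ae leb, forall x, D x -> f x = g x} -> fourier_cvg g.
Proof.
move=> cf mg fg; have f2 := cf.1.
have g2 : cL2 leb D g by split => //; rewrite -(eq_ae_normsq _ f2.1 mg fg) ?f2.2.
apply: (@fourier_cvg_closed (fun=> f)) => //.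
have -> : normsq leb D (fun x => f x - g x) = 0.
  rewrite /normsq (@eq_ae_normsq _ _ _ _ _ measurable_pi_itv _ (fun=> 0)).
  - by have := ip_normsq leb measurable_pi_itv (fun=> 0); rewrite ip0l// => -[].
  - exact: (cL2B measurable_pi_itv f2 g2).1.
  - exact: cmeasurable_cst.
  - by apply: filterS fg => x h Dx; rewrite h// subrr.
exact: cvg_cst.
Qed.

End TrigonometricSystem.

(** * Completeness of the trigonometric system *)

Section TrigonometricDensity.
Import HBNNSimple.
Context {R : realType}.
Local Notation leb := (@lebesgue_measure R).
Local Notation D := (@pi_itv R).
Implicit Types (f g : R -> R[i]) (k l : int).
Local Hint Resolve measurable_pi_itv : core.

Lemma negligible_point (a : R) : leb.-negligible [set a].
Proof.
by exists [set a]; split; [exact: measurable_set1|exact: lebesgue_measure_set1|].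
Qed.

Inductive trigpoly : (R -> R[i]) -> Prop :=
| trigpoly_exp k : trigpoly (fun x => expi (k%:~R * x))
| trigpoly_add f g : trigpoly f -> trigpoly g -> trigpoly (fun x => f x + g x)
| trigpoly_scale (a : R[i]) f : trigpoly f -> trigpoly (fun x => a * f x).

Lemma trigpoly_fourier_cvg f : trigpoly f -> fourier_cvg f.
Proof.
elim=> [k|{}f g _ cf _ cg|a {}f _ cf].
- exact: fourier_cvg_cexp.
- exact: (fourier_cvgD cf cg).
- exact: (fourier_cvgZ a cf).
Qed.

Lemma trigpoly_mul f g : trigpoly f -> trigpoly g -> trigpoly (fun x => f x * g x).
Proof.
move=> tf tg; elim: tf => [k|{}f h _ cf _ ch|a {}f _ cf].
- elim: tg => [l|{}g h _ cg _ ch|a {}g _ cg].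
  + rewrite (_ : (fun x => _) = (fun x => expi ((k + l)%:~R * x))).
      exact: trigpoly_exp.
    by apply/funext => x; rewrite expi_int_add.
  + rewrite (_ : (fun x => _) = (fun x => expi (k%:~R * x) * g x + expi (k%:~R * x) * h x)).
      exact: trigpoly_add.
    by apply/funext => x; rewrite mulrDr.
  + rewrite (_ : (fun x => _) = (fun x => a * (expi (k%:~R * x) * g x))).
      exact: trigpoly_scale.
    by apply/funext => x; rewrite mulrCA.
- rewrite (_ : (fun x => _) = (fun x => f x * g x + h x * g x)).
    exact: trigpoly_add.
  by apply/funext => x; rewrite mulrDl.
- rewrite (_ : (fun x => _) = (fun x => a * (f x * g x))).
    exact: trigpoly_scale.
  by apply/funext => x; rewrite mulrA.
Qed.

Lemma trigpoly_cst (a : R[i]) : trigpoly (fun=> a).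
Proof.
rewrite (_ : (fun=> a) = (fun x => a * expi ((0 : int)%:~R * x))).
  exact/trigpoly_scale/trigpoly_exp.
by apply/funext => x; rewrite mul0r expi0 mulr1.
Qed.

Lemma trigpoly_expn f n : trigpoly f -> trigpoly (fun x => f x ^+ n).
Proof.
move=> tf; elim: n => [|n IH].
  rewrite (_ : (fun x => _) = (fun=> 1)); first exact: trigpoly_cst.
  by apply/funext => x; rewrite expr0.
rewrite (_ : (fun x => _) = (fun x => f x * f x ^+ n)).
  exact: trigpoly_mul.
by apply/funext => x; rewrite exprS.
Qed.

Lemma trigpoly_sin (a : R) : trigpoly (fun x => (sin (x - a))%:C).
Proof.
have -> : (fun x => (sin (x - a))%:C) = (fun x => - ('i / 2) * expi (- a) * expi (1%:~R * x) +
   ('i / 2) * expi a * expi ((- 1)%:~R * x)).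
  apply/funext => x; rewrite mulr1z mul1r mulrN1z mulN1r -!mulrA -!expiD.
  rewrite [- a + x]addrC (_ : a - x = - (x - a)); last by rewrite opprB.
  have i2 : 'i / 2 = 0 +i* 2^-1 :> R[i].
    rewrite -[2 in LHS](rmorph_nat (real_complex R)) -fmorphV.
    by apply: complex_eq; rewrite ?Re_mul ?Im_mul/=; ring.
  rewrite mulrA i2 expiN.
  by apply: complex_eq; rewrite /expi ?Re_add ?Im_add ?Re_mul ?Im_mul ?Re_opp ?Im_opp ?Re_conj ?Im_conj/=; field.
by apply: trigpoly_add; apply: trigpoly_scale; exact: trigpoly_exp.
Qed.

(** These polynomials approach, boundedly on [0, 1], the indicator of y < 1/2:
    as (1 - y^n)^(2^n) is about exp (- (2 y)^n), Bernoulli's inequalities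
    suffice. *)
Definition step_poly n (y : R) : R := (1 - y ^+ n) ^+ (2 ^ n).

Lemma bernoulli_le (a : R) m : 0 <= a <= 1 -> 1 - m%:R * a <= (1 - a) ^+ m.
Proof.
move=> /andP[a0 a1]; elim: m => [|m IH]; first by rewrite mul0r subr0 expr0.
rewrite exprS -natr1; have := ler_wpM2l (_ : 0 <= 1 - a) IH; rewrite subr_ge0 => /(_ a1).
apply: le_trans; have : 0 <= m%:R * (a * a) by rewrite !mulr_ge0.
by move: (m%:R) => M; nra.
Qed.

Lemma bernoulli_ge (a : R) m : 0 <= a -> 1 + m%:R * a <= (1 + a) ^+ m.
Proof.
move=> a0; elim: m => [|m IH]; first by rewrite mul0r addr0 expr0.
rewrite exprS -natr1; have := ler_wpM2l (_ : 0 <= 1 + a) IH; rewrite addr_ge0// => /(_ isT).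
apply: le_trans; have : 0 <= m%:R * (a * a) by rewrite !mulr_ge0.
by move: (m%:R) => M; nra.
Qed.

Lemma step_poly_bound n (y : R) : 0 <= y <= 1 -> 0 <= step_poly n y <= 1.
Proof.
move=> /andP[y0 y1]; have yn : y ^+ n <= 1 by rewrite exprn_ile1.
by rewrite exprn_ge0 ?subr_ge0// exprn_ile1 ?subr_ge0// lerBlDr lerDl exprn_ge0.
Qed.

Lemma step_poly_lt (y : R) : 0 <= y < 2^-1 -> step_poly n y @[n --> \oo] --> (1 : R).
Proof.
move=> /andP[y0 y2]; have y1 : y <= 1 by lra.
have h : (2 * y) ^+ n @[n --> \oo] --> (0 : R).
  by apply: cvg_expr; rewrite ger0_norm ?mulr_ge0//; lra.
have h1 : (1 - (2 * y) ^+ n) @[n --> \oo] --> (1 - 0 : R).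
  by apply: cvgB => //; exact: cvg_cst.
rewrite subr0 in h1; apply: (squeeze_cvgr _ h1 (cvg_cst (1 : R))); apply: nearW => n.
have yn : 0 <= y ^+ n <= 1 by rewrite exprn_ge0// exprn_ile1.
have := @bernoulli_le (y ^+ n) (2 ^ n) yn.
rewrite natrX -exprMn => -> /=.
by have /andP[] := @step_poly_bound n y (introT andP (conj y0 y1)).
Qed.

Lemma step_poly_gt (y : R) : 2^-1 < y <= 1 -> step_poly n y @[n --> \oo] --> (0 : R).
Proof.
move=> /andP[y2 y1]; have y0 : 0 < y by lra.
have h : (2 * y)^-1 ^+ n @[n --> \oo] --> (0 : R).
  apply: cvg_expr; rewrite ger0_norm ?invr_ge0 ?mulr_ge0 ?(ltW y0)//.
  by rewrite invf_lt1 ?mulr_gt0//; lra.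
apply: (squeeze_cvgr _ (cvg_cst 0) h); apply: nearW => n.
have yb : 0 <= y <= 1 by rewrite (ltW y0).
have /andP[-> _ /=] := step_poly_bound n yb.
have yn : 0 <= y ^+ n <= 1 by rewrite exprn_ge0 ?(ltW y0)// exprn_ile1 ?(ltW y0).
have hg := @bernoulli_ge (y ^+ n) (2 ^ n) (proj1 (andP yn)).
rewrite natrX -exprMn in hg.
have p1 : 0 < (2 * y) ^+ n by rewrite exprn_gt0// mulr_gt0.
rewrite exprVn -(ler_pM2l p1) divff ?gt_eqF//.
have q1 : step_poly n y * (1 + y ^+ n) ^+ (2 ^ n) <= 1.
  rewrite /step_poly -exprMn exprn_ile1//; move: (y ^+ n) yn => a /andP[a0 a1]; nra.
apply: le_trans q1; rewrite mulrC ler_wpM2l//.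
  by have /andP[] := step_poly_bound n yb.
by rewrite (le_trans _ hg)// lerDr.
Qed.

(** Indicators of half-lines: an arc shorter than a half circle is the
    intersection of two half circles, hence a bounded limit of products of two
    trigonometric polynomials.  The sign s selects the arcs to the right of a
    non-negative a or to the left of a non-positive a. *)
Lemma fourier_cvg_arc (s a : R) : s = 1 \/ s = -1 -> 0 <= s * a <= pi ->
  fourier_cvg (fun x => (\1_[set x : measurableTypeR R | s * a < s * x] x)%:C).
Proof.
move=> s1 /andP[a0 api].
(* y b x < 1/2 on the half circle where s sin (x - b) is positive. *)
pose y (b x : R) := (1 - s * sin (x - b)) / 2.
have sM : s * s = 1 by case: s1 => ->; rewrite ?mulrNN mulr1.
have y01 b x : 0 <= y b x <= 1.
  have := sin_geN1 (x - b); have := sin_le1 (x - b); rewrite /y.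
  by case: s1 => ->; lra.
have mA : measurable [set x : measurableTypeR R | s * a < s * x].
  case: s1 => ->.
  - rewrite (_ : [set x | _] = `]a, +oo[%classic); first exact: measurable_itv.
    by apply/seteqP; split => x /=; rewrite in_itv/= andbT !mul1r.
  - rewrite (_ : [set x | _] = `]-oo, a[%classic); first exact: measurable_itv.
    by apply/seteqP; split => x /=; rewrite in_itv/= !mulN1r ltrN2.
have mind : measurable_fun D (\1_[set x : measurableTypeR R | s * a < s * x] : measurableTypeR R -> R).
  exact: measurable_funTS.
apply: (@fourier_cvg_dominated _ (fun n x => (step_poly n (y 0 x) * step_poly n (y a x))%:C) _ (fun=> 1)).
- move=> n; apply: trigpoly_fourier_cvg.
  have tp b : trigpoly (fun x => (step_poly n (y b x))%:C).
    have ty : trigpoly (fun x => (y b x)%:C).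
      have -> : (fun x => (y b x)%:C) = (fun x => 2^-1 + - (s%:C / 2) * (sin (x - b))%:C).
        apply/funext => x; rewrite /y mulrBl mul1r rmorphB/= fmorphV/= rmorphM/= rmorphM/= fmorphV/=.
        by rewrite rmorph_nat; ring.
      by apply: trigpoly_add; [exact: trigpoly_cst|apply: trigpoly_scale; exact: trigpoly_sin].
    have -> : (fun x => (step_poly n (y b x))%:C) = (fun x => (1 + - 1 * (y b x)%:C ^+ n) ^+ (2 ^ n)).
      by apply/funext => x; rewrite /step_poly rmorphXn rmorphB rmorph1 rmorphXn mulN1r.
    apply: trigpoly_expn; apply: trigpoly_add; first exact: trigpoly_cst.
    by apply: trigpoly_scale; exact: trigpoly_expn.
  rewrite (_ : (fun x => _) = (fun x => (step_poly n (y 0 x))%:C * (step_poly n (y a x))%:C)).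
    exact: trigpoly_mul.
  by apply/funext => x; rewrite rmorphM.
- exact: cmeasurable_real.
- move=> n x _; rewrite normc_real ger0_norm ?mulr_ge0//.
  + have /andP[p0 p1] := step_poly_bound n (y01 0 x).
    have /andP[q0 q1] := step_poly_bound n (y01 a x).
    by rewrite mulr_ile1.
  + by have /andP[] := step_poly_bound n (y01 0 x).
  + by have /andP[] := step_poly_bound n (y01 a x).
- by move=> x _; rewrite normc_real indicE; case: (_ \in _); rewrite ?normr1 ?normr0.
- exact: integrable_pi_cst.
- have null : leb.-negligible [set - pi; 0; pi; a].
    by do 3 ?[apply: negligibleU]; exact: negligible_point.
  move: null => [N [mN N0 subN]]; exists N; split => // x /= nx; apply: subN => /=.
  apply: contrapT => hx; apply: nx => /itvP Dx.
  have [x1 x2 x3 x4] : [/\ x != - pi, x != 0, x != pi & x != a].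
    by split; apply/eqP => e; apply: hx; rewrite e; [left; left; left|left; left; right|left; right|right].
  have xl : - pi < x by rewrite lt_def x1 Dx.
  have xr : x < pi by rewrite lt_def eq_sym x3 Dx.
  suff h : (step_poly n (y 0 x) * step_poly n (y a x)) @[n --> \oo] -->
      (\1_[set x : measurableTypeR R | s * a < s * x] x : R).
    exact: ccvg_real.
  have sgn (b : R) : 0 < s * b < pi -> s * sin b > 0.
    by case: s1 => ->; rewrite ?mul1r ?mulN1r -?sinN => /sin_gt0_pi.
  have sgnN (b : R) : - pi < s * b < 0 -> s * sin b < 0.
    case: s1 => ->; rewrite ?mul1r ?mulN1r => /andP[b1 b2].
      by rewrite -oppr_gt0 -sinN sin_gt0_pi// oppr_gt0 b2 ltrNl.
    by rewrite oppr_lt0 sin_gt0_pi// -oppr_lt0 b2 -ltrN2.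
  have sx : - pi < s * x < pi.
    by case: s1 => ->; rewrite ?mul1r ?mulN1r ?xl ?xr// ltrN2 xr ltrNl xl.
  have sx0 : s * x != 0 by rewrite mulf_neq0//; case: s1 => ->; rewrite ?oppr_eq0 oner_eq0.
  have sxa : s * x != s * a.
    by apply/eqP => /(congr1 ( *%R s)); rewrite !mulrA sM !mul1r => /eqP; rewrite (negbTE x4).
  have [ltax|leax] := ltP (s * a) (s * x).
    rewrite indicE mem_set// -(mulr1 1); apply: cvgM.
      apply: step_poly_lt; rewrite (proj1 (andP (y01 _ _))) /y subr0.
      have := sgn x; case/andP : sx => _ -> ; rewrite andbT => /(_ (le_lt_trans a0 ltax)); lra.
    apply: step_poly_lt; rewrite (proj1 (andP (y01 _ _))) /y.
    have := sgn (x - a); rewrite mulrBr subr_gt0 ltax /=.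
    case/andP : sx => _ sx => /(_ _); have -> : s * x - s * a < pi by lra.
    by move=> /(_ isT); lra.
  rewrite indicE memNset/=; last by apply/negP; rewrite -leNgt.
  have lt : s * x < s * a by rewrite lt_def eq_sym sxa.
  have [sx0'|sx0'] := ltP (s * x) 0.
    have c0 : step_poly n (y 0 x) @[n --> \oo] --> (0 : R).
      apply: step_poly_gt; rewrite (proj2 (andP (y01 _ _))) andbT /y subr0.
      by have := sgnN x; rewrite sx0' (proj1 (andP sx)) => /(_ isT); lra.
    apply: (squeeze_cvgr _ (cvg_cst 0) c0); apply: nearW => n.
    have /andP[p0 p1] := step_poly_bound n (y01 0 x).
    have /andP[q0 q1] := step_poly_bound n (y01 a x).
    by rewrite mulr_ge0//= ler_piMr.
  have c0 : step_poly n (y a x) @[n --> \oo] --> (0 : R).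
    apply: step_poly_gt; rewrite (proj2 (andP (y01 _ _))) andbT /y.
    have := sgnN (x - a); rewrite mulrBr subr_lt0 lt andbT.
    have -> : - pi < s * x - s * a by have := sx0; lra.
    by move=> /(_ isT); lra.
  apply: (squeeze_cvgr _ (cvg_cst 0) c0); apply: nearW => n.
  have /andP[p0 p1] := step_poly_bound n (y01 0 x).
  have /andP[q0 q1] := step_poly_bound n (y01 a x).
  by rewrite mulr_ge0//= ler_piMl.
Qed.

(** Dynkin's theorem: the half-lines are stable under intersection and generate
    the Borel sets, and mean-square convergence of Fourier series passes to
    complements and to countable disjoint unions. *)
Lemma fourier_cvg_indic (A : set (measurableTypeR R)) : measurable A ->
  fourier_cvg (fun x => (\1_A x : R)%:C).
Proof.
have cst1 : fourier_cvg (fun=> 1 : R[i]) by apply: trigpoly_fourier_cvg; exact: trigpoly_cst.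
have compl (B : set (measurableTypeR R)) : fourier_cvg (fun x => (\1_B x : R)%:C) ->
    fourier_cvg (fun x => (\1_(~` B) x : R)%:C).
  move=> cB; rewrite (_ : (fun x => _) = (fun x => 1 - (\1_B x : R)%:C)).
    exact: (fourier_cvgB cst1 cB).
  apply/funext => x; rewrite !indicE in_setC; case: (x \in B) => /=.
    by rewrite subrr.
  by rewrite subr0.
move=> mA.
apply: (@dynkin_induction _ (measurableTypeR R) (@RGenCInfty.G R)
   (fun A => fourier_cvg (fun x => (\1_A x : R)%:C))).
- exact: (@RGenCInfty.measurableE R).
- move=> _ _ [a ->] [b ->]; exists (Num.max a b); apply/seteqP; split => x /=; rewrite !in_itv/= !andbT ge_max.
    by move=> [-> ->].
  by move=> /andP[].
- rewrite (_ : (fun x => _) = (fun=> 1)); first exact: cst1.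
  by apply/funext => x; rewrite indicE in_setT.
- move=> _ [a ->].
  have mE (b : R) : cmeasurable D (fun x => (\1_(`[b, +oo[%classic : set (measurableTypeR R)) x : R)%:C).
    by apply: cmeasurable_real; apply: measurable_funTS; apply: measurable_indic; exact: measurable_itv.
  have null := negligible_point a.
  have [api|pia] := leP a (- pi).
    apply: (@fourier_cvg_ae _ _ _ cst1 (mE a)); apply: aeW => x /itvP Dx.
    by rewrite indicE mem_set//= in_itv/= andbT (le_trans api)// Dx.
  have [api|] := leP a pi; last first.
    move=> pia'; apply: (@fourier_cvg_ae _ (fun=> 0) _ _ (mE a)).
      exact: trigpoly_fourier_cvg (trigpoly_cst 0).
    apply: aeW => x /itvP Dx; rewrite indicE memNset//= in_itv/= andbT.
    by apply/negP; rewrite -ltNge (le_lt_trans _ pia')// Dx.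
  have [a0|a0] := leP 0 a.
    have c := @fourier_cvg_arc 1 a (or_introl erefl).
    rewrite mul1r a0 api in c; apply: (@fourier_cvg_ae _ _ _ (c isT) (mE a)).
    move: null => [N [mN N0 subN]]; exists N; split => // x /= nx; apply: subN => /=.
    apply: contrapT => xa; apply: nx => Dx; congr real_complex_def.
    rewrite !indicE; congr (_ %:R); apply: congr1; apply/idP/idP => /set_mem/=; rewrite ?in_itv/= ?mul1r ?andbT => h;
      rewrite inE/= ?in_itv/= ?mul1r ?andbT ?(ltW h)//.
    by rewrite lt_neqAle h andbT; apply/eqP => e; apply: xa.
  have c := @fourier_cvg_arc (-1) a (or_intror erefl).
  rewrite mulN1r oppr_ge0 (ltW a0) (_ : - a <= pi) in c; last by lra.
  apply: (@fourier_cvg_ae _ _ _ (compl _ (c isT)) (mE a)).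
  apply: aeW => x Dx; congr real_complex_def.
  rewrite !indicE in_setC; congr (_ %:R); apply: congr1.
  apply/negP/idP => [h|/set_mem/= + /set_mem/=].
    by rewrite inE/= in_itv/= andbT leNgt; apply/negP => xa; apply: h; rewrite inE/= mulN1r ltrN2.
  by rewrite in_itv/= andbT mulN1r ltrN2 leNgt => /negP.
- by move=> S mS; exact: compl.
- move=> F mF tF cF.
  apply: (@fourier_cvg_dominated _ (fun n x => \sum_(k < n) (\1_(F k) x : R)%:C) _ (fun=> 1)).
  + by move=> n; apply: fourier_cvg_sum => k; exact: cF.
  + by apply: cmeasurable_real; apply: measurable_funTS; apply: measurable_indic; exact: bigcup_measurable.
  + move=> n x _.
    have [[j _ Fj]|nF] := pselect ((\bigcup_k F k) x).
      have [jn|nj] := ltnP j n.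
        rewrite (bigD1 (Ordinal jn))//= big1 ?addr0; first by rewrite indicE mem_set// normc1.
        move=> i /eqP ij; rewrite indicE memNset// => Fi; apply: ij; apply: val_inj => /=.
        by apply: (tF i j) => //; exists x.
      rewrite big1 ?normc0// => i _; rewrite indicE memNset// => Fi.
      have e : i = j :> nat by apply: (tF i j) => //; exists x.
      by have := ltn_ord i; rewrite e ltnNge nj.
    rewrite big1 ?normc0// => i _; rewrite indicE memNset// => Fi; apply: nF; by exists i.
  + by move=> x _; rewrite normc_real indicE; case: (_ \in _); rewrite ?normr1 ?normr0.
  + exact: integrable_pi_cst.
  + apply: aeW => x _.
    have [[j _ Fj]|nF] := pselect ((\bigcup_k F k) x).
      apply/ccvgP; apply: (@cvg_near_cst _ _ _ _ _ eventually_filter); exists j.+1 => // n /= jn.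
      rewrite (bigD1 (Ordinal jn))//= big1 ?addr0.
        by rewrite !indicE !mem_set ?subrr ?normc0//; exists j.
      move=> i /eqP ij; rewrite indicE memNset// => Fi; apply: ij; apply: val_inj => /=.
      by apply: (tF i j) => //; exists x.
    apply/ccvgP; apply: (@cvg_near_cst _ _ _ _ _ eventually_filter); apply: nearW => n.
    rewrite indicE memNset// subr0 big1 ?normc0// => i _; rewrite indicE memNset// => Fi; apply: nF; by exists i.
- suff: (@RGenCInfty.G R).-sigma.-measurable A by [].
  by rewrite -(@RGenCInfty.measurableE R).
Qed.

(** Simple functions increase to g, which dominates them. *)
Lemma fourier_cvg_nneg (g : measurableTypeR R -> R) : measurable_fun D g ->
  (forall x, D x -> 0 <= g x) -> leb.-integrable D (EFin \o (fun x => g x ^+ 2)) ->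
  fourier_cvg (fun x => (g x)%:C).
Proof.
move=> mg g0 ig.
have mEg : measurable_fun D (EFin \o g) by apply/measurable_EFinP.
have g0' x : D x -> (0 <= (EFin \o g) x)%E by move=> Dx; rewrite lee_fin g0.
pose h := nnsfun_approx measurable_pi_itv mEg.
have h_cvg x : D x -> (fun n => h n x : R) @ \oo --> g x.
  move=> Dx; have := cvg_nnsfun_approx measurable_pi_itv mEg g0' Dx.
  by move=> /fine_cvgP[_]; exact.
have h_le n x : D x -> h n x <= g x.
  move=> Dx; rewrite -(cvg_lim _ (h_cvg _ Dx))//; apply: nondecreasing_cvgn_le.
    by move=> b c bc; have /lefP := nd_nnsfun_approx measurable_pi_itv mEg bc; exact.
  by apply/cvg_ex; exists (g x); exact: h_cvg.
apply: (@fourier_cvg_dominated _ (fun n x => (h n x : R)%:C) _ g) => //.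
- move=> n.
  under eq_fun do rewrite fimfunEord rmorph_sum.
  apply: fourier_cvg_sum => i; under eq_fun do rewrite rmorphM.
  by apply: fourier_cvgZ; apply: fourier_cvg_indic; exact: measurable_sfunP.
- by move=> n x Dx; rewrite normc_real ger0_norm ?h_le.
- by move=> x Dx; rewrite normc_real ger0_norm ?g0.
- by apply: aeW => x Dx; apply: ccvg_real; exact: h_cvg.
Qed.

(** By linearity it suffices to treat the positive and the negative parts of the
    real and of the imaginary part. *)
Lemma fourier_cvg_L2 f : cL2 leb D f -> fourier_cvg f.
Proof.
move=> f2.
have real_case (p : R[i] -> R) : measurable_fun D (fun x => p (f x)) ->
    (forall z, `|p z| <= normc z) -> fourier_cvg (fun x => (p (f x))%:C).
  move=> mp pn.
  have part (q : R -> R) : measurable_fun D (fun x => q (p (f x))) ->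
      (forall x, 0 <= q x <= `|x|) -> fourier_cvg (fun x => (q (p (f x)))%:C).
    move=> mq q0; apply: fourier_cvg_nneg => //.
      by move=> x _; have /andP[] := q0 (p (f x)).
    apply: le_integrable (cL2_sqr_integrable f2) => //.
      by apply/measurable_EFinP; exact: measurable_funX.
    move=> x _ /=; rewrite lee_fin !ger0_norm ?sqr_ge0//.
    have /andP[q1 q2] := q0 (p (f x)).
    by rewrite ler_pXn2r// ?nnegrE ?normc_ge0// (le_trans q2).
  rewrite (_ : (fun x => _) = (fun x => (Num.max (p (f x)) 0)%:C - (Num.max (- p (f x)) 0)%:C)); last first.
    apply/funext => x; rewrite -rmorphB; congr (_%:C).
    by case: (leP (p (f x)) 0) => h1; case: (leP (- p (f x)) 0) => h2; lra.
  apply: fourier_cvgB.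
  - apply: (part (fun x => Num.max x 0)); first exact: measurable_maxr.
    by move=> x; rewrite le_max lexx orbT /= ge_max normr_ge0 ler_norm.
  - apply: (part (fun x => Num.max (- x) 0)).
      by apply: measurable_maxr => //; exact: measurableT_comp.
    by move=> x; rewrite le_max lexx orbT /= ge_max normr_ge0 lerNl lerNnormlW.
rewrite (_ : f = (fun x => (complex.Re (f x))%:C + 'i * (complex.Im (f x))%:C)); last first.
  by apply/funext => x; exact: complexE.
apply: fourier_cvgD; last apply: fourier_cvgZ.
- apply: real_case; [exact: f2.1.1|exact: normc_Re_le].
- apply: real_case; [exact: f2.1.2|exact: normc_Im_le].
Qed.

End TrigonometricDensity.

(** * Operators on L^2([0,1]) and their forms *)

Section RealSums.
Context {R : realType}.

Lemma sum_cauchy_schwarz n (a b : nat -> R) : (forall j, 0 <= a j) -> (forall j, 0 <= b j) ->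
  \sum_(j < n) a j * b j <=
  Num.sqrt (\sum_(j < n) a j ^+ 2) * Num.sqrt (\sum_(j < n) b j ^+ 2).
Proof.
move=> a0 b0; elim: n => [|n IH]; first by rewrite !big_ord0 sqrtr0 mulr0.
rewrite !big_ord_recr/=; apply: (le_trans (lerD IH (lexx _))).
set A := \sum_(j < n) a j ^+ 2; set B := \sum_(j < n) b j ^+ 2.
have A0 : 0 <= A by apply: sumr_ge0 => j _; exact: sqr_ge0.
have B0 : 0 <= B by apply: sumr_ge0 => j _; exact: sqr_ge0.
have an := a0 n; have bn := b0 n.
rewrite -(ler_pXn2r (_ : 0 < 2)%N)// ?nnegrE; last 2 first.
- by rewrite addr_ge0 ?mulr_ge0 ?sqrtr_ge0.
- by rewrite mulr_ge0 ?sqrtr_ge0.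
rewrite exprMn !sqr_sqrtr ?addr_ge0 ?sqr_ge0//.
move: (sqrtr_ge0 A) (sqrtr_ge0 B) (sqr_sqrtr A0) (sqr_sqrtr B0).
move: (Num.sqrt A) (Num.sqrt B) => x y x0 y0 <- <-.
by have := sqr_ge0 (x * b n - y * a n); rewrite !expr2; nra.
Qed.

End RealSums.

Section OperatorsOnH.
Context {R : realType}.
Local Notation leb := (@lebesgue_measure R).
Local Notation U := (@unit_itv R).
Local Notation op := ((R -> R[i]) -> R -> R[i]).
Implicit Types (x y : R -> R[i]) (A B : op).

Lemma measurable_unit_itv : measurable U. Proof. exact: measurable_itv. Qed.
Local Hint Resolve measurable_unit_itv : core.

Definition nsqH x : R := normsq leb U x.

Definition normH x : R := L2norm leb U x.

Lemma dotHE x y : dotH x y = ip leb U x y. Proof. by []. Qed.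

Lemma normH_ge0 x : 0 <= normH x. Proof. exact: L2norm_ge0. Qed.

Lemma sqr_normH x : normH x ^+ 2 = nsqH x. Proof. exact: sqr_L2norm. Qed.

Lemma sqnormHE x : inH x -> sqnormH x = (nsqH x)%:E.
Proof. exact: sqnormE. Qed.

Lemma inHD x y : inH x -> inH y -> inH (fun u => x u + y u).
Proof. exact: cL2D. Qed.

Lemma inHB x y : inH x -> inH y -> inH (fun u => x u - y u).
Proof. exact: cL2B. Qed.

Lemma inHZ (a : R[i]) x : inH x -> inH (fun u => a * x u).
Proof. exact: cL2Z. Qed.

Lemma inH0 : inH (fun=> 0 : R[i]). Proof. exact: cL20. Qed.

Lemma inH_sum n (x : 'I_n -> R -> R[i]) : (forall j, inH (x j)) ->
  inH (fun u => \sum_(j < n) x j u).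
Proof. by move=> hx; apply: cL2_sum. Qed.

Lemma dotH_bound x y : inH x -> inH y -> normc (dotH x y) <= normH x * normH y.
Proof. exact: cauchy_schwarz_norm. Qed.

Lemma dotHDl x y z : inH x -> inH y -> inH z ->
  dotH (fun u => x u + y u) z = dotH x z + dotH y z.
Proof. exact: ipDl. Qed.

Lemma dotHBr x y z : inH x -> inH y -> inH z ->
  dotH z (fun u => x u - y u) = dotH z x - dotH z y.
Proof. exact: ipBr. Qed.

Lemma dotHZl (a : R[i]) x y : inH x -> inH y ->
  dotH (fun u => a * x u) y = a * dotH x y.
Proof. exact: ipZl. Qed.

Lemma dotHZr (a : R[i]) x y : inH x -> inH y ->
  dotH y (fun u => a * x u) = a^* * dotH y x.
Proof. exact: ipZr. Qed.

Lemma dotH_suml n (x : 'I_n -> R -> R[i]) y : (forall j, inH (x j)) -> inH y ->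
  dotH (fun u => \sum_(j < n) x j u) y = \sum_(j < n) dotH (x j) y.
Proof. by move=> hx hy; exact: ip_suml. Qed.

Lemma dotH_sumr n (x : 'I_n -> R -> R[i]) y : (forall j, inH (x j)) -> inH y ->
  dotH y (fun u => \sum_(j < n) x j u) = \sum_(j < n) dotH y (x j).
Proof. by move=> hx hy; exact: ip_sumr. Qed.

Lemma eq_ae_dotHl x y z : inH x -> inH y -> inH z ->
  {ae leb, forall u, U u -> x u = y u} -> dotH x z = dotH y z.
Proof. by move=> hx hy hz; apply: eq_ae_ipl => //; [exact: hx.1|exact: hy.1|exact: hz.1]. Qed.

Lemma dotH_conj x y : inH x -> inH y -> dotH y x = (dotH x y)^*.
Proof. exact: ip_conj. Qed.

Lemma dotHxx x : dotH x x = (nsqH x)%:C. Proof. exact: ip_normsq. Qed.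

(** The form of an operator that respects representatives only up to null sets
    is exactly sesquilinear. *)
Lemma form_lin A (a : R[i]) x x' y : bounded_linearH A -> inH x -> inH x' -> inH y ->
  dotH (A (fun v => a * x v + x' v)) y = a * dotH (A x) y + dotH (A x') y.
Proof.
move=> [Ain Alin _] hx hx' hy.
rewrite (eq_ae_dotHl _ _ hy (Alin a x x' hx hx')).
- have hAx := Ain _ hx; have hAx' := Ain _ hx'.
  by rewrite dotHDl ?dotHZl//; exact: inHZ.
- by apply: Ain; apply: inHD => //; exact: inHZ.
- by apply: inHD; [apply: inHZ; exact: Ain|exact: Ain].
Qed.

Lemma form0 A y : bounded_linearH A -> inH y -> dotH (A (fun=> 0)) y = 0.
Proof.
move=> bA hy; have := form_lin (-1) bA inH0 inH0 hy.
have -> : (fun v : R => -1 * (0 : R[i]) + 0) = (fun=> 0) by apply/funext => v; rewrite mulr0 addr0.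
by rewrite mulN1r addNr.
Qed.

Lemma formB A x x' y : bounded_linearH A -> inH x -> inH x' -> inH y ->
  dotH (A (fun v => x v - x' v)) y = dotH (A x) y - dotH (A x') y.
Proof.
move=> bA hx hx' hy.
rewrite (_ : (fun v => x v - x' v) = (fun v => -1 * x' v + x v)).
  by rewrite form_lin// mulN1r addrC.
by apply/funext => v; rewrite mulN1r addrC.
Qed.

Lemma form_sum A n (a : 'I_n -> R[i]) (x : 'I_n -> R -> R[i]) y : bounded_linearH A ->
  (forall j, inH (x j)) -> inH y ->
  dotH (A (fun v => \sum_(j < n) a j * x j v)) y = \sum_(j < n) a j * dotH (A (x j)) y.
Proof.
move=> bA hx hy; elim: n a x hx => [|n IH] a x hx.
  rewrite big_ord0 (_ : (fun v => _) = (fun=> 0)); first exact: form0.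
  by apply/funext => v; rewrite big_ord0.
rewrite big_ord_recr/= addrC.
rewrite (_ : (fun v => _) = (fun v => a ord_max * x ord_max v +
   \sum_(j < n) a (widen_ord (leqnSn n) j) * x (widen_ord (leqnSn n) j) v)).
  rewrite form_lin//; first by rewrite IH.
  by apply: inH_sum => j; exact: inHZ.
by apply/funext => v; rewrite big_ord_recr/= addrC.
Qed.

Lemma basis_approx e x : orthonormal_basisH e -> inH x ->
  nsqH (fun u => x u - \sum_(j < n) dotH x (e j) * e j u) @[n --> \oo] --> 0.
Proof.
move=> [[he _] hb] hx; apply: (proj1 (@sqnorm_cvg0P _ _ _ leb U measurable_unit_itv _ _) (hb x hx)).
by move=> n; apply: inHB => //; apply: inH_sum => j; exact: inHZ.
Qed.

Lemma bessel_H n (e : nat -> R -> R[i]) x : orthonormalH e -> inH x ->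
  \sum_(j < n) normc (dotH x (e j)) ^+ 2 <= nsqH x.
Proof.
move=> [he eo] hx.
have := @bessel_le _ _ _ leb U measurable_unit_itv n 1 (fun j => e j) x ltr01
  (fun j => he j) hx; rewrite mul1r; apply.
by move=> j k; rewrite -dotHE eo -[in RHS]val_eqE; case: eqP.
Qed.

Lemma HSnormE e A : (HSnorm e A < +oo)%E ->
  fine (HSnorm e A) = Num.sqrt (fine (\sum_(0 <= j <oo) sqnormH (A (e j)))%E).
Proof. by move=> _; rewrite /HSnorm fine_poweR powR12_sqrt// fine_ge0// nneseries_ge0// => j _ _; apply: integral_ge0 => u _; rewrite lee_fin sqr_ge0. Qed.

Lemma HSnorm_ge0 e A : (0 <= HSnorm e A)%E.
Proof. exact: poweR_ge0. Qed.

(** Unlike the operator, its form only involves the fixed functions A e_j, which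
    is what makes it measurable in parameters. *)
Lemma form_basis_cvg e A x y : orthonormal_basisH e -> bounded_linearH A ->
  inH x -> inH y ->
  ccvg (fun n => \sum_(j < n) dotH x (e j) * dotH (A (e j)) y) (dotH (A x) y).
Proof.
move=> he bA hx hy; have [[ein eo] _] := he; have [Ain _ [K AK]] := bA.
pose xn n (u : R) := \sum_(j < n) dotH x (e j) * e j u.
have hxn n : inH (xn n) by apply: inH_sum => j; exact: inHZ.
pose Kp := Num.max K 0.
have h := basis_approx he hx.
have h' : Num.sqrt (Kp * nsqH (fun u => x u - xn n u)) * normH y @[n --> \oo] --> (0 : R).
  rewrite -(mul0r (normH y)); apply: cvgM; last exact: cvg_cst.
  rewrite -sqrtr0 -(mulr0 Kp).
  apply: (cvg_comp _ _ (cvgM (cvg_cst Kp) h)).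
  exact: sqrt_continuous.
apply: (ccvg_le _ h') => n; rewrite -form_sum// normcB_sym -formB//; last exact: (hxn n).
apply: (le_trans (dotH_bound _ _)) => //.
  by apply: Ain; exact: (inHB hx (hxn n)).
rewrite ler_wpM2r ?normH_ge0// /normH /L2norm ler_wsqrtr//.
have hd := inHB hx (hxn n).
have := AK _ hd; rewrite (sqnormHE hd) sqnormHE; last exact: Ain.
rewrite -EFinM lee_fin => /le_trans; apply.
by rewrite ler_wpM2r ?normsq_ge0// le_max lexx.
Qed.

(** A Hilbert-Schmidt operator is bounded by its Hilbert-Schmidt norm: expand
    the argument in the basis and use the Cauchy-Schwarz inequality twice. *)
Lemma HS_form_bound e A x y : orthonormal_basisH e -> bounded_linearH A ->
  (HSnorm e A < +oo)%E -> inH x -> inH y ->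
  normc (dotH (A x) y) <= fine (HSnorm e A) * normH x * normH y.
Proof.
move=> he bA Afin hx hy; have [[ein eo] _] := he; have [Ain _ _] := bA.
rewrite HSnormE//; set S := (\sum_(0 <= j <oo) sqnormH (A (e j)))%E.
have Sfin : (S < +oo)%E by apply: lty_poweRy Afin; rewrite invr_eq0 pnatr_eq0.
have S0 : (0 <= S)%E.
  by apply: nneseries_ge0 => j _ _; apply: integral_ge0 => u _; rewrite lee_fin sqr_ge0.
have bound n : normc (\sum_(j < n) dotH x (e j) * dotH (A (e j)) y) <=
    Num.sqrt (fine S) * normH x * normH y.
  apply: (le_trans (normc_sum _ _ _)).
  apply: (@le_trans _ _ (\sum_(j < n) normc (dotH x (e j)) * normH (A (e j)) * normH y)).
    apply: ler_sum => j _; rewrite normcM -mulrA ler_wpM2l ?normc_ge0//.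
    by apply: dotH_bound => //; exact: Ain.
  rewrite -mulr_suml ler_wpM2r ?normH_ge0//.
  apply: (le_trans (@sum_cauchy_schwarz _ n (fun j => normc (dotH x (e j))) (fun j => normH (A (e j))) _ _)).
  - by move=> j; exact: normc_ge0.
  - by move=> j; exact: normH_ge0.
  rewrite mulrC; apply: ler_pM; rewrite ?sqrtr_ge0//; last first.
    by rewrite /normH /L2norm ler_wsqrtr// bessel_H.
  rewrite ler_wsqrtr//.
  have SE : S = (fine S)%:E by rewrite fineK// ge0_fin_numE.
  rewrite -lee_fin -SE.
  have -> : (\sum_(j < n) normH (A (e j)) ^+ 2)%:E = (\sum_(0 <= j < n) sqnormH (A (e j)))%E.
    rewrite big_mkord -sumEFin; apply: eq_bigr => j _; rewrite sqr_normH sqnormHE//; exact: Ain.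
  by apply: nneseries_lim_ge => j _ _; apply: integral_ge0 => u _; rewrite lee_fin sqr_ge0.
exact: (ccvg_normc_le (form_basis_cvg he bA hx hy) bound).
Qed.

Lemma bounded_linearH_lin A B (a : R[i]) : bounded_linearH A -> bounded_linearH B ->
  bounded_linearH (fun x u => A x u + a * B x u).
Proof.
move=> [Ain Alin [K AK]] [Bin Blin [L BL]]; split.
- by move=> x hx; apply: inHD; [exact: Ain|apply: inHZ; exact: Bin].
- move=> b x y hx hy; apply: filterS2 (Alin b x y hx hy) (Blin b x y hx hy) => u h1 h2 Uu.
  by rewrite h1// h2//; ring.
- exists (2 * K + 2 * (normc a ^+ 2 * L)) => x hx.
  have hA := Ain x hx; have hB := Bin x hx.
  rewrite sqnormHE; last by apply: inHD => //; exact: inHZ.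
  rewrite (sqnormHE hx) -EFinM lee_fin.
  apply: (le_trans (normsqD_le _ hA (inHZ a hB))) => //.
  rewrite (normsqZ measurable_unit_itv a hB) [leRHS]mulrDl; apply: lerD.
    rewrite -mulrA ler_wpM2l//.
    by have := AK x hx; rewrite !sqnormHE// -EFinM lee_fin.
  rewrite (_ : 2 * (normc a ^+ 2 * L) * nsqH x = 2 * (normc a ^+ 2 * (L * nsqH x))); last by rewrite !mulrA.
  rewrite ler_wpM2l// ler_wpM2l ?sqr_ge0//.
  by have := BL x hx; rewrite !sqnormHE// -EFinM lee_fin.
Qed.

Lemma bounded_linearH0 : bounded_linearH (fun _ _ => 0 : R[i]).
Proof.
split => [x _|a x y _ _|]; first exact: inH0.
  by apply: aeW => u _; rewrite mulr0 addr0.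
exists 0 => x _; rewrite mul0e (sqnormHE inH0) lee_fin.
have -> : nsqH (fun=> 0) = 0 by apply: complexI; rewrite -dotHxx dotHE ip0l.
exact: lexx.
Qed.

Lemma bounded_linearH_zsum N (C : int -> op) (a : int -> R[i]) :
  (forall h, bounded_linearH (C h)) ->
  bounded_linearH (fun x u => zsum N (fun h => C h x u * a h)).
Proof.
move=> bC.
suff gen n : bounded_linearH (fun x u => \sum_(k < n) C (k%:Z - N%:Z) x u * a (k%:Z - N%:Z)).
  exact: gen.
elim: n => [|n IH].
  rewrite (_ : (fun x u => _) = (fun _ _ => 0)); first exact: bounded_linearH0.
  by apply/funext => x; apply/funext => u; rewrite big_ord0.
rewrite (_ : (fun x u => _) = (fun x u => \sum_(k < n) C (k%:Z - N%:Z) x u * a (k%:Z - N%:Z) +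
    a (n%:Z - N%:Z) * C (n%:Z - N%:Z) x u)).
  exact: (bounded_linearH_lin _ IH (bC _)).
by apply/funext => x; apply/funext => u; rewrite big_ord_recr/= [X in _ + X]mulrC.
Qed.

Lemma kernel_section_ae (k : R -> R -> R[i]) :
  cmeasurable (U `*` U) (fun q : measurableTypeR R * measurableTypeR R => k q.1 q.2) ->
  (\int[leb]_(u in U) sqnormH (k u) < +oo)%E ->
  {ae leb, forall u, U u -> inH (k u)}.
Proof.
move=> mk kfin.
have isq : leb.-integrable U (fun u => sqnormH (k u)).
  apply: integrable_of_ge0 => //.
  - exact: (measurable_sqnorm1 leb measurable_unit_itv measurable_unit_itv mk).
  - by move=> u _; exact: sqnorm_ge0.
have := integrable_ae measurable_unit_itv isq; apply: filterS => u h Uu.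
split; first exact: (cmeasurable_section1 measurable_unit_itv measurable_unit_itv Uu mk).
by rewrite -/(sqnormH _) -ge0_fin_numE ?h//; exact: sqnorm_ge0.
Qed.

(** By the Cauchy-Schwarz inequality in the second variable, the operator is
    bounded by the L^2 norm of its kernel. *)
Lemma kernel_op_bounded (k : R -> R -> R[i]) :
  cmeasurable (U `*` U) (fun q : measurableTypeR R * measurableTypeR R => k q.1 q.2) ->
  (\int[leb]_(u in U) sqnormH (k u) < +oo)%E -> bounded_linearH (kernel_op k).
Proof.
move=> mk kfin.
have msq : measurable_fun U (fun u => sqnormH (k u)).
  exact: (measurable_sqnorm1 leb measurable_unit_itv measurable_unit_itv mk).
have sq0 u : (0 <= sqnormH (k u))%E by exact: sqnorm_ge0.
have kin := kernel_section_ae mk kfin.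
have isq : leb.-integrable U (fun u => sqnormH (k u)).
  by apply: integrable_of_ge0.
have dotk u x : kernel_op k x u = dotH (k u) (fun v => (x v)^*).
  by apply: eq_cintegral => v _; rewrite conjCK.
have inHconj x : inH x -> inH (fun v => (x v)^*) by exact: cL2_conj.
have nconj x : inH x -> nsqH (fun v => (x v)^*) = nsqH x.
  by move=> hx; rewrite /nsqH !normsqE; apply: eq_Rintegral => v _; rewrite normc_conj.
have mK x : inH x -> cmeasurable U (kernel_op k x).
  move=> hx; apply: (cmeasurable_cintegral1 leb measurable_unit_itv measurable_unit_itv
    (f := fun q => k q.1 q.2 * x q.2)).
  apply: cmeasurableM => //.
  apply: (cmeasurable_comp measurable_unit_itv _ hx.1); first by move=> q [].
  exact: measurable_funTS measurable_snd.
have bound x : inH x -> (sqnormH (kernel_op k x) <= (fine (\int[leb]_(u in U) sqnormH (k u)))%:E * sqnormH x)%E.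
  move=> hx; rewrite fineK; last by rewrite ge0_fin_numE//; exact: integral_ge0.
  rewrite (sqnormHE hx) -integralZr//; apply: ae_ge0_le_integral => //.
  - by apply/measurable_EFinP; apply: measurable_sqr_normc; exact: mK.
  - by apply: emeasurable_funM => //; exact: measurable_cst.
  - by move=> u _; rewrite lee_fin sqr_ge0.
  - by move=> u _; rewrite mule_ge0// lee_fin normsq_ge0.
  - apply: filterS kin => u h Uu; rewrite (sqnormHE (h Uu)) -EFinM lee_fin dotk.
    by rewrite -(nconj x hx); apply: cauchy_schwarz => //; [exact: h|exact: inHconj].
split => [x hx|a x y hx hy|].
- split; first exact: mK.
  rewrite (le_lt_trans (bound x hx))// (sqnormHE hx) -EFinM ltry//.
- apply: filterS kin => u h Uu; have hk := h Uu; rewrite !dotk.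
  rewrite -[in RHS](conjCK a) -(dotHZr _ (inHconj x hx) hk) -(ipDr _ (inHZ _ (inHconj x hx)) (inHconj y hy) hk)//.
  by apply: eq_cintegral => v _; congr (_ * Num.conj _); rewrite conjD conjM.
- by exists (fine (\int[leb]_(u in U) sqnormH (k u))%E).
Qed.

End OperatorsOnH.

(** * Covariances of the coordinates of a stationary process *)

Section SecondMoments.
Context {R : realType} {d : measure_display} {Omega : measurableType d}.
Context (P : probability Omega R) (X : int -> Omega -> R -> R[i]).
Hypotheses (HX : H_process X) (Hstat : weakly_stationary P X).
Local Notation leb := (@lebesgue_measure R).
Local Notation U := (@unit_itv R).
Local Notation L2P := (cL2 P setT).
Implicit Types (f g : R -> R[i]) (s t h : int).
Local Hint Resolve measurable_unit_itv : core.
Let mU := @measurable_unit_itv R.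
Let mT : measurable [set: Omega]. Proof. exact: measurableT. Qed.

Let mX t : cmeasurable ([set: Omega] `*` U)
  (fun q : Omega * measurableTypeR R => X t q.1 q.2).
Proof. by have [] := HX t. Qed.

Let X_inH t w : inH (X t w).
Proof. by have [_] := HX t. Qed.

Let mXu t u : U u -> cmeasurable setT (fun w => X t w u).
Proof. by move=> Uu; exact: (cmeasurable_section2 mT mU Uu (mX t)). Qed.

Lemma probability_integrable_cst (r : R) : P.-integrable setT (EFin \o (fun=> r)).
Proof. exact: finite_measure_integrable_cst. Qed.

Lemma cL2_cst (z : R[i]) : L2P (fun=> z).
Proof.
apply: (@le_cL2 _ _ _ _ _ mT _ (fun=> normc z ^+ 2)) => //.
exact: probability_integrable_cst.
Qed.

Lemma energy_lty t : (\int[P]_w sqnormH (X t w) < +oo)%E.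
Proof. by have [h _ _] := Hstat; exact: h. Qed.

Lemma variance_lty t : (\int[leb]_(u in U) sqnorm P setT (fun w => X t w u) < +oo)%E.
Proof.
rewrite -(tonelli_sqnorm P leb mT mU (mX t)).
exact: energy_lty.
Qed.

Let measurable_variance t : measurable_fun U (fun u => sqnorm P setT (fun w => X t w u)).
Proof. exact: (measurable_sqnorm2 P mT mU (mX t)). Qed.

Lemma variance_ae t : {ae leb, forall u, U u -> L2P (fun w => X t w u)}.
Proof.
have iv : leb.-integrable U (fun u => sqnorm P setT (fun w => X t w u)).
  apply: integrable_of_ge0 => //; last exact: variance_lty.
  by move=> u _; exact: sqnorm_ge0.
have := integrable_ae mU iv; apply: filterS => u h Uu.
by split; [exact: mXu|rewrite -ge0_fin_numE ?h//; exact: sqnorm_ge0].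
Qed.

Lemma energy_integrable t : P.-integrable setT (EFin \o (fun w => nsqH (X t w))).
Proof.
apply/integrableP; split.
  apply: (eq_measurable_fun (fun w => sqnormH (X t w))).
    by move=> w _; rewrite /= sqnormHE.
  exact: (measurable_sqnorm1 leb mT mU (mX t)).
apply: le_lt_trans (energy_lty t); rewrite le_eqVlt; apply/orP; left; apply/eqP.
by apply: eq_integral => w _; rewrite /= ger0_norm ?normsq_ge0// sqnormHE.
Qed.

Let m_tensor t f : inH f -> cmeasurable ([set: Omega] `*` U)
  (fun q : Omega * measurableTypeR R => X t q.1 q.2 * (f q.2)^*).
Proof.
move=> hf; apply: cmeasurableM => //; apply: cmeasurable_conj.
apply: (cmeasurable_comp mU _ hf.1); first by move=> q [].
exact: measurable_funTS measurable_snd.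
Qed.

Lemma coordinate_L2 t f : inH f -> L2P (fun w => dotH (X t w) f).
Proof.
move=> hf; apply: (@le_cL2 _ _ _ _ _ mT _ (fun w => nsqH (X t w) * nsqH f)).
- exact: (cmeasurable_cintegral1 leb mT mU (m_tensor t hf)).
- by move=> w _; exact: (cauchy_schwarz mU (X_inH t w) hf).
- rewrite /comp; under eq_fun do rewrite EFinM.
  by apply: integrableZr => //; exact: energy_integrable.
Qed.

(** Fubini's theorem, for a coordinate of the process times a square integrable
    variable; it is applied twice to reduce the covariances of coordinates to
    the autocovariance kernel. *)
Lemma coordinate_swap t f (W : Omega -> R[i]) : inH f -> L2P W ->
  cE P (fun w => dotH (X t w) f * W w) =
  cintegral leb U (fun u => (f u)^* * cE P (fun w => X t w u * W w)).
Proof.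
move=> hf hW.
have mW : cmeasurable ([set: Omega] `*` U) (fun q : Omega * measurableTypeR R => W q.1).
  by apply: (cmeasurable_comp mT _ hW.1) => //; exact: measurable_funTS measurable_fst.
pose F (q : Omega * measurableTypeR R) := W q.1 * (X t q.1 q.2 * (f q.2)^*).
have mF : cmeasurable ([set: Omega] `*` U) F.
  by apply: cmeasurableM => //; exact: m_tensor.
rewrite /cE (@eq_cintegral _ _ _ _ _ _ (fun w => cintegral leb U (fun u => F (w, u)))); last first.
  move=> w _; rewrite /F/= [RHS]cintegralZ//; first by rewrite mulrC.
  exact: (cL2_cintegrable mU (X_inH t w) hf).
rewrite (cfubini_on mT mU mF).
- apply: ae_eq_cintegral => //.
  + exact: (cmeasurable_cintegral2 P mT mU mF).
  + apply: cmeasurableM; first exact/cmeasurable_conj/hf.1.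
    have mXW : cmeasurable ([set: Omega] `*` U) (fun q : Omega * measurableTypeR R => X t q.1 q.2 * W q.1).
      exact: cmeasurableM.
    exact: (cmeasurable_cintegral2 P mT mU mXW).
  + apply: filterS (variance_ae t) => u hu Uu; rewrite /F/= -cintegralZ//.
      by apply: eq_cintegral => w _; ring.
    have hWc := cL2_conj mT hW.
    have := cL2_cintegrable mT (hu Uu) hWc.
    by under [in X in X -> _]eq_fun do rewrite conjCK.
(* |W X f| <= |W|^2 |f|^2 + |X|^2 gives absolute integrability. *)
- apply: (@le_lt_trans _ _ (\int[P]_w ((normc (W w) ^+ 2)%:E * (nsqH f)%:E + (nsqH (X t w))%:E))%E).
    have mnF : measurable_fun ([set: Omega] `*` U) (fun q => (normc (F q))%:E).
      by apply/measurable_EFinP; exact: measurable_normc.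
    apply: ge0_le_integral => //.
    + by move=> w _; apply: integral_ge0 => u _; rewrite lee_fin normc_ge0.
    + by apply: (ge0_measurable_integral1 leb mT mU mnF) => q; rewrite lee_fin normc_ge0.
    + apply: emeasurable_funD.
        apply/measurable_EFinP; apply: measurable_funM; last exact: measurable_cst.
        by apply: measurable_sqr_normc; exact: hW.1.
      exact: measurable_int (energy_integrable t).
    + move=> w _; rewrite -EFinM -(sqnormHE (X_inH t w)).
      have e1 : ((normc (W w) ^+ 2 * nsqH f)%:E = \int[leb]_(u in U) ((normc (W w) ^+ 2)%:E * (normc (f u) ^+ 2)%:E))%E.
        by rewrite integralZl//; [rewrite EFinM -(sqnormHE hf)|exact: cL2_sqr_integrable].
      rewrite e1 /sqnormH /sqnorm -ge0_integralD//.
      * apply: ge0_le_integral => //.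
        -- by move=> u _; rewrite lee_fin normc_ge0.
        -- exact: (measurable_section1 mT mU (x := w) I mnF).
        -- apply: emeasurable_funD.
             apply: emeasurable_funM; first exact: measurable_cst.
             by apply/measurable_EFinP; apply: measurable_sqr_normc; exact: hf.1.
           by apply/measurable_EFinP; apply: measurable_sqr_normc; exact: (X_inH t w).1.
        -- move=> u _; rewrite -EFinM -EFinD lee_fin /F/= !normcM normc_conj.
           move: (normc_ge0 (W w)) (normc_ge0 (X t w u)) (normc_ge0 (f u)).
           move: (normc (W w)) (normc (X t w u)) (normc (f u)) => a b c a0 b0 c0.
           by have := sqr_ge0 (a * c - b); rewrite !expr2; nra.
      * by move=> u _; rewrite mule_ge0// lee_fin sqr_ge0.
      * apply: emeasurable_funM; first exact: measurable_cst.
        by apply/measurable_EFinP; apply: measurable_sqr_normc; exact: hf.1.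
      * by move=> u _; rewrite lee_fin sqr_ge0.
      * by apply/measurable_EFinP; apply: measurable_sqr_normc; exact: (X_inH t w).1.
  have i1 : P.-integrable setT (fun w => (normc (W w) ^+ 2)%:E * (nsqH f)%:E)%E.
    by apply: integrableZr => //; exact: cL2_sqr_integrable.
  by apply: integrable_lty => //; apply: integrableD => //; exact: energy_integrable.
Qed.

Lemma coordinate_mean t f : inH f -> cE P (fun w => dotH (X t w) f) = 0.
Proof.
move=> hf; have := coordinate_swap t hf (cL2_cst 1).
rewrite (_ : (fun w => dotH (X t w) f * 1) = (fun w => dotH (X t w) f)); last first.
  by apply/funext => w; rewrite mulr1.
move=> ->; rewrite -[RHS](cintegral0 leb mU); apply: ae_eq_cintegral => //.
- apply: cmeasurableM; first exact/cmeasurable_conj/hf.1.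
  have mX1 : cmeasurable ([set: Omega] `*` U) (fun q : Omega * measurableTypeR R => X t q.1 q.2 * 1).
    by apply: cmeasurableM => //; exact: cmeasurable_cst.
  exact: (cmeasurable_cintegral2 P mT mU mX1).
- have [_ mean _] := Hstat; apply: filterS (mean t) => u h Uu.
  rewrite (_ : (fun w => X t w u * 1) = (fun w => X t w u)); last first.
    by apply/funext => w; rewrite mulr1.
  by rewrite h// mulr0.
Qed.

Let kern h := autocov_kernel P X h.

Let m_kern h : cmeasurable (U `*` U) (fun q : measurableTypeR R * measurableTypeR R => kern h q.1 q.2).
Proof.
have mUU : measurable (U `*` U) by exact: measurableX.
have m3 t (p : (measurableTypeR R * measurableTypeR R) -> measurableTypeR R) :
    measurable_fun setT p -> (forall q, (U `*` U) q -> U (p q)) ->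
    cmeasurable ((U `*` U) `*` [set: Omega])
      (fun r : (measurableTypeR R * measurableTypeR R) * Omega => X t r.2 (p r.1)).
  move=> mp Up.
  apply: (@cmeasurable_comp _ _ _ _ _ _ ([set: Omega] `*` U)
    (fun q : Omega * measurableTypeR R => X t q.1 q.2) (fun r => (r.2, p r.1))) => //.
  - exact: measurableX.
  - by move=> r [/= h1 _]; split => //; exact: Up.
  - apply: measurable_funTS; apply: measurable_fun_pair; first exact: measurable_snd.
    by apply: measurableT_comp => //; exact: measurable_fst.
have mk : cmeasurable ((U `*` U) `*` [set: Omega])
   (fun r : (measurableTypeR R * measurableTypeR R) * Omega => X h r.2 r.1.1 * (X 0 r.2 r.1.2)^*).
  apply: cmeasurableM; last apply: cmeasurable_conj.
  - by apply: (m3 h fst) => // q [].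
  - by apply: (m3 0 snd) => // q [].
exact: (cmeasurable_cintegral1 P mUU mT mk).
Qed.

(** The Cauchy-Schwarz inequality under P bounds |c_h(u, v)|^2 by the product of
    the second moments of X_h(u) and X_0(v). *)
Lemma autocov_kernel_sq h : (\int[leb]_(u in U) sqnormH (autocov_kernel P X h u) < +oo)%E.
Proof.
have mks : measurable_fun U (fun u => sqnormH (kern h u)).
  exact: (measurable_sqnorm1 leb mU mU (m_kern h)).
set E0 := (\int[leb]_(v in U) sqnorm P setT (fun w => X 0 w v))%E.
have E00 : (0 <= E0)%E by apply: integral_ge0 => v _; exact: sqnorm_ge0.
have E0E : E0 = (fine E0)%:E by rewrite fineK// ge0_fin_numE//; exact: variance_lty.
apply: (@le_lt_trans _ _ (\int[leb]_(u in U) (sqnorm P setT (fun w => X h w u) * (fine E0)%:E))%E).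
  apply: ae_ge0_le_integral => //.
  - by apply: emeasurable_funM; [exact: measurable_variance|exact: measurable_cst].
  - by move=> u _; exact: sqnorm_ge0.
  - by move=> u _; rewrite mule_ge0// -?E0E//; exact: sqnorm_ge0.
  - apply: filterS (variance_ae h) => u hu Uu; have hXu := hu Uu.
    rewrite (sqnormE mT hXu) -E0E /E0.
    rewrite -ge0_integralZl//; last 2 first.
    - by move=> v _; exact: sqnorm_ge0.
    - by rewrite lee_fin normsq_ge0.
    apply: ae_ge0_le_integral => //.
    + apply/measurable_EFinP; apply: measurable_sqr_normc.
      exact: (cmeasurable_section1 mU mU Uu (m_kern h)).
    + by apply: emeasurable_funM; [exact: measurable_cst|exact: measurable_variance].
    + by move=> v _; rewrite lee_fin sqr_ge0.
    + by move=> v _; apply: mule_ge0; [rewrite lee_fin normsq_ge0|exact: sqnorm_ge0].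
    + apply: filterS (variance_ae 0) => v hv Uv; rewrite (sqnormE mT (hv Uv)) -EFinM lee_fin.
      exact: (cauchy_schwarz mT hXu (hv Uv)).
have iv : leb.-integrable U (fun u => sqnorm P setT (fun w => X h w u)).
  apply: integrable_of_ge0 => //; last exact: variance_lty.
  by move=> u _; exact: sqnorm_ge0.
by apply: integrable_lty => //; exact: integrableZr.
Qed.

Lemma autocov_op_bounded h : bounded_linearH (autocov_op P X h).
Proof. by apply: kernel_op_bounded; [exact: m_kern|exact: autocov_kernel_sq]. Qed.

(** The expectation is moved inside both coordinates, one after the other, and
    stationarity identifies it with the autocovariance kernel for almost all
    (u, v). *)
Lemma coordinate_covariance s t f g : inH f -> inH g ->
  ip P setT (fun w => dotH (X s w) f) (fun w => dotH (X t w) g) =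
  dotH (autocov_op P X (s - t) g) f.
Proof.
move=> hf hg; have hZ := coordinate_L2 t hg.
have hconj (Z : Omega -> R[i]) : L2P Z -> L2P (fun w => (Z w)^*) by exact: cL2_conj.
rewrite /ip -/(cE P _) (coordinate_swap s hf (hconj _ hZ)).
rewrite /dotH; have [_ _ stat] := Hstat.
have Cg : inH (autocov_op P X (s - t) g) by have [h _ _] := autocov_op_bounded (s - t); exact: h.
have mkg : cmeasurable U (autocov_op P X (s - t) g) by exact: Cg.1.
apply: ae_eq_cintegral => //.
- apply: cmeasurableM; first exact/cmeasurable_conj/hf.1.
  have mXW : cmeasurable ([set: Omega] `*` U) (fun q : Omega * measurableTypeR R => X s q.1 q.2 * (dotH (X t q.1) g)^*).
    apply: cmeasurableM => //; apply: cmeasurable_conj.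
    by apply: (cmeasurable_comp mT _ hZ.1) => //; exact: measurable_funTS measurable_fst.
  exact: (cmeasurable_cintegral2 P mT mU mXW).
- by apply: cmeasurableM => //; apply: cmeasurable_conj; exact: hf.1.
- have := stat t (s - t); rewrite addrC subrK => /ae_sections sec.
  apply: filterS3 (variance_ae s) sec (kernel_section_ae (m_kern (s - t)) (autocov_kernel_sq (s - t))) => u hu hs hk Uu.
  rewrite mulrC; congr (_ * _).
  have hXu := hu Uu.
  have e1 : cE P (fun w => X s w u * (dotH (X t w) g)^*) = (cE P (fun w => dotH (X t w) g * (X s w u)^*))^*.
    rewrite /cE -cintegral_conj//; last exact: cL2_cintegrable.
    by apply: eq_cintegral => w _; rewrite conjM conjCK mulrC.
  rewrite e1 (coordinate_swap t hg (hconj _ hXu)).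
  have mXX : cmeasurable ([set: Omega] `*` U) (fun q : Omega * measurableTypeR R => X t q.1 q.2 * (X s q.1 u)^*).
    apply: cmeasurableM => //; apply: cmeasurable_conj.
    by apply: (cmeasurable_comp mT _ hXu.1) => //; exact: measurable_funTS measurable_fst.
  have mc : cmeasurable U (fun v => cE P (fun w => X t w v * (X s w u)^*)).
    exact: (cmeasurable_cintegral2 P mT mU mXX).
  have mku : cmeasurable U (kern (s - t) u) by exact: (cmeasurable_section1 mU mU Uu (m_kern (s - t))).
  have e2 : {ae leb, forall v, U v -> (cE P (fun w => X t w v * (X s w u)^*)) = (kern (s - t) u v)^*}.
    apply: filterS2 (variance_ae t) (hs Uu) => v hv hs' Uv.
    rewrite /kern -hs'// /cE -cintegral_conj//; last by apply: cL2_cintegrable => //; exact: hv.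
    by apply: eq_cintegral => w _; rewrite conjM conjCK mulrC.
  rewrite (ae_eq_cintegral mU (g := fun v => (kern (s - t) u v * g v)^*)).
  + rewrite [RHS](_ : _ = cintegral leb U (fun v => kern (s - t) u v * g v))//.
    have hku : inH (kern (s - t) u) by exact: hk.
    rewrite cintegral_conj ?conjCK//.
    have := cL2_cintegrable mU hku (cL2_conj mU hg).
    by under [in X in X -> _]eq_fun do rewrite conjCK.
  + by apply: cmeasurableM => //; apply: cmeasurable_conj; exact: hg.1.
  + by apply: cmeasurable_conj; apply: cmeasurableM => //; exact: hg.1.
  + by apply: filterS e2 => v h Uv; rewrite h// conjM mulrC.
Qed.

End SecondMoments.

(** * Square integrable functions of the frequency *)

Section Fields.
Context {R : realType}.
Local Notation leb := (@lebesgue_measure R).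
Local Notation U := (@unit_itv R).
Local Notation D := (@pi_itv R).
Local Notation op := ((R -> R[i]) -> R -> R[i]).
Local Notation mR := (measurableTypeR R).
Implicit Types (f g : R -> R -> R[i]) (A : op).
Local Hint Resolve measurable_unit_itv : core.
Local Hint Resolve measurable_pi_itv : core.
Let mU := @measurable_unit_itv R.
Let mD := @measurable_pi_itv R.

(** Square integrable functions of the frequency with values in L^2([0,1]). *)
Definition fieldH f : Prop :=
  [/\ cmeasurable (D `*` U) (fun q : mR * mR => f q.1 q.2),
      forall theta, D theta -> inH (f theta)
    & (\int[leb]_(theta in D) sqnormH (f theta) < +oo)%E].

Definition fieldsq f : R := fine (\int[leb]_(theta in D) sqnormH (f theta))%E.

Definition fieldnorm f : R := Num.sqrt (fieldsq f).

Lemma field_sq_integrable f : fieldH f ->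
  leb.-integrable D (EFin \o (fun theta => nsqH (f theta))).
Proof.
move=> [mf hf foo]; have : leb.-integrable D (fun theta => sqnormH (f theta)).
  apply: integrable_of_ge0 => //; first exact: (measurable_sqnorm1 leb mD mU mf).
  by move=> t _; exact: sqnorm_ge0.
by apply: eq_integrable => // t /set_mem Dt; rewrite sqnormHE//; exact: hf.
Qed.

Lemma fieldsqE f : fieldH f -> fieldsq f = \int[leb]_(theta in D) nsqH (f theta).
Proof.
move=> [mf hf foo]; congr fine; apply: eq_integral => t /set_mem Dt.
by rewrite sqnormHE//; exact: hf.
Qed.

Lemma fieldB f g : fieldH f -> fieldH g -> fieldH (fun theta u => f theta u - g theta u).
Proof.
move=> hf hg; have [mf fin ff] := hf; have [mg gin gf] := hg; split.
- exact: cmeasurableB.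
- by move=> t Dt; apply: inHB; [exact: fin|exact: gin].
- apply: (@le_lt_trans _ _ (\int[leb]_(theta in D) (2%:E * (nsqH (f theta))%:E + 2%:E * (nsqH (g theta))%:E))%E).
    apply: ge0_le_integral => //.
    + by move=> t _; exact: sqnorm_ge0.
    + apply: (measurable_sqnorm1 leb mD mU (f := fun q : mR * mR => f q.1 q.2 - g q.1 q.2)).
      exact: cmeasurableB.
    + apply: emeasurable_funD; apply: emeasurable_funM; try exact: measurable_cst.
        exact: measurable_int (field_sq_integrable hf).
      exact: measurable_int (field_sq_integrable hg).
    + move=> t Dt; have h1 := fin t Dt; have h2 := gin t Dt.
      rewrite sqnormHE; last exact: inHB.
      rewrite -!EFinM -EFinD lee_fin.
      have := normsqD_le mU h1 (inHZ (-1) h2).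
      rewrite (normsqZ mU _ h2) normcN normc1 expr1n mul1r; apply: le_trans.
      by rewrite le_eqVlt; apply/orP; left; apply/eqP; congr normsq; apply/funext => u; rewrite mulN1r.
  apply: integrable_lty => //; apply: integrableD => //; apply: integrableZl => //.
  - exact: field_sq_integrable.
  - exact: field_sq_integrable.
Qed.

Lemma field_norm_L2 f : fieldH f -> cL2 leb D (fun theta => (normH (f theta))%:C) /\
  L2norm leb D (fun theta => (normH (f theta))%:C) = fieldnorm f.
Proof.
move=> hf; have e t : normc (normH (f t))%:C ^+ 2 = nsqH (f t).
  by rewrite normc_real ger0_norm ?normH_ge0// sqr_normH.
have h : cL2 leb D (fun theta => (normH (f theta))%:C).
  apply: (@le_cL2 _ _ _ _ _ mD _ (fun theta => nsqH (f theta))).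
  - apply: cmeasurable_real; apply: (measurableT_comp (f := @Num.sqrt R)).
      exact: continuous_measurable_fun (@sqrt_continuous R).
    by apply/measurable_EFinP; exact: measurable_int (field_sq_integrable hf).
  - by move=> t _; rewrite e.
  - exact: field_sq_integrable.
split => //; rewrite /L2norm /fieldnorm (fieldsqE hf) normsqE; congr Num.sqrt.
by apply: eq_Rintegral => t _; rewrite e.
Qed.

(** The Cauchy-Schwarz inequality over the frequencies. *)
Lemma field_form_bound f g (F : R -> R[i]) (c : R) : fieldH f -> fieldH g -> 0 <= c ->
  cmeasurable D F ->
  (forall theta, D theta -> normc (F theta) <= c * (normH (f theta) * normH (g theta))) ->
  cintegrable leb D F /\
  normc (cintegral leb D F) <= c * (fieldnorm f * fieldnorm g).
Proof.
move=> hf hg c0 mF Fb.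
have [f2 fn] := field_norm_L2 hf; have [g2 gn] := field_norm_L2 hg.
have ifg := cL2_cintegrable mD f2 g2.
have fgE t : (normH (f t))%:C * (normH (g t))%:C^* = (normH (f t) * normH (g t))%:C.
  by rewrite conj_real -rmorphM.
have i1 : leb.-integrable D (EFin \o (fun t => normH (f t) * normH (g t))).
  have [h _] := ifg; apply: eq_integrable h => // t _; rewrite /comp.
  by rewrite fgE.
have i2 : leb.-integrable D (EFin \o (fun t => c * (normH (f t) * normH (g t)))).
  by rewrite /comp; under eq_fun do rewrite EFinM; exact: integrableZl.
have iF : cintegrable leb D F by apply: (le_cintegrable mD mF Fb).
split => //; apply: (le_trans (cintegral_le_bound mD iF i2 Fb)).
rewrite RintegralZl// ler_wpM2l// -fn -gn.
apply: le_trans (cauchy_schwarz_norm mD f2 g2).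
have -> : ip leb D (fun theta => (normH (f theta))%:C) (fun theta => (normH (g theta))%:C) =
    (\int[leb]_(t in D) (normH (f t) * normH (g t)))%:C.
  by rewrite -cintegral_real//; apply: eq_cintegral => t _; exact: fgE.
by rewrite normc_real ler_norm.
Qed.

Lemma field_dot_measurable f (y : R -> R[i]) : fieldH f -> inH y ->
  cmeasurable D (fun theta => dotH (f theta) y).
Proof.
move=> [mf _ _] hy.
apply: (cmeasurable_cintegral1 leb mD mU (f := fun q : mR * mR => f q.1 q.2 * (y q.2)^*)).
apply: cmeasurableM => //; apply: cmeasurable_conj.
apply: (cmeasurable_comp mU _ hy.1); first by move=> q [].
exact: measurable_funTS measurable_snd.
Qed.

(** Expansion in the basis e: the operator A gives no jointly measurable
    version of (theta, u) |-> A (f theta) u. *)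
Lemma field_form_measurable (e : nat -> R -> R[i]) A f g : orthonormal_basisH e ->
  bounded_linearH A -> fieldH f -> fieldH g ->
  cmeasurable D (fun theta => dotH (A (f theta)) (g theta)).
Proof.
move=> he bA hf hg; have [[ein _] _] := he; have [Ain _ _] := bA.
apply: (cmeasurable_cvg (F_ := fun n theta => \sum_(j < n) dotH (f theta) (e j) * dotH (A (e j)) (g theta))).
  move=> n; apply: cmeasurable_sum => j; apply: cmeasurableM.
    exact: field_dot_measurable.
  have mg := field_dot_measurable hg (Ain _ (ein j)).
  have [mg1 mg2] := cmeasurable_conj mg; have [_ gin _] := hg.
  have E t : D t -> dotH (A (e j)) (g t) = (dotH (g t) (A (e j)))^*.
    by move=> Dt; rewrite -dotH_conj//; [exact: gin|exact: Ain].
  split; [apply: eq_measurable_fun mg1|apply: eq_measurable_fun mg2].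
    by move=> t /set_mem Dt; rewrite E.
  by move=> t /set_mem Dt; rewrite E.
move=> t Dt; have [_ fin _] := hf; have [_ gin _] := hg.
by apply: form_basis_cvg => //; [exact: fin|exact: gin].
Qed.

End Fields.

(** * The filters as Fourier coefficients *)

Section FilterCoefficients.
Context {R : realType}.
Local Notation leb := (@lebesgue_measure R).
Local Notation U := (@unit_itv R).
Local Notation D := (@pi_itv R).
Local Notation mR := (measurableTypeR R).
Context (phi : nat -> R -> R -> R[i]) (m : nat).
Hypothesis phi_field : fieldH (phi m).
Local Hint Resolve measurable_unit_itv : core.
Local Hint Resolve measurable_pi_itv : core.
Let mU := @measurable_unit_itv R.
Let mD := @measurable_pi_itv R.
Let mphi : cmeasurable (D `*` U) (fun q : mR * mR => phi m q.1 q.2).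
Proof. by have [] := phi_field. Qed.

Let energy (u : R) : \bar R := sqnorm leb D (fun s => phi m s u).

Let m_energy : measurable_fun U energy.
Proof. exact: (measurable_sqnorm2 leb mD mU mphi). Qed.

Let i_energy : leb.-integrable U energy.
Proof.
apply: integrable_of_ge0 => //; first by move=> u _; exact: sqnorm_ge0.
by rewrite -(tonelli_sqnorm leb leb mD mU mphi); have [] := phi_field.
Qed.

Let fpc_filterE (l : int) (u : R) : fpc_filter phi m l u =
  if `[< cL2 leb D (fun s => phi m s u) >] then fhat (fun s => phi m s u) l else 0.
Proof. by []. Qed.

Lemma section_L2_ae : {ae leb, forall u, U u -> cL2 leb D (fun s => phi m s u)}.
Proof.
have := integrable_ae mU i_energy; apply: filterS => u h Uu.
split; first exact: (cmeasurable_section2 mD mU Uu mphi).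
by rewrite -/(energy u) -ge0_fin_numE ?h//; exact: sqnorm_ge0.
Qed.

Lemma fpc_filter_measurable (l : int) : cmeasurable U (fpc_filter phi m l).
Proof.
(* The sections outside S are not square integrable, and there the filter is 0
   by convention. *)
pose S := U `&` [set u : mR | (energy u < +oo)%E].
have mS : measurable S by exact: emeasurable_fun_infty_o.
have mh : cmeasurable U (fun u => (\1_S u : R)%:C * fhat (fun s => phi m s u) l).
  apply: cmeasurableM; first exact/cmeasurable_real/measurable_funTS/measurable_indic.
  apply: cmeasurableZ.
  apply: (cmeasurable_cintegral2 leb mD mU (f := fun q : mR * mR => phi m q.1 q.2 * expi (- (l%:~R * q.1)))).
  apply: cmeasurableM => //.
  have me : cmeasurable D (fun s : mR => expi (- (l%:~R * s))).
    by under eq_fun do rewrite -mulNr; exact: cexp_measurable.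
  apply: (cmeasurable_comp mD _ me); first by move=> q [].
  exact: measurable_funTS measurable_fst.
have E u : U u -> (\1_S u : R)%:C * fhat (fun s => phi m s u) l = fpc_filter phi m l u.
  move=> Uu; rewrite fpc_filterE indicE; case: asboolP => h.
    by rewrite mem_set ?mul1r//; split => //; exact: h.2.
  rewrite memNset ?mul0r// => -[_ /= e]; apply: h; split => //.
  exact: (cmeasurable_section2 mD mU Uu mphi).
split; [apply: eq_measurable_fun mh.1|apply: eq_measurable_fun mh.2].
  by move=> u /set_mem Uu; rewrite E.
by move=> u /set_mem Uu; rewrite E.
Qed.

Lemma fhat_le (f : R -> R[i]) (l : int) : cL2 leb D f ->
  2 * pi * normc (fhat f l) ^+ 2 <= normsq leb D f.
Proof.
move=> f2; have := fourier_bessel (absz l) f2; have := normsq_ge0 leb D (fun x => f x - fourier_psum (absz l) f x).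
move=> + E; rewrite {}E subr_ge0; apply: le_trans.
rewrite ler_wpM2l ?(ltW twopi_gt0)//.
have l0 : 0 <= l + (absz l)%:Z by lia.
have lt : (absz (l + (absz l)%:Z)%R < (absz l).*2.+1)%N by lia.
rewrite (bigD1 (Ordinal lt))//= (_ : _ - _ = l); last by lia.
by rewrite lerDl; apply: sumr_ge0 => k _; rewrite sqr_ge0.
Qed.

Lemma fpc_filter_inH (l : int) : inH (fpc_filter phi m l).
Proof.
split; first exact: fpc_filter_measurable.
apply: (@le_lt_trans _ _ (\int[leb]_(u in U) ((2 * pi)^-1%:E * energy u))%E); last first.
  by apply: integrable_lty => //; exact: integrableZl.
apply: ae_ge0_le_integral => //.
- by apply/measurable_EFinP; apply: measurable_sqr_normc; exact: fpc_filter_measurable.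
- by apply: emeasurable_funM => //; exact: measurable_cst.
- by move=> u _; rewrite lee_fin sqr_ge0.
- by move=> u _; rewrite mule_ge0//; [rewrite lee_fin invr_ge0 (ltW twopi_gt0)|exact: sqnorm_ge0].
- apply: filterS section_L2_ae => u h Uu; have hu := h Uu.
  rewrite fpc_filterE asboolT// /energy (sqnormE mD hu) -EFinM lee_fin.
  by rewrite mulrC ler_pdivlMr ?twopi_gt0// mulrC; exact: fhat_le.
Qed.

(** The Fourier partial sum of theta |-> phi m theta u, as fpc_filter phi m l u is
    its l-th Fourier coefficient for almost every u. *)
Definition filter_psum N (theta : R) (u : R) : R[i] :=
  zsum N (fun l => fpc_filter phi m l u * expi (l%:~R * theta)).

Let m_filter_psum N : cmeasurable (D `*` U) (fun q : mR * mR => filter_psum N q.1 q.2).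
Proof.
apply: cmeasurable_sum => k; apply: cmeasurableM.
  apply: (cmeasurable_comp mU _ (fpc_filter_measurable _)); first by move=> q [].
  exact: measurable_funTS measurable_snd.
apply: (cmeasurable_comp mD _ (cexp_measurable _ D)); first by move=> q [].
exact: measurable_funTS measurable_fst.
Qed.

Lemma filter_psum_inH N theta : inH (filter_psum N theta).
Proof.
rewrite (_ : filter_psum N theta = fun u => \sum_(k < N.*2.+1)
   expi ((k%:Z - N%:Z)%:~R * theta) * fpc_filter phi m (k%:Z - N%:Z) u).
  by apply: inH_sum => k; apply: inHZ; exact: fpc_filter_inH.
by apply/funext => u; apply: eq_bigr => k _; rewrite mulrC.
Qed.

Let err N u := sqnorm leb D (fun s => phi m s u - filter_psum N s u).

Let errE N : (\int[leb]_(theta in D) sqnormH (fun u => phi m theta u - filter_psum N theta u)%R =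
  \int[leb]_(u in U) err N u)%E.
Proof.
apply: (tonelli_sqnorm leb leb mD mU (f := fun q : mR * mR => phi m q.1 q.2 - filter_psum N q.1 q.2)).
exact: cmeasurableB.
Qed.

Let m_err N : measurable_fun U (err N).
Proof.
apply: (measurable_sqnorm2 leb mD mU (f := fun q : mR * mR => phi m q.1 q.2 - filter_psum N q.1 q.2)).
exact: cmeasurableB.
Qed.

Let err_section N u : cL2 leb D (fun s => phi m s u) ->
  err N u = (normsq leb D (fun s => phi m s u - fourier_psum N (fun s => phi m s u) s))%:E.
Proof.
move=> hu; rewrite -(sqnormE mD); last by apply: cL2B => //; exact: cL2_fourier_psum.
congr (sqnorm _ _ _); apply/funext => s; congr (_ - _); apply: eq_zsum => l.
by rewrite fpc_filterE asboolT.
Qed.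

Let err_cvg : (\int[leb]_(u in U) err N u)%E @[N --> \oo] --> (\int[leb]_(u in U) 0)%E.
Proof.
have f_f : {ae leb, forall u, U u -> (fun N => err N u) @ \oo --> 0%E}.
  apply: filterS section_L2_ae => u h Uu; have hu := h Uu.
  rewrite (_ : (fun N => err N u) = EFin \o (fun N => normsq leb D (fun s => phi m s u - fourier_psum N (fun s => phi m s u) s))); last first.
    by apply/funext => N; rewrite /= err_section.
  by apply: cvg_EFin; [exact: nearW|exact: (fourier_cvg_L2 hu).2].
have f_g : {ae leb, forall u N, U u -> (`|err N u| <= energy u)%E}.
  apply: filterS section_L2_ae => u h N Uu; have hu := h Uu.
  rewrite gee0_abs; last exact: sqnorm_ge0.
  rewrite err_section// /energy (sqnormE mD hu) lee_fin.
  exact: fourier_contraction.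
by have [_ _] := dominated_convergence mU m_err (measurable_cst _) f_f i_energy f_g.
Qed.

Lemma filter_psum_field N : fieldH (filter_psum N).
Proof.
have hE : fieldH (fun theta u => phi m theta u - filter_psum N theta u).
  split.
  - exact: cmeasurableB.
  - by move=> t Dt; apply: inHB; [have [_ h _] := phi_field; exact: h|exact: filter_psum_inH].
  - rewrite errE; apply: le_lt_trans (integrable_lty mU i_energy).
    apply: ae_ge0_le_integral => //.
    + by move=> u _; exact: sqnorm_ge0.
    + by move=> u _; exact: sqnorm_ge0.
    + apply: filterS section_L2_ae => u h Uu; have hu := h Uu.
      by rewrite err_section// /energy (sqnormE mD hu) lee_fin fourier_contraction.
rewrite (_ : filter_psum N = fun theta u => phi m theta u - (phi m theta u - filter_psum N theta u)).
  exact: fieldB.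
by apply/funext => t; apply/funext => u; rewrite opprB addrC subrK.
Qed.

(** Parseval's theorem in almost every section, integrated over the sections:
    the error of a section is dominated by its energy. *)
Lemma filter_psum_cvg :
  fieldnorm (fun theta u => phi m theta u - filter_psum N theta u) @[N --> \oo] --> 0.
Proof.
rewrite -sqrtr0; apply: (cvg_comp (fun N => fieldsq (fun theta u => phi m theta u - filter_psum N theta u)) _ (G := nbhs (0 : R))); last exact: sqrt_continuous.
have := err_cvg; rewrite integral0 => /fine_cvgP[_ /= h].
rewrite (_ : (fun N => _) = fine \o (fun N => \int[leb]_(u in U) err N u)%E); first exact: h.
by apply/funext => N; rewrite /fieldsq errE.
Qed.

End FilterCoefficients.

(** * The form of the spectral density operator *)

Section SpectralForm.
Context {R : realType}.
Local Notation leb := (@lebesgue_measure R).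
Local Notation D := (@pi_itv R).
Local Notation op := ((R -> R[i]) -> R -> R[i]).
Context (e : nat -> R -> R[i]) (C : int -> op) (F : R -> op).
Hypothesis (he : orthonormal_basisH e) (bC : forall h, bounded_linearH (C h)).
Hypothesis (HF : spectral_density_op e C F).
Hypothesis (Hsum : (\esum_(h in [set: int]) HSnorm e (C h) < +oo)%E).
Local Hint Resolve measurable_unit_itv : core.
Local Hint Resolve measurable_pi_itv : core.
Let mD := @measurable_pi_itv R.
Implicit Types (x y : R -> R[i]) (f g : R -> R -> R[i]) (h j k l : int).

Let hs h : R := fine (HSnorm e (C h)).

Let HS_lty h : (HSnorm e (C h) < +oo)%E.
Proof.
apply: le_lt_trans Hsum; apply: ereal_sup_ubound; exists [set h].
  by split => //; exact: finite_set1.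
by rewrite fsbig_set1.
Qed.

Let HSE h : HSnorm e (C h) = (hs h)%:E.
Proof. by rewrite fineK// ge0_fin_numE ?HS_lty// HSnorm_ge0. Qed.

Let hs_ge0 h : 0 <= hs h.
Proof. by apply: fine_ge0; exact: HSnorm_ge0. Qed.

Definition HStotal : R := fine (\esum_(h in [set: int]) HSnorm e (C h))%E.

Lemma HStotal_bound N : \sum_(k < N.*2.+1) hs (k%:Z - N%:Z) <= HStotal.
Proof.
have tot0 : (0 <= \esum_(h in [set: int]) HSnorm e (C h))%E.
  by apply: esum_ge0 => h _; exact: HSnorm_ge0.
rewrite -lee_fin /HStotal fineK ?ge0_fin_numE//.
pose r : seq int := map (fun k : nat => k%:Z - N%:Z) (iota 0 N.*2.+1).
have ur : uniq r by rewrite map_inj_uniq ?iota_uniq// => a b; lia.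
have -> : (\sum_(k < N.*2.+1) hs (k%:Z - N%:Z))%:E = (\sum_(h <- r) HSnorm e (C h))%E.
  rewrite big_map -[N.*2.+1 in RHS]subn0 -/(index_iota 0 N.*2.+1) big_mkord -sumEFin.
  by apply: eq_bigr => k _; rewrite HSE.
apply: esum_ge; exists [set` r]; first by split => //; exact: finite_seq.
by rewrite (fsbig_seq _ _ ur).
Qed.

Lemma HStotal_ge0 : 0 <= HStotal.
Proof. by apply: le_trans (HStotal_bound 0); apply: sumr_ge0 => k _; exact: hs_ge0. Qed.

Lemma form_bound h x y : inH x -> inH y -> normc (dotH (C h x) y) <= hs h * normH x * normH y.
Proof. by move=> hx hy; exact: HS_form_bound. Qed.

Lemma form_zsum_bound N (a : int -> R[i]) x y : (forall h, normc (a h) <= 1) ->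
  inH x -> inH y ->
  normc (zsum N (fun h => dotH (C h x) y * a h)) <= HStotal * (normH x * normH y).
Proof.
move=> a1 hx hy; apply: (le_trans (normc_sum _ _ _)).
apply: (@le_trans _ _ (\sum_(k < N.*2.+1) hs (k%:Z - N%:Z) * (normH x * normH y))).
  apply: ler_sum => k _; rewrite normcM mulrA; apply: le_trans (form_bound _ hx hy).
  by rewrite ler_piMr ?normc_ge0.
by rewrite -mulr_suml ler_wpM2r ?HStotal_bound// mulr_ge0 ?normH_ge0.
Qed.

(** Convergence of operators in Hilbert-Schmidt norm implies convergence of
    their forms. *)
Lemma spectral_form_cvg theta x y : D theta -> inH x -> inH y ->
  ccvg (fun N => ((2 * pi)^-1)%:C *
          zsum N (fun h => dotH (C h x) y * expi (- (h%:~R * theta))))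
       (dotH (F theta x) y).
Proof.
move=> Dt hx hy; have [bF cF] := HF Dt.
pose A N (z : R -> R[i]) u := F theta z u - ((2 * pi)^-1)%:C *
  zsum N (fun h => C h z u * expi (- (h%:~R * theta))).
have bA N : bounded_linearH (A N).
  rewrite (_ : A N = fun z u => F theta z u + (- ((2 * pi)^-1)%:C) *
     zsum N (fun h => C h z u * expi (- (h%:~R * theta)))).
    by apply: bounded_linearH_lin => //; exact: bounded_linearH_zsum.
  by apply/funext => z; apply/funext => u; rewrite mulNr.
have Cx h : inH (C h x) by have [q _ _] := bC h; exact: q.
have Fx : inH (F theta x) by have [q _ _] := bF; exact: q.
have formE N : dotH (A N x) y = dotH (F theta x) y -
    ((2 * pi)^-1)%:C * zsum N (fun h => dotH (C h x) y * expi (- (h%:~R * theta))).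
  pose z u := zsum N (fun h => expi (- (h%:~R * theta)) * C h x u).
  have hz : inH z by apply: inH_sum => k; exact: inHZ.
  have -> : A N x = fun u => F theta x u + (- ((2 * pi)^-1)%:C) * z u.
    apply/funext => u; rewrite /A mulNr; congr (_ - _ * _).
    by apply: eq_zsum => h; rewrite mulrC.
  rewrite dotHDl//; last exact: inHZ.
  rewrite dotHZl// mulNr; congr (_ - _ * _).
  rewrite dotH_suml//; last by move=> k; exact: inHZ.
  by apply: eq_bigr => k _; rewrite dotHZl// mulrC.
move: cF => /fine_cvgP[nfin cfin].
have h0 : fine (HSnorm e (A N)) * normH x * normH y @[N --> \oo] --> (0 : R).
  rewrite -(mul0r (normH y)); apply: cvgM; last exact: cvg_cst.
  by rewrite -(mul0r (normH x)); apply: cvgM; [exact: cfin|exact: cvg_cst].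
apply/ccvgP; apply: (squeeze_cvgr _ (cvg_cst (0 : R)) h0).
apply: filterS nfin => N fN; rewrite normc_ge0 /= normcB_sym -formE.
apply: HS_form_bound => //.
by move: fN; rewrite ge0_fin_numE// HSnorm_ge0.
Qed.

Lemma spectral_form_bound theta x y : D theta -> inH x -> inH y ->
  normc (dotH (F theta x) y) <= (2 * pi)^-1 * HStotal * (normH x * normH y).
Proof.
move=> Dt hx hy; apply: (ccvg_normc_le (spectral_form_cvg Dt hx hy)) => N.
rewrite normcM normc_real ger0_norm ?invr_ge0 ?(ltW twopi_gt0)//.
rewrite -mulrA ler_wpM2l ?invr_ge0 ?(ltW twopi_gt0)//.
by apply: form_zsum_bound => // h; rewrite normc_expi.
Qed.

Definition trunc_form N f g theta : R[i] :=
  zsum N (fun h => dotH (C h (f theta)) (g theta) * expi (- (h%:~R * theta))).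

Definition trunc_ip N j f g : R[i] :=
  cintegral leb D (fun theta => trunc_form N f g theta * expi (j%:~R * theta)).

Let trunc_measurable N j f g : fieldH f -> fieldH g ->
  cmeasurable D (fun theta => trunc_form N f g theta * expi (j%:~R * theta)).
Proof.
move=> hf hg; apply: cmeasurableM; last exact: cexp_measurable.
apply: cmeasurable_sum => k; apply: cmeasurableM.
  exact: (field_form_measurable he).
by under eq_fun do rewrite -mulNr; exact: cexp_measurable.
Qed.

Let trunc_bound N j f g theta : fieldH f -> fieldH g -> D theta ->
  normc (trunc_form N f g theta * expi (j%:~R * theta)) <=
  HStotal * (normH (f theta) * normH (g theta)).
Proof.
move=> [_ fin _] [_ gin _] Dt; rewrite normcM normc_expi mulr1.
by apply: form_zsum_bound; [move=> h; rewrite normc_expi|exact: fin|exact: gin].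
Qed.

Lemma trunc_ip_bound N j f g : fieldH f -> fieldH g ->
  normc (trunc_ip N j f g) <= HStotal * (fieldnorm f * fieldnorm g).
Proof.
move=> hf hg; have [_ h] := field_form_bound hf hg HStotal_ge0 (trunc_measurable N j hf hg)
  (fun theta Dt => @trunc_bound N j f g theta hf hg Dt).
exact: h.
Qed.

Let trunc_integrable N j f g : fieldH f -> fieldH g ->
  cintegrable leb D (fun theta => trunc_form N f g theta * expi (j%:~R * theta)).
Proof.
move=> hf hg; have [h _] := field_form_bound hf hg HStotal_ge0 (trunc_measurable N j hf hg)
  (fun theta Dt => @trunc_bound N j f g theta hf hg Dt).
exact: h.
Qed.

(** Bilinear expansion in the errors f - f' and g - g'. *)
Lemma trunc_ip_diff N j f f' g g' : fieldH f -> fieldH f' -> fieldH g -> fieldH g' ->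
  trunc_ip N j f g - trunc_ip N j f' g' =
  trunc_ip N j (fun t u => f t u - f' t u) g + trunc_ip N j f (fun t u => g t u - g' t u) -
  trunc_ip N j (fun t u => f t u - f' t u) (fun t u => g t u - g' t u).
Proof.
move=> hf hf' hg hg'; have hff := fieldB hf hf'; have hgg := fieldB hg hg'.
have i1 := trunc_integrable N j hff hg; have i2 := trunc_integrable N j hf hgg.
rewrite /trunc_ip; apply: (etrans (esym (cintegralB mD (trunc_integrable N j hf hg)
  (trunc_integrable N j hf' hg')))).
rewrite -(cintegralD mD i1 i2).
apply: (etrans _ (cintegralB mD (cintegrableD mD i1 i2) (trunc_integrable N j hff hgg))).
apply: eq_cintegral => t /set_mem Dt; rewrite -!mulrDl -!mulrBl; congr (_ * _).
have [_ fin _] := hf; have [_ fin' _] := hf'; have [_ gin _] := hg; have [_ gin' _] := hg'.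
rewrite /trunc_form -zsumD /zsum -!sumrB; apply: eq_bigr => k _.
have Cin := let: And3 q _ _ := bC (k%:Z - N%:Z) in q.
have fB : inH (fun u => f t u - f' t u) by apply: inHB; [exact: fin|exact: fin'].
rewrite dotHBr; [|exact: gin|exact: gin'|apply: Cin; exact: fin].
rewrite dotHBr; [|exact: gin|exact: gin'|exact: Cin].
rewrite formB//; [|exact: fin|exact: fin'|exact: gin].
rewrite formB//; [|exact: fin|exact: fin'|exact: gin'].
by ring.
Qed.

Lemma spectral_form_measurable f g : fieldH f -> fieldH g ->
  cmeasurable D (fun theta => dotH (F theta (f theta)) (g theta)).
Proof.
move=> hf hg; have [_ fin _] := hf; have [_ gin _] := hg.
apply: (cmeasurable_cvg (F_ := fun N theta => ((2 * pi)^-1)%:C * trunc_form N f g theta)).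
  move=> N; apply: cmeasurableZ; apply: cmeasurable_sum => k; apply: cmeasurableM.
    exact: (field_form_measurable he).
  by under eq_fun do rewrite -mulNr; exact: cexp_measurable.
by move=> t Dt; apply: spectral_form_cvg => //; [exact: fin|exact: gin].
Qed.

(** The truncated forms converge to the form of the spectral density, by
    dominated convergence over the frequencies. *)
Lemma trunc_ip_cvg j f g : fieldH f -> fieldH g ->
  ccvg (fun N => ((2 * pi)^-1)%:C * trunc_ip N j f g)
       (cintegral leb D (fun theta => dotH (F theta (f theta)) (g theta) * expi (j%:~R * theta))).
Proof.
move=> hf hg; have [_ fin _] := hf; have [_ gin _] := hg.
have E N : ((2 * pi)^-1)%:C * trunc_ip N j f g = cintegral leb D (fun theta =>
    ((2 * pi)^-1)%:C * (trunc_form N f g theta * expi (j%:~R * theta))).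
  by rewrite cintegralZ//; exact: trunc_integrable.
under eq_fun do rewrite E.
have c0 : 0 <= (2 * pi)^-1 :> R by rewrite invr_ge0 (ltW twopi_gt0).
have [f2 _] := field_norm_L2 hf; have [g2 _] := field_norm_L2 hg.
have [i1 _] := cL2_cintegrable mD f2 g2.
apply: (cintegral_dominated mD (g := fun theta => (2 * pi)^-1 * (HStotal * (normH (f theta) * normH (g theta))))).
- by move=> N; apply: cmeasurableZ; exact: trunc_measurable.
- by apply: cmeasurableM; [exact: spectral_form_measurable|exact: cexp_measurable].
- apply: aeW => t Dt; under eq_fun do rewrite mulrA mulrC.
  by rewrite mulrC; apply: ccvgMl; apply: spectral_form_cvg => //; [exact: fin|exact: gin].
- have i2 : leb.-integrable D (EFin \o (fun t => normH (f t) * normH (g t))).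
    by apply: eq_integrable i1 => // t _; rewrite /comp conj_real -rmorphM.
  have i3 : leb.-integrable D (EFin \o (fun t => HStotal * (normH (f t) * normH (g t)))).
    by rewrite /comp; under eq_fun do rewrite EFinM; exact: integrableZl.
  by rewrite /comp; under eq_fun do rewrite EFinM; exact: integrableZl.
- apply: aeW => t N Dt; rewrite normcM normc_real ger0_norm// ler_wpM2l//.
  exact: trunc_bound.
Qed.

(** Orthogonality of the exponentials: on trigonometric polynomials with
    coefficients in H the truncated form is a finite double sum. *)
Lemma trunc_ip_trigpoly K j (a b : int -> R -> R[i]) N M :
  (forall k, inH (a k)) -> (forall k, inH (b k)) -> (N + M + absz j <= K)%N ->
  trunc_ip K j (fun theta u => zsum N (fun k => a k u * expi (k%:~R * theta)))
               (fun theta u => zsum M (fun l => b l u * expi (l%:~R * theta))) =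
  (2 * pi)%:C * zsum N (fun k => zsum M (fun l => dotH (C (k - l + j) (a k)) (b l))).
Proof.
move=> ha hb NMK.
have Cin h x : inH x -> inH (C h x) by have [q _ _] := bC h; exact: q.
have pt h t : dotH (C h (fun u => zsum N (fun k => a k u * expi (k%:~R * t))))
     (fun u => zsum M (fun l => b l u * expi (l%:~R * t))) =
    \sum_(k < N.*2.+1) \sum_(l < M.*2.+1) dotH (C h (a (k%:Z - N%:Z))) (b (l%:Z - M%:Z)) *
      expi ((k%:Z - N%:Z - (l%:Z - M%:Z))%:~R * t).
  have -> : (fun u => zsum N (fun k => a k u * expi (k%:~R * t))) =
      (fun u => \sum_(k < N.*2.+1) expi ((k%:Z - N%:Z)%:~R * t) * a (k%:Z - N%:Z) u).
    by apply/funext => u; apply: eq_bigr => k _; rewrite mulrC.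
  have -> : (fun u => zsum M (fun k => b k u * expi (k%:~R * t))) =
      (fun u => \sum_(k < M.*2.+1) expi ((k%:Z - M%:Z)%:~R * t) * b (k%:Z - M%:Z) u).
    by apply/funext => u; apply: eq_bigr => k _; rewrite mulrC.
  rewrite form_sum//; last by apply: inH_sum => k; exact: inHZ.
  apply: eq_bigr => k _; rewrite dotH_sumr//; last 2 first.
  - by move=> l; exact: inHZ.
  - exact: Cin.
  rewrite mulr_sumr; apply: eq_bigr => l _; rewrite dotHZr//; last exact: Cin.
  rewrite (expi_int_add (k%:Z - N%:Z) (- (l%:Z - M%:Z))) -(expi_int_conj (l%:Z - M%:Z)).
  by rewrite [LHS]mulrA; exact: mulrC.
have integrand t : trunc_form K (fun theta u => zsum N (fun k => a k u * expi (k%:~R * theta)))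
      (fun theta u => zsum M (fun l => b l u * expi (l%:~R * theta))) t * expi (j%:~R * t) =
    \sum_(k < N.*2.+1) \sum_(l < M.*2.+1) \sum_(h < K.*2.+1)
      dotH (C (h%:Z - K%:Z) (a (k%:Z - N%:Z))) (b (l%:Z - M%:Z)) *
      expi ((k%:Z - N%:Z - (l%:Z - M%:Z) + j - (h%:Z - K%:Z))%:~R * t).
  rewrite /trunc_form /zsum mulr_suml.
  under eq_bigr do rewrite pt !mulr_suml.
  rewrite exchange_big; apply: eq_bigr => k _.
  under eq_bigr do rewrite !mulr_suml.
  rewrite exchange_big; apply: eq_bigr => l _; apply: eq_bigr => h _.
  rewrite -mulNr -mulrNz -[LHS]mulrA -[LHS]mulrA -!expi_int_add.
  by rewrite (_ : _ + (_ + j) = k%:Z - N%:Z - (l%:Z - M%:Z) + j - (h%:Z - K%:Z)); last ring.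
have ce k : cintegrable leb D (fun t => expi (k%:~R * t)).
  have := cL2_cintegrable mD (cL2_cexp k%:~R) (cL2_cexp (0 : int)%:~R).
  by under [in X in X -> _]eq_fun do rewrite mul0r expi0 rmorph1 mulr1.
rewrite /trunc_ip; under eq_cintegral do rewrite integrand.
rewrite cintegral_sum//; last first.
  by move=> k; apply: cintegrable_sum => // l; apply: cintegrable_sum => // h; exact: cintegrableZ.
rewrite [in RHS]/zsum mulr_sumr; apply: eq_bigr => k _.
rewrite cintegral_sum//; last first.
  by move=> l; apply: cintegrable_sum => // h; exact: cintegrableZ.
rewrite mulr_sumr; apply: eq_bigr => l _.
rewrite cintegral_sum//; last by move=> h; exact: cintegrableZ.
set k' := k%:Z - N%:Z; set l' := l%:Z - M%:Z.
have -> : \sum_(h < K.*2.+1) cintegral leb D (fun t => dotH (C (h%:Z - K%:Z) (a k')) (b l') *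
      expi ((k' - l' + j - (h%:Z - K%:Z))%:~R * t)) =
    zsum K (fun h => if h == k' - l' + j then (2 * pi)%:C * dotH (C h (a k')) (b l') else 0).
  apply: eq_bigr => h _; rewrite cintegralZ// cintegral_cexp.
  have -> : (k' - l' + j - (h%:Z - K%:Z) == 0) = (h%:Z - K%:Z == k' - l' + j).
    by rewrite subr_eq0 eq_sym.
  by case: ifP => _; rewrite ?mulr0// mulrC.
rewrite zsum_pick//.
by rewrite /k' /l'; move: (ltn_ord k) (ltn_ord l) NMK; clear -k l; lia.
Qed.

Let hsum M (f : int -> R) : R := \sum_(k < M.*2.+1) f (k%:Z - M%:Z).

Let hsumS M (f : int -> R) : hsum M.+1 f = f (- (M.+1)%:Z) + hsum M f + f (M.+1)%:Z.
Proof.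
rewrite /hsum doubleS big_ord_recr big_ord_recl/= sub0r; congr (_ + _ + f _); last by clear; lia.
by apply: eq_bigr => k _; congr f; rewrite /= /bump /=; clear; lia.
Qed.

Let hsum_tail (eps : R) : 0 < eps -> exists N, forall M, (N <= M)%N -> hsum M hs - hsum N hs <= eps.
Proof.
move=> eps0.
have nd : nondecreasing_seq (hsum ^~ hs).
  apply/nondecreasing_seqP => M; rewrite hsumS.
  by rewrite -addrA addrCA lerDl addr_ge0.
have ub : has_ubound (range (hsum ^~ hs)) by exists HStotal => _ [M _ <-]; exact: HStotal_bound.
have cv := nondecreasing_cvgn nd ub; set l := sup _ in cv.
have le_l M : hsum M hs <= l by apply: ub_le_sup => //; exists M.
move/cvgrPdist_le : cv => /(_ _ eps0)[N _ hN]; exists N => M NM.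
have := hN N (leqnn N); rewrite ger0_norm ?subr_ge0//; apply: le_trans.
by rewrite lerD2r.
Qed.

Let hsum_split N M (f : int -> R) : (forall h, f h <= 2) -> (N <= M)%N ->
  hsum M (fun h => hs h * f h) <=
  hsum N (fun h => hs h * f h) + 2 * (hsum M hs - hsum N hs).
Proof.
move=> f2 /subnK <-; elim: (M - N)%N => [|n IH]; first by rewrite add0n subrr mulr0 addr0.
rewrite addSn !hsumS; set a := hsum _ _ in IH *; set b := hsum N _ in IH *.
have u h : hs h * f h <= hs h * 2 by rewrite ler_wpM2l.
have := lerD (lerD (u (- (n + N).+1%:Z)) IH) (u (n + N).+1%:Z).
by move/le_trans; apply; rewrite le_eqVlt; apply/orP; left; apply/eqP; ring.
Qed.

(** Uniform modulus of continuity at frequency 0: the finitely many terms that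
    carry most of the mass vary at most like r = |e^(i theta) - 1|, and
    K r <= eps / 2 + K^2 r^2 / (2 eps) turns this into a multiple of
    r^2 = 2 - 2 cos theta, the quantity that the Fejer kernel absorbs. *)
Lemma spectral_form_modulus (eps : R) : 0 < eps -> exists2 c : R, 0 <= c &
  forall theta x, D theta -> inH x ->
  normc (dotH (F theta x) x - dotH (F 0 x) x) <= (eps + c * (2 - 2 * cos theta)) * nsqH x.
Proof.
move=> eps0; have e4 : 0 < eps / 4 by rewrite divr_gt0.
have [N hN] := hsum_tail e4; pose K := N%:R * HStotal.
have K0 : 0 <= K by rewrite mulr_ge0 ?HStotal_ge0.
exists (K ^+ 2 / (2 * eps)); first by rewrite divr_ge0 ?sqr_ge0 ?mulr_ge0 ?(ltW eps0).
move=> theta x Dt hx.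
have D0 : D 0 by rewrite /pi_itv /= in_itv /= oppr_le0 pi_ge0.
set r := normc (expi theta - 1).
pose f h := normc (expi (- (h%:~R * theta)) - 1).
have f2 h : f h <= 2.
  by rewrite /f (le_trans (le_normcD _ _))// normcN normc_expi normc1.
have fN h : (absz h <= N)%N -> f h <= N%:R * r.
  move=> hn; have -> : f h = normc (expi ((absz h)%:R * theta) - 1).
    rewrite /f; case: h {hn} => n //=.
      by rewrite expiN -normc_conj rmorphB rmorph1/= conjCK.
    by rewrite NegzE mulrNz mulNr opprK.
  apply: (le_trans (normc_expi_sub1 _ _)); rewrite ler_wpM2r ?normc_ge0//.
  by rewrite ler_nat.
have cv := ccvgD (ccvg_shift N (spectral_form_cvg Dt hx hx))
  (ccvgMl (k := -1) (ccvg_shift N (spectral_form_cvg D0 hx hx))).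
rewrite -mulN1r; apply: (ccvg_normc_le cv) => n.
set M := (n + N)%N; have NM : (N <= M)%N by exact: leq_addl.
rewrite mulN1r -mulrBr.
have -> : zsum M (fun h => dotH (C h x) x * expi (- (h%:~R * theta))) -
    zsum M (fun h => dotH (C h x) x * expi (- (h%:~R * 0))) =
    zsum M (fun h => dotH (C h x) x * (expi (- (h%:~R * theta)) - 1)).
  rewrite /zsum -sumrB; apply: eq_bigr => k _.
  by rewrite mulr0 oppr0 expi0 mulrBr.
rewrite normcM normc_real ger0_norm ?invr_ge0 ?(ltW twopi_gt0)//.
have p1 : (2 * pi)^-1 <= 1 :> R.
  by rewrite invf_le1 ?twopi_gt0//; have := pi_ge2 R; lra.
apply: (le_trans (ler_piMl (normc_ge0 _) p1)).
apply: (le_trans (normc_sum _ _ _)).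
apply: (@le_trans _ _ (hsum M (fun h => hs h * f h) * nsqH x)).
  rewrite /hsum mulr_suml; apply: ler_sum => k _; rewrite normcM.
  rewrite mulrAC; apply: ler_wpM2r; first exact: normc_ge0.
  by rewrite -sqr_normH expr2 mulrA; exact: form_bound.
apply: ler_wpM2r; first by rewrite -sqr_normH sqr_ge0.
apply: (le_trans (hsum_split f2 NM)).
have t1 : hsum N (fun h => hs h * f h) <= K * r.
  apply: (@le_trans _ _ (hsum N hs * (N%:R * r))).
    rewrite /hsum mulr_suml; apply: ler_sum => k _; apply: ler_wpM2l => //.
    by apply: fN; move: (ltn_ord k); clear; lia.
  rewrite mulrA ler_wpM2r ?normc_ge0// mulrC ler_wpM2l//; exact: HStotal_bound.
have t2 := hN M NM; rewrite -sqr_normc_expi_sub1 -/r.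
have t3 : K * r <= eps / 2 + K ^+ 2 / (2 * eps) * r ^+ 2.
  rewrite -subr_ge0.
  have -> : eps / 2 + K ^+ 2 / (2 * eps) * r ^+ 2 - K * r = (eps - K * r) ^+ 2 / (2 * eps).
    by field; rewrite gt_eqF.
  by rewrite divr_ge0 ?sqr_ge0 ?mulr_ge0 ?(ltW eps0).
lra.
Qed.

End SpectralForm.

(** * Eigenvalues and Weyl's inequality *)

Section SpectralRepresentations.
Context {R : realType}.
Local Notation leb := (@lebesgue_measure R).
Local Notation U := (@unit_itv R).
Local Notation op := ((R -> R[i]) -> R -> R[i]).
Implicit Types (x y : R -> R[i]) (A B : op) (lam mu : nat -> R) (ph ps : nat -> R -> R[i]).
Local Hint Resolve measurable_unit_itv : core.

Lemma spectral_repr_form A lam ph x y : spectral_representation A lam ph ->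
  inH (A x) -> inH x -> inH y ->
  ccvg (fun n => \sum_(k < n) (lam k)%:C * dotH x (ph k) * dotH (ph k) y) (dotH (A x) y).
Proof.
move=> [_ _ [ph2 _] cv] hAx hx hy.
pose s n u := \sum_(m < n) (lam m)%:C * dotH x (ph m) * ph m u.
have hs n : inH (s n) by apply: inH_sum => k; exact: inHZ.
have E n : dotH (s n) y = \sum_(k < n) (lam k)%:C * dotH x (ph k) * dotH (ph k) y.
  rewrite dotH_suml//; last by move=> k; exact: inHZ.
  by apply: eq_bigr => k _; rewrite dotHZl.
under eq_fun do rewrite -E.
apply: (@ip_cvgl _ _ _ leb U measurable_unit_itv _ _ _ hs hAx hy).
have := proj1 (@sqnorm_cvg0P _ _ _ leb U measurable_unit_itv _
  (fun n => inHB hAx (hs n))) (cv x hx).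
apply: cvg_trans; rewrite (_ : (fun n => _) = (fun n => normsq leb U (fun u => A x u - s n u)))//.
apply/funext => n; congr fine; apply: eq_integral => u _.
by rewrite normcB_sym.
Qed.

(** The partial sums of the form are constant from rank k + 1 on. *)
Lemma eigen_form A lam ph k m : spectral_representation A lam ph ->
  inH (A (ph k)) -> dotH (A (ph k)) (ph m) = if m == k then (lam m)%:C else 0.
Proof.
move=> sp hA; have [_ _ [ph2 pho] _] := sp.
apply: (ccvg_near_cst (n0 := k.+1) (spectral_repr_form sp hA (ph2 k) (ph2 m))).
move=> n kn; rewrite (bigD1 (Ordinal kn))//= big1 ?addr0.
  by rewrite !pho eqxx mulr1 eq_sym; case: eqP => [->|]; rewrite ?mulr1 ?mulr0.
move=> j jk; rewrite !pho (_ : (k == j) = false) ?mulr0 ?mul0r//.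
by apply/eqP => kj; move/eqP: jk; apply; exact: val_inj.
Qed.

Lemma underdetermined_solution (n m : nat) (M : 'M[R[i]]_(n, m)) : (m < n)%N ->
  exists2 a : 'rV[R[i]]_n, a != 0 & a *m M = 0.
Proof.
move=> mn; have /rowV0Pn[a /sub_kermxP aM a0] : kermx M != 0.
  by rewrite kermx_eq0 /row_free; move: (rank_leq_col M); lia.
by exists a.
Qed.

(** Weyl's inequality, by min-max: among the combinations of the first m + 1
    eigenvectors of A some non-zero x is orthogonal to the first m eigenvectors
    of B; there the form of A is at least lam m |x|^2 and the form of B at most
    mu m |x|^2. *)
Lemma weyl_inequality A B lam mu ph ps (delta : R) m :
  spectral_representation A lam ph -> spectral_representation B mu ps ->
  (forall x, inH x -> inH (A x)) -> (forall x, inH x -> inH (B x)) ->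
  (forall x, inH x -> normc (dotH (A x) x - dotH (B x) x) <= delta * nsqH x) ->
  lam m <= mu m + delta.
Proof.
move=> spA spB hA hB AB; have [lam0 /nonincreasing_seqP lamd [ph2 pho] _] := spA.
have [mu0 /nonincreasing_seqP mud [ps2 pso] _] := spB.
have [a a0 aM] := underdetermined_solution
  (\matrix_(j < m.+1, i < m) dotH (ph j) (ps i)) (ltnSn m).
pose x u := \sum_(j < m.+1) a ord0 j * ph j u.
have hx : inH x by apply: inH_sum => j; exact: inHZ.
have xph k : dotH x (ph k) = \sum_(j < m.+1) if j == k :> nat then a ord0 j else 0.
  rewrite dotH_suml//; last by move=> j; exact: inHZ.
  by apply: eq_bigr => j _; rewrite dotHZl// pho; case: eqP => _; rewrite ?mulr1 ?mulr0.
have xphlt (j : 'I_m.+1) : dotH x (ph j) = a ord0 j.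
  rewrite xph (bigD1 j)//= eqxx big1 ?addr0// => i ij.
  by rewrite ifF//; apply/eqP => e; move/eqP: ij; apply; exact: val_inj.
have xphge k : (m < k)%N -> dotH x (ph k) = 0.
  move=> mk; rewrite xph big1// => j _; rewrite ifF//.
  by apply/eqP => e; move: (ltn_ord j); rewrite e; lia.
have xps k : (k < m)%N -> dotH x (ps k) = 0.
  move=> km; have := congr1 (fun v : 'rV[R[i]]_m => v ord0 (Ordinal km)) aM.
  rewrite !mxE => <-; rewrite dotH_suml//; last by move=> j; exact: inHZ.
  by apply: eq_bigr => j _; rewrite dotHZl// mxE.
set S : R := \sum_(j < m.+1) normc (a ord0 j) ^+ 2.
have S0 : 0 < S.
  rewrite lt0r sumr_ge0 ?andbT; last by move=> j _; exact: sqr_ge0.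
  apply: contra a0; rewrite psumr_eq0; last by move=> j _; exact: sqr_ge0.
  move=> /allP h; apply/eqP/rowP => j; rewrite mxE; apply: eq0_normc.
  by have /(_ (mem_index_enum j))/= := h j; rewrite expf_eq0 => /eqP.
have sqc z : z * z^* = (normc z ^+ 2)%:C :> R[i] by exact: mulc_conj.
have xx : nsqH x = S.
  apply: complexI; rewrite -dotHxx {1}/x dotH_suml//; last by move=> j; exact: inHZ.
  rewrite rmorph_sum; apply: eq_bigr => j _.
  by rewrite dotHZl// (dotH_conj hx (ph2 j)) xphlt sqc.
have AE : dotH (A x) x = (\sum_(j < m.+1) lam j * normc (a ord0 j) ^+ 2)%:C.
  apply: (ccvg_near_cst (n0 := m.+1) (spectral_repr_form spA (hA _ hx) hx hx)).
  move=> n mn; rewrite rmorph_sum -(subnKC mn) big_split_ord/= [X in _ + X]big1 ?addr0.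
    by apply: eq_bigr => j _; rewrite (dotH_conj hx (ph2 j)) xphlt -mulrA sqc -rmorphM.
  by move=> j _; rewrite xphge ?mulr0 ?mul0r// ltnS leq_addr.
have Alow : lam m * S <= \sum_(j < m.+1) lam j * normc (a ord0 j) ^+ 2.
  rewrite mulr_sumr; apply: ler_sum => j _; rewrite ler_wpM2r ?sqr_ge0//.
  by apply: lamd; rewrite -ltnS.
have Bup : complex.Re (dotH (B x) x) <= mu m * S.
  have /ccvgP h := spectral_repr_form spB (hB _ hx) hx hx.
  apply/ler_addgt0Pr => eps eps0.
  have [N hN] := proj1 (cvg0P (fun n => normc_ge0 _)) h _ eps0.
  apply: (@le_trans _ _ (complex.Re (\sum_(k < N) (mu k)%:C * dotH x (ps k) * dotH (ps k) x) + eps)).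
    rewrite -lerBlDl -Re_opp -Re_add; apply: (le_trans (le_trans (ler_norm _) (normc_Re_le _))).
    by rewrite normcB_sym; exact: hN.
  rewrite lerD2r.
  have -> : \sum_(k < N) (mu k)%:C * dotH x (ps k) * dotH (ps k) x =
      (\sum_(k < N) mu k * normc (dotH x (ps k)) ^+ 2)%:C.
    rewrite rmorph_sum; apply: eq_bigr => k _.
    by rewrite (dotH_conj hx (ps2 k)) -mulrA sqc -rmorphM.
  apply: (@le_trans _ _ (\sum_(k < N) mu m * normc (dotH x (ps k)) ^+ 2)).
    apply: ler_sum => k _; have [km|mk] := ltnP k m.
      by rewrite xps// normc0 expr0n !mulr0.
    by rewrite ler_wpM2r ?sqr_ge0//; exact: mud.
  by rewrite -mulr_sumr ler_wpM2l// -xx; exact: bessel_H.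
have := le_trans (ler_norm _) (normc_Re_le (dotH (A x) x - dotH (B x) x)).
move/le_trans => /(_ _ (AB x hx)); rewrite AE xx => hd.
rewrite -(ler_pM2r S0) mulrDl; apply: (le_trans Alow).
apply: le_trans (lerD Bup (lexx _)); rewrite -lerBlDl; apply: le_trans hd.
by rewrite Re_add Re_opp.
Qed.

End SpectralRepresentations.

(** * Covariances of the scores *)

Section ScoreProcess.
Context {R : realType} {d : measure_display} {Omega : measurableType d}.
Context (P : probability Omega R) (X : int -> Omega -> R -> R[i]).
Context (e : nat -> R -> R[i]) (F : R -> (R -> R[i]) -> R -> R[i]).
Context (lambda : nat -> R -> R) (phi : nat -> R -> R -> R[i]).
Local Notation leb := (@lebesgue_measure R).
Local Notation U := (@unit_itv R).
Local Notation D := (@pi_itv R).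
Local Notation mR := (measurableTypeR R).
Local Notation C := (autocov_op P X).
Local Notation L2P := (cL2 P setT).
Hypothesis (HX : H_process X) (Hstat : weakly_stationary P X).
Hypothesis (He : orthonormal_basisH e).
Hypothesis (Hsum : (\esum_(h in [set: int]) HSnorm e (C h) < +oo)%E).
Hypothesis (HF : spectral_density_op e C F).
Hypothesis (Hspec : forall theta : R, D theta ->
  spectral_representation (F theta) (fun m => lambda m theta) (fun m => phi m theta)).
Hypothesis (Hphi : forall m, cmeasurable (U `*` D) (fun q : mR * mR => phi m q.2 q.1)).
Local Hint Resolve measurable_unit_itv : core.
Local Hint Resolve measurable_pi_itv : core.
Let mU := @measurable_unit_itv R.
Let mD := @measurable_pi_itv R.
Let mT := @measurableT d Omega.
Implicit Types (m : nat) (s t l k h : int).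

Let bC h : bounded_linearH (C h).
Proof. exact: autocov_op_bounded. Qed.

Let Fin theta x : D theta -> inH x -> inH (F theta x).
Proof. by move=> Dt hx; have [[q _ _] _] := HF Dt; exact: q. Qed.

Let phi_in m theta : D theta -> inH (phi m theta).
Proof. by move=> Dt; have [_ _ [q _] _] := Hspec Dt; exact: q. Qed.

Lemma eigenfunction_field m : fieldH (phi m).
Proof.
split; last 1 first.
- rewrite (eq_integral (fun=> 1%:E)); last first.
    move=> t /set_mem Dt; rewrite sqnormHE; last exact: phi_in.
    have [_ _ [_ q] _] := Hspec Dt; have := q m m; rewrite dotHxx eqxx => /(congr1 (@complex.Re R)) /= ->.
    by [].
  rewrite (integral_cst leb mD) mul1e. by have := ltry (2 * pi : R); rewrite -lebesgue_pi_itv.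
- apply: (@cmeasurable_comp R _ _ (mR * mR)%type (mR * mR)%type (D `*` U) (U `*` D)
    (fun q => phi m q.2 q.1) (fun q => (q.2, q.1))) => //.
  + exact: measurableX.
  + by move=> q [].
  + by apply: measurable_funTS; exact: measurable_swap.
- by move=> t Dt; exact: phi_in.
Qed.

Let phiF := eigenfunction_field.

Let filter_in m l : inH (fpc_filter phi m l).
Proof. exact: (fpc_filter_inH (phiF m)). Qed.

Let coord t l m w := dotH (X (t - l) w) (fpc_filter phi m l).

Let coord_L2 t l m : L2P (coord t l m).
Proof. exact: (coordinate_L2 HX Hstat _ (filter_in m l)). Qed.

Lemma score_psum_L2 m t N : L2P (score_psum X phi m t N).
Proof. by apply: (cL2_sum mT) => k; exact: coord_L2. Qed.

Lemma score_psum_mean m t N : cE P (score_psum X phi m t N) = 0.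
Proof.
rewrite /cE /score_psum /zsum cintegral_sum//; last first.
  move=> k; have := cL2_cintegrable mT (coord_L2 t (k%:Z - N%:Z) m) (cL2_cst P 1).
  by under [in X in X -> _]eq_fun do rewrite rmorph1 mulr1.
by rewrite big1// => k _; exact: (coordinate_mean HX Hstat _ (filter_in m _)).
Qed.

(** The covariance of the scores m and m' at lag j, in the frequency domain. *)
Definition cross_spectral m m' j : R[i] :=
  cintegral leb D (fun theta => dotH (F theta (phi m' theta)) (phi m theta) * expi (j%:~R * theta)).

Let err m N := fieldnorm (fun theta u => phi m theta u - filter_psum phi m N theta u).

Let err_ge0 m N : 0 <= err m N. Proof. exact: sqrtr_ge0. Qed.

(** The covariances of the coordinates, summed over both filters, are the double
    sum that the orthogonality of the exponentials produces. *)
Lemma score_psum_ip m m' t s N M K : (M + N + absz (t - s)%R <= K)%N ->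
  ip P setT (score_psum X phi m t N) (score_psum X phi m' s M) =
  ((2 * pi)^-1)%:C * trunc_ip C K (t - s) (filter_psum phi m' M) (filter_psum phi m N).
Proof.
move=> MNK; rewrite (trunc_ip_trigpoly bC (filter_in m')
  (filter_in m) MNK).
rewrite mulrA -rmorphM mulVf ?gt_eqF ?twopi_gt0// mul1r.
rewrite /score_psum (ip_suml mT _ (fun k : 'I__ => coord_L2 t (k%:Z - N%:Z) m)
  (score_psum_L2 m' s M)).
rewrite [RHS]exchange_big; apply: eq_bigr => l _.
rewrite (ip_sumr mT _ (fun k : 'I__ => coord_L2 s (k%:Z - M%:Z) m') (coord_L2 t _ m)).
apply: eq_bigr => k _; rewrite (coordinate_covariance HX Hstat _ _ (filter_in m _) (filter_in m' _)).
rewrite (_ : t - (l%:Z - N%:Z) - (s - (k%:Z - M%:Z)) = k%:Z - M%:Z - (l%:Z - N%:Z) + (t - s))//.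
by clear; ring.
Qed.

(** The error of the covariances of the partial sums is controlled by the
    errors of the Fourier partial sums of the two eigenfunctions. *)
Lemma score_covariance_bound m m' t s N M :
  normc (ip P setT (score_psum X phi m t N) (score_psum X phi m' s M) - cross_spectral m m' (t - s)) <=
  (2 * pi)^-1 * HStotal e C *
  (err m' M * fieldnorm (phi m) + fieldnorm (phi m') * err m N + err m' M * err m N).
Proof.
set j := t - s; set z := ip _ _ _ _; set K0 := (M + N + absz j)%N.
pose p := filter_psum phi m N; pose p' := filter_psum phi m' M.
have hp : fieldH p by exact: (filter_psum_field (phiF m) N).
have hp' : fieldH p' by exact: (filter_psum_field (phiF m') M).
have ph := phiF m; have ph' := phiF m'.
have cv := ccvg_shift K0 (trunc_ip_cvg He bC HF Hsum (j := j) ph' ph : ccvg _ (cross_spectral m m' j)).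
have cv2 := ccvgD cv (@ccvg_cst R (-1 * z)).
rewrite normcB_sym -mulN1r; apply: (ccvg_normc_le cv2) => n.
have -> : z = ((2 * pi)^-1)%:C * trunc_ip C (n + K0) j p' p.
  by apply: score_psum_ip; exact: leq_addl.
rewrite mulN1r -mulrBr normcM normc_real ger0_norm ?invr_ge0 ?(ltW twopi_gt0)//.
rewrite -mulrA ler_wpM2l ?invr_ge0 ?(ltW twopi_gt0)//.
rewrite (trunc_ip_diff He bC Hsum _ _ ph' hp' ph hp).
have b := trunc_ip_bound He bC Hsum (n + K0) j.
apply: (le_trans (le_normcD _ _)); rewrite normcN mulrDr; apply: lerD; last first.
  exact: (b _ _ (fieldB ph' hp') (fieldB ph hp)).
apply: (le_trans (le_normcD _ _)); rewrite mulrDr; apply: lerD.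
  exact: (b _ _ (fieldB ph' hp') ph).
exact: (b _ _ ph' (fieldB ph hp)).
Qed.

Let err_cvg m : err m N @[N --> \oo] --> 0.
Proof. exact: (filter_psum_cvg (phiF m)). Qed.

Lemma score_covariance_near m m' t s (eps : R) : 0 < eps ->
  exists N0, forall N M, (N0 <= N)%N -> (N0 <= M)%N ->
  normc (ip P setT (score_psum X phi m t N) (score_psum X phi m' s M) -
         cross_spectral m m' (t - s)) <= eps.
Proof.
move=> eps0; set c := (2 * pi)^-1 * HStotal e C.
have c0 : 0 <= c by rewrite mulr_ge0 ?invr_ge0 ?(ltW twopi_gt0) ?HStotal_ge0.
set x := fieldnorm (phi m); set y := fieldnorm (phi m').
have x0 : 0 <= x by exact: sqrtr_ge0.
have y0 : 0 <= y by exact: sqrtr_ge0.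
set k := c * (x + y + 1) + 1.
have k0 : 0 < k by apply: ltr_wpDl ltr01; exact: mulr_ge0 c0 (addr_ge0 (addr_ge0 x0 y0) ler01).
(* With del <= 1 the quadratic error b a is at most del. *)
pose del := Num.min 1 (eps / k).
have del0 : 0 < del by rewrite lt_min ltr01 divr_gt0.
have [N1 h1] := proj1 (cvg0P (err_ge0 m)) (err_cvg m) _ del0.
have [N2 h2] := proj1 (cvg0P (err_ge0 m')) (err_cvg m') _ del0.
exists (maxn N1 N2) => N M; rewrite !geq_max => /andP[/h1 a1 _] /andP[_ /h2 a2].
apply: (le_trans (score_covariance_bound m m' t s N M)); rewrite -/c -/x -/y.
move: a1 a2 (err_ge0 m N) (err_ge0 m' M); move: (err m N) (err m' M) => a b a1 a2 a0 b0.
have d1 : del <= 1 by rewrite ge_min lexx.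
have dk : del * k <= eps by rewrite -ler_pdivlMr// ge_min lexx orbT.
apply: le_trans dk; apply: (@le_trans _ _ (c * (del * x + y * del + del * 1))).
  apply: (ler_wpM2l c0); apply: (lerD (lerD (ler_wpM2r x0 a2) (ler_wpM2l y0 a1))).
  exact: (ler_pM b0 a0 a2 (le_trans a1 d1)).
have -> : c * (del * x + y * del + del * 1) = del * k - del by rewrite /k; ring.
by rewrite gerBl ltW.
Qed.

(** Loeve's criterion: joint convergence of the covariances makes the partial
    sums a Cauchy sequence. *)
Lemma score_cvg m t : exists Y, L2P Y /\
  normsq P setT (fun w => score_psum X phi m t N w - Y w) @[N --> \oo] --> 0.
Proof.
have S2 := score_psum_L2 m t.
apply: (L2_complete mT S2) => eps eps0.
have e4 : 0 < eps / 4 by rewrite divr_gt0.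
have [N0 hN] := score_covariance_near m m t t e4; exists N0 => N M NN NM.
have := normsqB mT (S2 N) (S2 M); rewrite -!(ip_normsq _ mT).
set z := cross_spectral m m (t - t) in hN.
have := hN N N NN NN; have := hN N M NN NM; have := hN M N NM NN; have := hN M M NM NM.
set a := ip _ _ _ _; set b := ip _ _ _ _; set c := ip _ _ _ _; set f := ip _ _ _ _.
move=> h1 h2 h3 h4 E.
have -> : normsq P setT (fun w => score_psum X phi m t N w - score_psum X phi m t M w) =
   complex.Re ((f - z) + (z - c) + (z - b) + (a - z)).
  by rewrite (_ : _ + _ = f - c - b + a); [rewrite -E (ip_normsq _ mT)|ring].
apply: (le_trans (le_trans (ler_norm _) (normc_Re_le _))).
have -> : eps = eps / 4 + eps / 4 + eps / 4 + eps / 4 by lra.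
apply: (le_trans (le_normcD _ _)); apply: lerD h1.
apply: (le_trans (le_normcD _ _)); rewrite (normcB_sym z b); apply: lerD h2.
by apply: (le_trans (le_normcD _ _)); rewrite (normcB_sym z c); exact: lerD.
Qed.

Lemma ms_cvgP m t Y : ms_cvg P (score_psum X phi m t) Y <->
  L2P Y /\ normsq P setT (fun w => score_psum X phi m t N w - Y w) @[N --> \oo] --> 0.
Proof.
have h (Y2 : L2P Y) := @sqnorm_cvg0P _ _ _ P setT mT _ (fun n => cL2B mT (score_psum_L2 m t n) Y2).
by split => -[Y2 c]; split => //; apply/(h Y2).
Qed.

Lemma score_mean m t Y : ms_cvg P (score_psum X phi m t) Y -> cE P Y = 0.
Proof.
move=> /ms_cvgP[Y2 cv].
have E Z : cE P Z = ip P setT Z (fun=> 1).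
  by rewrite /cE /ip; congr cintegral; apply/funext => w; rewrite rmorph1 mulr1.
have := ip_cvgl mT (score_psum_L2 m t) Y2 (cL2_cst P 1) cv; rewrite -E => h.
apply: (ccvg_near_cst (n0 := 0%N) h) => n _; rewrite -E; exact: score_psum_mean.
Qed.

(** Covariances of the scores are the limits of the covariances of the partial
    sums, by continuity of the inner product. *)
Lemma score_ip m m' t s Y Y' :
  ms_cvg P (score_psum X phi m t) Y -> ms_cvg P (score_psum X phi m' s) Y' ->
  ip P setT Y Y' = cross_spectral m m' (t - s).
Proof.
move=> /ms_cvgP[Y2 cv] /ms_cvgP[Y2' cv'].
have h := ip_cvg mT (score_psum_L2 m t) (score_psum_L2 m' s) Y2 Y2' cv cv'.
apply: (ccvg_unique h); apply/ccvgP; apply/cvg0P => [n|eps eps0]; first exact: normc_ge0.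
by have [N0 hN] := score_covariance_near m m' t s eps0; exists N0 => n Nn; exact: hN.
Qed.

Lemma eigenvalue_bound m theta : D theta ->
  0 <= lambda m theta <= (2 * pi)^-1 * HStotal e C.
Proof.
move=> Dt; have sp := Hspec Dt; have [l0 _ [_ pho] _] := sp; rewrite l0 /=.
have hx := phi_in m Dt.
have := spectral_form_bound He bC HF Hsum Dt hx hx.
rewrite (eigen_form m sp (Fin Dt hx)) eqxx normc_real ger0_norm// -expr2 sqr_normH.
have -> : nsqH (phi m theta) = 1 by apply: complexI; rewrite -dotHxx pho eqxx.
by rewrite mulr1.
Qed.

Lemma eigenvalue_measurable m : measurable_fun D (lambda m).
Proof.
have [+ _] := spectral_form_measurable He bC HF (phiF m) (phiF m).
apply: eq_measurable_fun => t /set_mem Dt.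
by rewrite (eigen_form m (Hspec Dt) (Fin Dt (phi_in m Dt))) eqxx.
Qed.

(** The eigenfunctions diagonalize the form at every frequency. *)
Lemma cross_spectralE m m' j : cross_spectral m m' j =
  if m == m' then cintegral leb D (fun theta => (lambda m theta)%:C * expi (j%:~R * theta)) else 0.
Proof.
rewrite /cross_spectral; case: ifPn => [/eqP ->|mm'].
  apply: eq_cintegral => t /set_mem Dt.
  by rewrite (eigen_form m' (Hspec Dt) (Fin Dt (phi_in m' Dt))) eqxx.
rewrite -[RHS](cintegral0 leb mD); apply: eq_cintegral => t /set_mem Dt.
by rewrite (eigen_form m (Hspec Dt) (Fin Dt (phi_in m' Dt))) (negbTE mm') mul0r.
Qed.

(** By Weyl's inequality in both directions, the eigenvalues inherit the modulus
    of continuity of the form. *)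
Lemma eigenvalue_modulus m (eps : R) : 0 < eps -> exists2 c : R, 0 <= c &
  forall theta, D theta ->
  `|lambda m theta - lambda m 0| <= eps + c * (2 - 2 * cos theta).
Proof.
move=> eps0; have [c c0 h] := spectral_form_modulus He bC HF Hsum eps0; exists c => // t Dt.
have D0 : D 0 by rewrite /pi_itv /= in_itv /= oppr_le0 pi_ge0.
have F0 x : inH x -> inH (F 0 x) by exact: Fin.
have Ft x : inH x -> inH (F t x) by exact: Fin.
have w1 := weyl_inequality m (Hspec Dt) (Hspec D0) Ft F0 (fun x hx => h t x Dt hx).
have w2 := weyl_inequality m (Hspec D0) (Hspec Dt) F0 Ft
  (fun x hx => eq_ind_r (fun z => z <= _) (h t x Dt hx) (normcB_sym _ _)).
rewrite ler_norml; apply/andP; split; last by rewrite lerBlDl; exact: w1.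
by rewrite lerNl opprB lerBlDl; exact: w2.
Qed.

Lemma covmxE p (Z W : Omega -> 'cV[R[i]]_p) i j :
  covmx P Z W i j = ccov P (fun w => Z w i ord0) (fun w => W w j ord0).
Proof.
rewrite /covmx /ccov mxE; congr cE; apply/funext => w.
by rewrite mxE big_ord1 !mxE.
Qed.

Section LimitScores.
Variable Y : nat -> int -> Omega -> R[i].
Hypothesis HY : forall m t, ms_cvg P (score_psum X phi m t) (Y m t).

Let Y_L2 m t : L2P (Y m t).
Proof. by have [] := HY m t. Qed.

(** Each term is the covariance of two coordinates of the process.  The inner
    series is therefore the inner product of the score with one coordinate, and
    the outer series the inner product of the score with itself. *)
Lemma score_second_moment m t : exists2 s : int -> R[i],
  forall l : int, zseries_cvg
    (fun k => dotH (autocov_op P X (l - k) (fpc_filter phi m l)) (fpc_filter phi m k)) (s l)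
  & zseries_cvg s (\int[P]_w (normc (Y m t w) ^+ 2))%:C.
Proof.
have /ms_cvgP[_ cv] := HY m t.
exists (fun l => ip P setT (Y m t) (coord t l m)) => [l|].
  have := ip_cvgl mT (score_psum_L2 m t) (Y_L2 m t) (coord_L2 t l m) cv.
  rewrite (_ : (fun n => ip _ _ _ _) = (fun N => zsum N
    (fun k => dotH (C (l - k) (fpc_filter phi m l)) (fpc_filter phi m k))))//.
  apply/funext => N; rewrite /score_psum /zsum.
  rewrite (ip_suml mT _ (fun k : 'I__ => coord_L2 t (k%:Z - N%:Z) m) (coord_L2 t l m)).
  apply: eq_bigr => k _.
  rewrite (coordinate_covariance HX Hstat _ _ (filter_in m _) (filter_in m _)).
  by rewrite (_ : t - (k%:Z - N%:Z) - (t - l) = l - (k%:Z - N%:Z))//; clear; ring.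
have := ip_cvgr mT (score_psum_L2 m t) (Y_L2 m t) (Y_L2 m t) cv.
rewrite (ip_normsq _ mT) normsqE.
rewrite (_ : (fun n => ip _ _ _ _) = (fun N => zsum N (fun l => ip P setT (Y m t) (coord t l m))))//.
apply/funext => N; rewrite /score_psum /zsum.
by rewrite (ip_sumr mT _ (fun k : 'I__ => coord_L2 t (k%:Z - N%:Z) m) (Y_L2 m t)).
Qed.

Lemma score_ccov m m' t s : ccov P (Y m t) (Y m' s) = cross_spectral m m' (t - s).
Proof.
rewrite -(score_ip (HY m t) (HY m' s)) /ccov (score_mean (HY m t)) (score_mean (HY m' s)).
by rewrite /cE /ip; congr cintegral; apply/funext => w; rewrite !subr0.
Qed.

Lemma score_vec_cov p t s : covmx P (score_vec Y p t) (score_vec Y p s) =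
  \matrix_(i < p, j < p) cross_spectral i j (t - s).
Proof.
have E i' r : (fun w => score_vec Y p r w i' ord0) = Y i' r.
  by apply/funext => w; exact: mxE.
by apply/matrixP => i j; rewrite covmxE !E score_ccov mxE.
Qed.

Lemma score_sum_cov p n i j :
  varmx P (fun w => \sum_(k < n) score_vec Y p (k.+1)%:Z w) i j =
  \sum_(k < n) \sum_(l < n) cross_spectral i j (k%:Z - l%:Z).
Proof.
rewrite /varmx covmxE.
have E (i' : 'I_p) : (fun w => (\sum_(k < n) score_vec Y p (k.+1)%:Z w) i' ord0) =
    (fun w => \sum_(k < n) Y i' (k.+1)%:Z w).
  by apply/funext => w; rewrite summxE; apply: eq_bigr => k _; rewrite mxE.
have S2 (i' : 'I_p) := cL2_sum mT (index_enum 'I_n) (fun k : 'I_n => Y_L2 i' (k.+1)%:Z).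
have E0 (i' : 'I_p) : cE P (fun w => \sum_(k < n) Y i' (k.+1)%:Z w) = 0.
  rewrite /cE (cintegral_sum mT).
    by rewrite big1// => k _; exact: score_mean (HY _ _).
  move=> k; have := cL2_cintegrable mT (Y_L2 i' (k.+1)%:Z) (cL2_cst P 1).
  by under [in X in X -> _]eq_fun do rewrite rmorph1 mulr1.
rewrite !E /ccov !E0 /cE.
have -> : (fun w => (\sum_(k < n) Y i (k.+1)%:Z w - 0) * (\sum_(k < n) Y j (k.+1)%:Z w - 0)^*) =
  (fun w => (\sum_(k < n) Y i (k.+1)%:Z w) * (\sum_(k < n) Y j (k.+1)%:Z w)^*).
  by apply/funext => w; rewrite !subr0.
rewrite -/(ip P setT _ _) (ip_suml mT _ (fun k : 'I_n => Y_L2 i (k.+1)%:Z) (S2 j)).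
apply: eq_bigr => k _.
rewrite (ip_sumr mT _ (fun k : 'I_n => Y_L2 j (k.+1)%:Z) (Y_L2 i _)).
apply: eq_bigr => l _; rewrite (score_ip (HY _ _) (HY _ _)).
by rewrite (_ : (k.+1)%:Z - (l.+1)%:Z = k%:Z - l%:Z)//; clear; lia.
Qed.

End LimitScores.

End ScoreProcess.

(** * The Fejer kernel *)

Section FejerKernel.
Context {R : realType}.
Local Notation leb := (@lebesgue_measure R).
Local Notation D := (@pi_itv R).
Let mD := @measurable_pi_itv R.

Definition fejer (n : nat) (x : R) : R :=
  n%:R^-1 * normc (\sum_(k < n) expi (k%:R * x)) ^+ 2.

Lemma fejer_ge0 n x : 0 <= fejer n x.
Proof. by rewrite mulr_ge0 ?invr_ge0 ?sqr_ge0. Qed.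

Lemma fejerE n x : (fejer n x)%:C =
  n%:R^-1 * \sum_(k < n) \sum_(l < n) expi ((k%:Z - l%:Z)%:~R * x).
Proof.
have -> : (fejer n x)%:C = n%:R^-1 * (normc (\sum_(k < n) expi (k%:R * x)) ^+ 2)%:C :> R[i].
  by rewrite rmorphM fmorphV rmorph_nat.
congr (_ * _); rewrite -mulc_conj conj_sum mulr_suml.
apply: eq_bigr => k _; rewrite mulr_sumr; apply: eq_bigr => l _.
by rewrite (expi_int_conj l%:Z) -(expi_int_add k%:Z).
Qed.

(** The geometric sum: |e^(ix) - 1|^2 times the kernel is |e^(inx) - 1|^2 / n. *)
Lemma fejer_decay n x : (2 - 2 * cos x) * fejer n x <= 4 / n%:R.
Proof.
rewrite -sqr_normc_expi_sub1 /fejer mulrCA -exprMn -normcM mulrC.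
rewrite ler_wpM2r ?invr_ge0//.
have -> : (expi x - 1) * (\sum_(k < n) expi (k%:R * x)) = expi (n%:R * x) - 1.
  elim: n => [|n IH]; first by rewrite big_ord0 mulr0 mul0r expi0 subrr.
  by rewrite big_ord_recr/= mulrDr IH -natr1 [in RHS]mulrDl mul1r expiD; ring.
have -> : 4 = 2 ^+ 2 :> R by ring.
rewrite ler_pXn2r ?nnegrE ?normc_ge0//.
by rewrite (le_trans (le_normcD _ _))// normcN normc_expi normc1.
Qed.

Section AgainstBounded.
Variables (a : R -> R) (M : R).
Hypothesis (ma : measurable_fun D a) (aM : forall x, D x -> `|a x| <= M).

Let a_cexp j : cintegrable leb D (fun x => (a x)%:C * expi (j%:~R * x)).
Proof.
apply: (le_cintegrable mD (g := fun=> M)).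
- by apply: cmeasurableM; [exact: cmeasurable_real|exact: cexp_measurable].
- by move=> x Dx; rewrite normcM normc_expi mulr1 normc_real aM.
- exact: integrable_pi_cst.
Qed.

Let integrand n x : (a x * fejer n x)%:C =
  \sum_(k < n) \sum_(l < n) n%:R^-1 * ((a x)%:C * expi ((k%:Z - l%:Z)%:~R * x)).
Proof.
have -> : (a x * fejer n x)%:C = (a x)%:C * (fejer n x)%:C by exact: rmorphM.
rewrite fejerE !mulr_sumr; apply: eq_bigr => k _.
by rewrite !mulr_sumr; apply: eq_bigr => l _; rewrite mulrCA.
Qed.

Lemma fejer_cintegrable n : cintegrable leb D (fun x => (a x * fejer n x)%:C).
Proof.
under eq_fun do rewrite integrand.
apply: (cintegrable_sum mD) => k; apply: (cintegrable_sum mD) => l.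
exact: (cintegrableZ mD _ (a_cexp _)).
Qed.

Lemma fejer_integral n : n%:R^-1 * \sum_(k < n) \sum_(l < n)
    cintegral leb D (fun x => (a x)%:C * expi ((k%:Z - l%:Z)%:~R * x)) =
  cintegral leb D (fun x => (a x * fejer n x)%:C).
Proof.
have i1 j := cintegrableZ mD n%:R^-1 (a_cexp j).
have -> : cintegral leb D (fun x => (a x * fejer n x)%:C) =
    cintegral leb D (fun x => \sum_(k < n) \sum_(l < n)
      n%:R^-1 * ((a x)%:C * expi ((k%:Z - l%:Z)%:~R * x))).
  by apply: eq_cintegral => x _; exact: integrand.
rewrite (cintegral_sum mD _ (fun k : 'I_n => cintegrable_sum mD _ (fun l : 'I_n => i1 (k%:Z - l%:Z)))).
rewrite mulr_sumr; apply: eq_bigr => k _.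
rewrite (cintegral_sum mD _ (fun l : 'I_n => i1 (k%:Z - l%:Z))).
by rewrite mulr_sumr; apply: eq_bigr => l _; rewrite (cintegralZ mD _ (a_cexp _)).
Qed.

End AgainstBounded.

Lemma fejer_integrable n : leb.-integrable D (EFin \o fejer n).
Proof.
have [+ _] := @fejer_cintegrable (fun=> 1) 1 (measurable_cst _) (fun x _ => eq_ind_r (fun z => z <= 1) (lexx 1) (normr1 _)) n.
by under [in X in X -> _]eq_fun do rewrite mul1r.
Qed.

Lemma fejer_mass n : (0 < n)%N -> \int[leb]_(x in D) fejer n x = 2 * pi.
Proof.
move=> n0; apply: complexI; rewrite -(cintegral_real _ mD).
have := @fejer_integral (fun=> 1) 1 (measurable_cst _) (fun x _ => eq_ind_r (fun z => z <= 1) (lexx 1) (normr1 _)) n.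
under [in X in _ = X -> _]eq_cintegral do rewrite mul1r.
move=> <-.
have -> : \sum_(k < n) \sum_(l < n) cintegral leb D (fun x => 1%:C * expi ((k%:Z - l%:Z)%:~R * x)) =
    n%:R * (2 * pi)%:C.
  rewrite mulr_natl -[n in RHS]card_ord -sumr_const; apply: eq_bigr => k _.
  rewrite (bigD1 k)//= big1 ?addr0.
    by under eq_cintegral do rewrite mul1r; rewrite cintegral_cexp subrr eqxx.
  move=> l lk; under eq_cintegral do rewrite mul1r; rewrite cintegral_cexp ifF//.
  by apply/negbTE; rewrite subr_eq0 eq_sym; move: lk; apply: contra => /eqP [] /val_inj ->.
by rewrite mulrA mulVf ?mul1r// pnatr_eq0 -lt0n.
Qed.

(** The kernel has mass 2 pi, and against eta + c (2 - 2 cos x) it contributes at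
    most 2 pi eta + 8 pi c / n. *)
Lemma fejer_cvg (a : R -> R) M : measurable_fun D a -> (forall x, D x -> `|a x| <= M) ->
  (forall eps, 0 < eps -> exists2 c, 0 <= c &
     forall x, D x -> `|a x - a 0| <= eps + c * (2 - 2 * cos x)) ->
  ccvg (fun n => n%:R^-1 * \sum_(k < n) \sum_(l < n)
    cintegral leb D (fun x => (a x)%:C * expi ((k%:Z - l%:Z)%:~R * x)))
  ((2 * pi)%:C * (a 0)%:C).
Proof.
move=> ma aM mod0; under eq_fun do rewrite (fejer_integral ma aM).
apply/ccvgP; apply/cvg0P => [n|eps eps0]; first exact: normc_ge0.
pose eta := eps / 2 / (2 * pi).
have eta0 : 0 < eta by rewrite !divr_gt0 ?twopi_gt0.
have [c c0 hc] := mod0 _ eta0.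
pose N := (Num.truncn (16 * c * pi / eps)).+1.
exists N => n Nn; have n0 : (0 < n)%N by exact: leq_trans Nn.
have bn : c * (4 / n%:R) * (2 * pi) <= eps / 2.
  have : 16 * c * pi / eps <= n%:R.
    apply: (le_trans (ltW (truncnS_gt _))); by rewrite ler_nat.
  rewrite ler_pdivrMr// => h.
  have np : 0 < n%:R :> R by rewrite ltr0n.
  have -> : c * (4 / n%:R) * (2 * pi) = 8 * c * pi / n%:R by field; rewrite gt_eqF.
  by rewrite ler_pdivrMr//; lra.
have i1 := fejer_cintegrable ma aM n.
have i0 : cintegrable leb D (fun x => (a 0 * fejer n x)%:C).
  exact: (@fejer_cintegrable (fun=> a 0) `|a 0| (measurable_cst _) (fun _ _ => lexx _)).
have -> : (2 * pi)%:C * (a 0)%:C = cintegral leb D (fun x => (a 0 * fejer n x)%:C).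
  rewrite (cintegral_real _ mD) (RintegralZl _ mD (fejer_integrable n)).
  by rewrite fejer_mass// -rmorphM mulrC.
rewrite -(cintegralB mD i1 i0).
pose g x := eta * fejer n x + c * (4 / n%:R).
have ig1 : leb.-integrable D (EFin \o (fun x => eta * fejer n x)).
  by rewrite /comp; under eq_fun do rewrite EFinM; apply: integrableZl => //; exact: fejer_integrable.
have ig : leb.-integrable D (EFin \o g).
  by rewrite /comp /g; under eq_fun do rewrite EFinD; apply: integrableD => //; exact: integrable_pi_cst.
have ib : cintegrable leb D (fun x => (a x * fejer n x)%:C - (a 0 * fejer n x)%:C).
  under eq_fun do rewrite -mulN1r; exact: (cintegrableD mD i1 (cintegrableZ mD (-1) i0)).
apply: (le_trans (cintegral_le_bound mD ib ig _)).
  move=> x Dx; rewrite -rmorphB -mulrBl normc_real normrM (ger0_norm (fejer_ge0 _ _)).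
  apply: (le_trans (ler_wpM2r (fejer_ge0 n x) (hc x Dx))).
  rewrite mulrDl lerD2l -mulrA; apply: ler_wpM2l => //; exact: fejer_decay.
rewrite /g RintegralD//; last exact: integrable_pi_cst.
rewrite RintegralZl//; last exact: fejer_integrable.
have E : fine (leb D) = 2 * pi by rewrite lebesgue_pi_itv.
rewrite fejer_mass// Rintegral_cst// -[X in _ + _ * X]/(fine (leb D)) E.
have -> : eta * (2 * pi) = eps / 2.
  by rewrite /eta mulfVK// lt0r_neq0// twopi_gt0.
lra.
Qed.

End FejerKernel.

(** * The dynamic functional principal component scores *)

Theorem proposition3 (R : realType) (d : measure_display)
    (Omega : measurableType d) (P : probability Omega R)
    (X : int -> Omega -> R -> R[i])
    (e : nat -> R -> R[i])
    (F : R -> (R -> R[i]) -> R -> R[i])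
    (lambda : nat -> R -> R) (phi : nat -> R -> R -> R[i])
    (HX : H_process X)
    (Hstat : weakly_stationary P X)
    (He : orthonormal_basisH e)
    (Hsum : (\esum_(h in [set: int]) HSnorm e (autocov_op P X h) < +oo)%E)
    (HF : spectral_density_op e (autocov_op P X) F)
    (Hspec : forall theta : R, pi_itv theta ->
       spectral_representation (F theta)
         (fun m => lambda m theta) (fun m => phi m theta))
    (Hphi : forall m, cmeasurable (unit_itv `*` pi_itv)
       (fun q : measurableTypeR R * measurableTypeR R => phi m q.2 q.1)) :
  (forall m t, exists Ymt : Omega -> R[i],
     ms_cvg P (score_psum X phi m t) Ymt) /\
  (forall Y : nat -> int -> Omega -> R[i],
     (forall m t, ms_cvg P (score_psum X phi m t) (Y m t)) ->
     [/\ (* (a) *)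
         forall m t,
           cE P (Y m t) = 0 /\
           exists2 s : int -> R[i],
             forall l : int, zseries_cvg
               (fun k => dotH (autocov_op P X (l - k) (fpc_filter phi m l))
                              (fpc_filter phi m k)) (s l)
             & zseries_cvg s
                 (\int[P]_w (normc (Y m t w) ^+ 2))%:C,
         (* (b) *)
         (forall (m m' : nat) (s t : int), m != m' -> ccov P (Y m t) (Y m' s) = 0) /\
         (forall p, exists2 CY : int -> 'M[R[i]]_p,
            forall h t : int, covmx P (score_vec Y p (t + h)) (score_vec Y p t) = CY h
            & forall h, is_diag_mx (CY h))
       & (* (c) *)
         forall p (i j : 'I_p),
           ccvg
             (fun n => (n%:R^-1 *:
                varmx P (fun w => \sum_(k < n) score_vec Y p (k.+1)%:Z w)) i j)
             (((2 * pi)%:C *: diag_mx (\row_(k < p) (lambda k 0)%:C)) i j)]).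

Proof.
split=> [m t|Y HY].
  have [Y [Y2 cv]] := score_cvg HX Hstat He Hsum HF Hspec Hphi m t.
  by exists Y; apply/(ms_cvgP HX Hstat Hspec Hphi).
have cov0 (m m' : nat) j : m != m' -> cross_spectral F phi m m' j = 0.
  by move=> mm'; rewrite (cross_spectralE HF Hspec) (negbTE mm').
split.
- move=> m t; split; first exact: (score_mean HX Hstat Hspec Hphi (HY m t)).
  exact: (score_second_moment HX Hstat Hspec Hphi HY).
- split=> [m m' s t mm'|p].
    by rewrite (score_ccov HX Hstat He Hsum HF Hspec Hphi HY) cov0.
  exists (fun h => \matrix_(i < p, j < p) cross_spectral F phi i j h).
    move=> h t; rewrite (score_vec_cov HX Hstat He Hsum HF Hspec Hphi HY).
    by rewrite (_ : t + h - t = h)// addrAC subrr add0r.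
  by move=> h; apply/is_diag_mxP => i j ij; rewrite mxE cov0.
- move=> p i j; rewrite !mxE.
  under eq_fun do rewrite mxE (score_sum_cov HX Hstat He Hsum HF Hspec Hphi HY).
  have [->|ij] := eqVneq i j; last first.
    rewrite mulr0n mulr0.
    have ij' : (i : nat) != j by [].
    have s0 n : n%:R^-1 * \sum_(k < n) \sum_(l < n) cross_spectral F phi i j (k%:Z - l%:Z) = 0.
      by rewrite big1 ?mulr0// => k _; rewrite big1// => l _; exact: cov0.
    by under eq_fun do rewrite s0; exact: ccvg_cst.
  rewrite mulr1n.
  have lambda_bounded theta : pi_itv theta ->
      `|lambda j theta| <= (2 * pi)^-1 * HStotal e (autocov_op P X).
    move=> Dt; have /andP[l0 lM] := eigenvalue_bound HX Hstat He Hsum HF Hspec j Dt.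
    by rewrite ger0_norm.
  have := fejer_cvg (eigenvalue_measurable HX Hstat He HF Hspec Hphi j)
    lambda_bounded (eigenvalue_modulus HX Hstat He Hsum HF Hspec j).
  have sE n : n%:R^-1 * \sum_(k < n) \sum_(l < n) cintegral lebesgue_measure pi_itv
      (fun theta => (lambda j theta)%:C * expi ((k%:Z - l%:Z)%:~R * theta)) =
      n%:R^-1 * \sum_(k < n) \sum_(l < n) cross_spectral F phi j j (k%:Z - l%:Z).
    congr (_ * _); apply: eq_bigr => k _; apply: eq_bigr => l _.
    by rewrite (cross_spectralE HF Hspec) eqxx.
  by under eq_fun do rewrite sE.
Qed.
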